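(* Let $\mathcal{T}_1,\mathcal{T}_2$ be two triangulations of the same compact oriented surface $\Gamma_h$, with Whitney spaces $\mathcal{W}^r_i$ and Buffa-Christiansen (B-C) spaces $\mathcal{B}^q_i$ ($i=1,2$; $r,q\in\{0,1,2\}$, $r+q=2$), such that either $\partial\Gamma_h=\emptyset$, or the boundary trace of the B-C spaces vanishes, or the boundary trace of the Whitney spaces vanishes (the three cases are detailed in the context). For $ji\in\{12,21\}$ let $Q_{ji}^{r,\mathrm{B\text{-}C}}:\mathcal{W}^r_i\to\mathcal{W}^r_j$, $\boldsymbol{\omega}_i\mapsto\boldsymbol{\omega}_j$, be the mesh coupling operator defined by $$\int_{\Gamma_h}\boldsymbol{\beta}_j\wedge\boldsymbol{\omega}_j=\int_{\Gamma_h}\boldsymbol{\beta}_j\wedge\boldsymbol{\omega}_i\qquad\text{for all }\boldsymbol{\beta}_j\in\mathcal{B}^{q}_j,\quad q=2-r .$$ Then the operators $Q_{ji}^{r,\mathrm{B\text{-}C}}$ commute with the exterior derivative: for $r\in\{0,1\}$ and all $\boldsymbol{\omega}_i\in\mathcal{W}^r_i$, $$\mathrm{d}\,Q_{ji}^{r,\mathrm{B\text{-}C}}\boldsymbol{\omega}_i=Q_{ji}^{r+1,\mathrm{B\text{-}C}}\,\mathrm{d}\boldsymbol{\omega}_i .$$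
   Context: The following construction applies to each of the meshes $\mathcal{T}=\mathcal{T}_1,\mathcal{T}_2$ (index suppressed). **Meshes and Whitney forms.** $\Gamma_h$ is a compact oriented triangulated surface (dimension $n=2$), the union of the closed triangles of a finite simplicial complex $\mathcal{T}$ with sets $\mathcal{T}^0,\mathcal{T}^1,\mathcal{T}^2$ of nodes, edges, facets, each cell carrying a fixed inner orientation (nodes positive). $\mathcal{W}^r$ is the space of lowest-order Whitney $r$-forms on $\mathcal{T}$ with standard basis $\boldsymbol{\lambda}^r_t$, $t\in\mathcal{T}^r$ ($\int_s\boldsymbol{\lambda}^r_t=\delta_{st}$), and $D^r_{st}\in\{-1,0,1\}$ are the incidence numbers: $\mathrm{d}\boldsymbol{\lambda}^r_s=\sum_{t\in\mathcal{T}^{r+1}}D^r_{st}\boldsymbol{\lambda}^{r+1}_t$. $\widetilde{\mathcal{T}}$ is the (oriented) barycentric refinement of $\mathcal{T}$, with Whitney spaces $\widetilde{\mathcal{W}}^q$, standard bases $\tilde{\boldsymbol{\lambda}}^q_w$, $w\in\widetilde{\mathcal{T}}^q$, and incidence numbers $\widetilde{D}^q_{wz}$. **Dual mesh.** For $t\in\mathcal{T}^r$, $\star t\in\mathcal{V}^q$, $q=2-r$, is the barycentric dual cell: the barycenter of $t$ if $t$ is a facet; the union of the edges of $\widetilde{\mathcal{T}}$ joining the barycenter of $t$ to the barycenters of the adjacent facets if $t$ is an edge; the union of the facets of $\widetilde{\mathcal{T}}$ containing $t$ if $t$ is a node. $\star t$ is oriented so that $(\star t,t)$ is in the orientation of $\Gamma_h$.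 Write $v=\sum_{w\in\widetilde{\mathcal{T}}^q}c^q_{vw}w$ (as chains, $c^q_{vw}\in\{-1,0,1\}$) and $n_v=\sum_w|c^q_{vw}|$. **B-C spaces, case $\partial\Gamma_h=\emptyset$.** $\mathcal{B}^q=\mathrm{span}\{\boldsymbol{\mu}^q_v: v\in\mathcal{V}^q\}$ with $\boldsymbol{\mu}^q_v=\sum_{w\in\widetilde{\mathcal{T}}^q}R^q_{vw}\tilde{\boldsymbol{\lambda}}^q_w$, where the real coefficients are fixed as follows. (1) Let $U^2_v=\overline v$ and, for $q<2$, $U^q_v=\bigcup\{U^{q+1}_u: u\in\mathcal{V}^{q+1},\,v\subset\partial u\}$. Then $R^q_{vw}=0$ if $w\not\subset U^q_v$ or $w\subset\partial U^q_v$. (2) $R^q_{vw}=c^q_{vw}/n_v$ whenever $c^q_{vw}\neq0$. (3) If $q=1$, $v=\star t$ with $t\in\mathcal{T}^1$, then $R^1_{vw}=0$ for $w\subset t$. (4) For $r\in\{0,1\}$, $q=2-r$, $t\in\mathcal{T}^{r+1}$ and $z\in\widetilde{\mathcal{T}}^q$ with $z\subset U^{q-1}_{\star t}$ consider the equation $$E_{t,z}:\quad \sum_{w\in\widetilde{\mathcal{T}}^{q-1},\,w\subset\partial z}R^{q-1}_{\star t\,w}\widetilde{D}^{q-1}_{wz}=(-1)^r\sum_{s\in\mathcal{T}^r,\,s\subset\partial t}D^r_{st}R^q_{\star s\,z}.$$ The coefficients $R^2$ are fixed by (1),(2). The remaining coefficients $R^1_{\star t\,w}$ belong to the edges $w\not\subset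 t$ of $\widetilde{\mathcal{T}}$ emanating from an endpoint $s$ of $t$; they are obtained by evaluating $E_{t,z}$ ($r=0$) successively for the facets $z$ of $\widetilde{\mathcal{T}}$ around $s$, starting at the half of $t$ at $s$. The remaining coefficients $R^0_{\star t\,w}$ belong to the three vertices and three edge midpoints $w$ of the facet $t$; they are obtained from $E_{t,z}$ ($r=1$) for the six edges $z$ joining the barycenter of $t$ to these points. **Case of vanishing boundary trace of the B-C spaces.** $\partial\Gamma_h\neq\emptyset$, each edge meeting $\partial\Gamma_h$ is either contained in $\partial\Gamma_h$ or has exactly one point in common with it, the full Whitney spaces $\mathcal{W}^r$ are used, the dual mesh is truncated at $\partial\Gamma_h$, and the B-C spaces (denoted $\mathcal{B}^q_0$, playing the role of $\mathcal{B}^q$) are constructed by the same rules (1)-(4) (in particular, coefficients of edges and nodes of $\widetilde{\mathcal{T}}$ in $\partial\Gamma_h$ vanish for $q=1$ and $q=0$, respectively), except that for an edge $t$ having exactly one endpoint $s$ on $\partial\Gamma_h$, rule (3) is discarded in the dual cell $\star s$, so that the coefficient of the half of $t$ at $s$ is also determined by the equations $E_{t,z}$. **Case of vanishing boundary trace of the Whitney spaces.** $\partial\Gamma_h\neq\emptyset$, and $\mathcal{W}^r$ stands for the space $\mathcal{W}^r_0$ of Whitney forms with vanishing trace on $\partial\Gamma_h$, spanned by the $\boldsymbol{\lambda}^r_t$ with $t\in\mathcal{T}^r_0$, the set of $r$-cells not contained in $\partial\Gamma_h$. $\mathcal{B}^q\subset\widetilde{\mathcal{W}}^q$ is the B-C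 complex in duality with $\mathcal{W}_0$: it has a basis $\boldsymbol{\mu}^q_{\star t}$, $t\in\mathcal{T}^{2-q}_0$, with $\int_{\star s}\boldsymbol{\mu}^q_{\star t}=\delta_{st}$ and $\mathrm{d}\boldsymbol{\mu}^{q-1}_{\star t}=(-1)^r\sum_{s\in\mathcal{T}^r_0}D^r_{st}\boldsymbol{\mu}^q_{\star s}$ for $t\in\mathcal{T}^{r+1}_0$, $r=2-q\in\{0,1\}$. **Standing assumptions.** The same case applies to both meshes. The pairing $(\boldsymbol{\beta},\boldsymbol{\omega})\mapsto\int_{\Gamma_h}\boldsymbol{\beta}\wedge\boldsymbol{\omega}$ on $\mathcal{B}^q_j\times\mathcal{W}^r_j$ ($r+q=2$) is nondegenerate, so that $Q_{ji}^{r,\mathrm{B\text{-}C}}$ is well defined. *)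

(* Defs.v *)
From HB Require Import structures.
From mathcomp Require Import all_boot all_order all_fingroup all_algebra.
From mathcomp Require Import all_classical all_reals all_analysis.

Set Implicit Arguments.
Unset Strict Implicit.
Unset Printing Implicit Defensive.

Import Order.TTheory GRing.Theory Num.Theory.
Import numFieldNormedType.Exports.

Local Open Scope ring_scope.

(* A complex is given by its set of facets; an r-cell is a set of r.+1 nodes. *)

(* The (mod 2) boundary of a pure set of cells: the cells of codimension 1
   lying in exactly one member.  If C is the set of all facets, these are the
   edges contained in the boundary of the surface. *)
Definition bd (V : finType) (C : {set {set V}}) : {set {set V}} :=
  [set w : {set V} |
    #|[set z in C | (w \subset z) && (#|z| == #|w|.+1)]| == 1%N].

(* The closed cell w lies in the union of the closed cells of C (in a
   simplicial complex, it is then a face of one of them). *)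
Definition covered (V : finType) (C : {set {set V}}) (w : {set V}) : bool :=
  [exists z in C, w \subset z].

Definition on_bd (V : finType) (C : {set {set V}}) (w : {set V}) : bool :=
  covered (bd C) w.

(* s1 and s2 enumerate the same nodes: the sign of the permutation relating
   them, as the determinant of its permutation matrix. *)
Definition perm_sign (R : realType) (V : finType) (a : V) (s1 s2 : seq V) : R :=
  \det (\matrix_(i < size s2, j < size s2) (nth a s1 i == nth a s2 j)%:R).

(* [ord t] lists the nodes of the cell t in an order representing its inner
   orientation (so nodes are positive).  [orn K] is +1 or -1 according to
   whether the facet K, oriented by [ord K], agrees with the surface. *)
Record mesh (R : realType) (N : nat) := Mesh {
  node : finType;
  pos : node -> 'rV[R]_N;
  facets : {set {set node}};
  ord : {set node} -> seq node;
  orn : {set node} -> R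
}.

Section Mesh.
Variables (R : realType) (N : nat) (T : mesh R N).

Definition cells (r : nat) : {set {set node T}} :=
  [set s : {set node T} | (#|s| == r.+1) && covered (facets T) s].

Definition vert (s : {set node T}) : seq 'rV[R]_N := map (@pos R N T) (ord s).

(* The incidence number D_{st}: +1 if (outward node, ord s) is in the
   orientation of t, -1 if it is in the opposite one. *)
Definition incid (s t : {set node T}) : R :=
  if (s \subset t) && (#|t| == #|s|.+1) then
    \sum_(a in t :\: s) perm_sign R a (a :: ord s) (ord t)
  else 0.

Definition simplex (s : {set node T}) : set 'rV[R]_N :=
  [set x | exists c : node T -> R, [/\ forall a, a \in s -> 0 <= c a,
     \sum_(a in s) c a = 1 & x = \sum_(a in s) c a *: pos a]]%classic.

Definition open_simplex (s : {set node T}) : set 'rV[R]_N :=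
  [set x | exists c : node T -> R, [/\ forall a, a \in s -> 0 < c a,
     \sum_(a in s) c a = 1 & x = \sum_(a in s) c a *: pos a]]%classic.

Definition surface : set 'rV[R]_N :=
  [set x | exists2 K, K \in facets T & simplex K x]%classic.

End Mesh.

(* The edge vectors p_1 - p_0, ..., p_m - p_0, as rows. *)
Definition edgemx (R : realType) (N m : nat) (p : seq 'rV[R]_N) : 'M[R]_(m, N) :=
  \matrix_(i < m) (p`_i.+1 - p`_0).

Section Barycentric.
Variables (R : realType) (N : nat) (T : mesh R N) (K : {set node T}).

(* The barycentric coordinate of x for the node a of the facet K.  Only points
   x of the plane of K matter; pinvmx extends the function affinely to R^N. *)
Definition bary (a : node T) (x : 'rV[R]_N) : R :=
  let y := (x - (vert K)`_0) *m pinvmx (edgemx 2 (vert K)) in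
  match index a (ord K) with
  | 0%N => 1 - \sum_(j < 2) y 0 j
  | j.+1 => y 0 (inord j)
  end.

(* Linear part of the affine function [bary a], that is, its differential. *)
Definition dbary (a : node T) (v : 'rV[R]_N) : R := bary a v - bary a 0.

(* Orientation with respect to the surface of the rows of M, which are
   tangent to the facet K (used with m = 2). *)
Definition orient (m : nat) (M : 'M[R]_(m, N)) : R :=
  orn K * Num.sg (\det (\matrix_(i < m, j < m)
    ([seq dbary a (row i M) | a <- ord K]`_j.+1))).

End Barycentric.

Definition cell_orders (R : realType) (N : nat) (T : mesh R N) : Prop :=
  forall r s, s \in cells T r -> perm_eq (ord s) (enum s).

(* T is a finite simplicial complex whose union is a compact oriented surface,
   possibly with boundary. *)
Record triangulation (R : realType) (N : nat) (T : mesh R N) : Prop := {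
  tri_card : forall K, K \in facets T -> #|K| = 3%N;
  tri_ord : cell_orders T;
  tri_affine : forall K, K \in facets T -> row_free (edgemx 2 (vert K));
  tri_inter : forall K L, K \in facets T -> L \in facets T ->
    (simplex K `&` simplex L `<=` simplex (K :&: L)%SET)%classic;
  tri_edge : forall e, e \in cells T 1 ->
    (#|[set K in facets T | e \subset K]| <= 2)%N;
  (* the facets around a node form one fan or one cycle *)
  tri_node : forall a K L, K \in facets T -> L \in facets T ->
    a \in K -> a \in L ->
    connect [rel F G | [&& F \in facets T, G \in facets T,
                           a \in F :&: G & #|F :&: G| == 2%N]] K L;
  tri_orn : forall K, K \in facets T -> orn K = 1 \/ orn K = -1;
  tri_coherent : forall e, e \in cells T 1 -> ~~ on_bd (facets T) e ->
    \sum_(K in facets T | e \subset K) orn K * incid e K = 0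
}.

Definition same_oriented_surface (R : realType) (N : nat) (T1 T2 : mesh R N) :
    Prop :=
  surface T1 = surface T2 /\
  forall K1 K2, K1 \in facets T1 -> K2 \in facets T2 ->
    (open_simplex K1 `&` open_simplex K2 !=set0)%classic ->
    orient K1 (edgemx 2 (vert K2)) = orn K2.

(* An r-form evaluates at a point on the r rows of a matrix. *)
Definition form (R : realType) (N r : nat) := 'rV[R]_N -> 'M[R]_(r, N) -> R.

(* A piecewise smooth form on the surface, given by its restriction to each
   facet; in particular no value is chosen on the edges, where facets meet. *)
Definition pform (R : realType) (N : nat) (T : mesh R N) (r : nat) :=
  {set node T} -> form R N r.

Section Forms.
Variables (R : realType) (N : nat).

Definition wedge (q r : nat) (b : form R N q) (w : form R N r) :
    form R N (q + r) := fun x V =>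
  (q`! * r`!)%:R^-1 * \sum_(s : 'S_(q + r))
    (-1) ^+ s * b x (usubmx (row_perm s V)) * w x (dsubmx (row_perm s V)).

Definition extd (T : mesh R N) (r : nat) (w : pform T r) : pform T r.+1 :=
  fun K x V => \sum_(k < r.+1)
    (-1) ^+ k * 'D_(row k V) (fun y => w K y (row' k V) : R^o) x.

(* Iterated integral over {x in R^m | x_i >= 0, x_0 + ... + x_(m-1) <= a}. *)
Fixpoint corner_integral (m : nat) (a : R) (f : seq R -> R) : R :=
  if m is m'.+1 then
    (\int[lebesgue_measure]_(x in `[0%R, a]%classic)
       corner_integral m' (a - x) (fun s => f (x :: s)))%R
  else f [::].

Definition simplex_integral (m : nat) (p : seq 'rV[R]_N) (w : form R N m) : R :=
  corner_integral m 1 (fun s =>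
    w (p`_0 + \sum_(i < m) s`_i *: (p`_i.+1 - p`_0)) (edgemx m p)).

(* The integral over the surface of b /\ w (for q + r = 2), where b and w are
   given on two meshes A and B of this surface. *)
Definition pairing (A B : mesh R N) (q r : nat)
    (b : pform A q) (w : pform B r) : R :=
  \sum_(K in facets A) \sum_(L in facets B)
    orn K * simplex_integral (vert K)
              (fun x V => \1_(simplex L) x * wedge (b K) (w L) x V).

(* r! \sum_k (-1)^k l_k dl_0 /\ ... (omitting dl_k) ... /\ dl_r for the
   barycentric coordinates l_0, ..., l_r of the nodes [ord t]. *)
Definition lambda (T : mesh R N) (r : nat) (t : {set node T}) : pform T r :=
  fun K x V =>
    if (K \in facets T) && (t \subset K) then
      r`!%:R * \sum_(k < r.+1) (-1) ^+ k * [seq bary K a x | a <- ord t]`_k *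
        \det (\matrix_(i < r, j < r)
                ([seq dbary K a (row j V) | a <- ord t]`_(lift k i)))
    else 0.

(* Integral of a form over an r-cell.  It is applied to Whitney forms, whose
   traces on the cell from the adjacent facets coincide. *)
Definition cell_integral (T : mesh R N) (r : nat) (t : {set node T})
    (w : pform T r) : R :=
  simplex_integral (vert t)
    (w (odflt finset.set0 [pick K in facets T | t \subset K])).

End Forms.

Arguments lambda {R N T} r t.
Arguments cell_integral {R N T} r t w.

(* A mesh with orderings [rord] orienting the cells of its barycentric
   refinement, and the coefficients [coef q t w] = R^q_{vw} for v = *t. *)
Record bc_mesh (R : realType) (N : nat) := BCMesh {
  primal :> mesh R N;
  rord : {set {set node primal}} -> seq {set node primal};
  coef : nat -> {set node primal} -> {set {set node primal}} -> R
}.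

Section Dual.
Variables (R : realType) (N : nat) (T : bc_mesh R N).

Definition is_cell (s : {set node T}) : bool :=
  (s != finset.set0) && covered (facets T) s.

(* The nodes are the (barycenters of the) cells of T, the cells are the chains
   of cells of T, and the surface orientation is that of T. *)
Definition refined : mesh R N := {|
  node := {set node T} : finType;
  pos := fun s => (#|s|%:R)^-1 *: \sum_(a in s) pos a;
  facets := [set z : {set {set node T}} | [&& #|z| == 3%N,
    [forall s in z, is_cell s] &
    [forall s in z, forall t in z, (s \subset t) || (t \subset s)]]];
  ord := @rord R N T;
  orn := fun z => \sum_(f in facets T | f \in z)
    orient f (edgemx 2
      [seq (#|s|%:R)^-1 *: \sum_(a in s) pos a | s : {set node T} <- rord z])
|}.

(* The dual cell *t as a set of q-cells of the refinement, q = 2 - dim t. *)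
Definition dual (t : {set node T}) : {set {set node refined}} :=
  [set w in cells refined (3 - #|t|) |
    (t \in w) && [forall s in w, t \subset s]].

(* The coefficient c^q_{vw}, v = *t: the sign for which (w, t) is in the
   orientation of the surface.  The chain w contains exactly one facet f. *)
Definition chain_coef (q : nat) (t : {set node T}) (w : {set node refined}) : R :=
  if w \in dual t then
    \sum_(f in facets T | f \in w)
      orient f (col_mx (edgemx q (vert w)) (edgemx (2 - q) (vert t)))
  else 0.

Definition chain_size (q : nat) (t : {set node T}) : R :=
  \sum_(w in cells refined q) `|chain_coef q t w|.

(* The facets of the refinement forming U^q_v, v = *t, where r = 2 - q is the
   dimension of t. *)
Fixpoint Udom (r : nat) (t : {set node T}) : {set {set node refined}} :=
  if r is r'.+1 then
    \bigcup_(s in cells T r' | dual t \subset bd (dual s)) Udom r' s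
  else dual t.

Definition mu (q : nat) (t : {set node T}) : pform refined q := fun K x V =>
  \sum_(w in cells refined q) coef q t w * lambda q w K x V.

Definition dual_integral (q : nat) (t : {set node T}) (b : pform refined q) : R :=
  \sum_(w in cells refined q) chain_coef q t w * cell_integral q w b.

Definition bnode (a : node T) : bool := on_bd (facets T) [set a].

(* E_{t,z}, for t of dimension r + 1 and z of dimension 2 - r. *)
Definition bc_equation (r : nat) (t : {set node T}) (z : {set node refined}) : Prop :=
  \sum_(w in cells refined (1 - r) | w \subset z)
     coef (1 - r) t w * incid w z
  = (-1) ^+ r * \sum_(s in cells T r | s \subset t)
     incid s t * coef (2 - r) s z.

Definition bc_rule1 : Prop := forall r t w, (r <= 2)%N ->
  t \in cells T r -> w \in cells refined (2 - r) ->
  ~~ covered (Udom r t) w || on_bd (Udom r t) w -> coef (2 - r) t w = 0.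

Definition bc_rule2 : Prop := forall r t w, (r <= 2)%N ->
  t \in cells T r -> w \in cells refined (2 - r) ->
  chain_coef (2 - r) t w != 0 ->
  coef (2 - r) t w = chain_coef (2 - r) t w / chain_size (2 - r) t.

(* The half of the edge t at its endpoint a is the cell {{a}, t} of the
   refinement; the rule is discarded if a is the only endpoint of t on the
   boundary. *)
Definition bc_rule3 : Prop := forall t a, t \in cells T 1 -> a \in t ->
  ~~ (bnode a && (#|[set b in t | bnode b]| == 1%N)) ->
  coef 1 t [set [set a]; t] = 0.

(* The equations used to compute R^1_{*t} around an endpoint a of t: evaluated
   successively for the facets z around a, they are needed for all z but the
   last one. *)
Definition bc_rule4_edges : Prop := forall t a, t \in cells T 1 -> a \in t ->
  exists z0 : {set node refined}, forall z, z \in facets refined ->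
    [set a] \in z -> z != z0 -> bc_equation 0 t z.

(* The equations used to compute R^0_{*t} at the vertices and edge midpoints p
   of t (where it is not already known to vanish by the first rule). *)
Definition bc_rule4_nodes : Prop := forall t p : {set node T},
  t \in cells T 2 -> p \subset t ->
  [set t; p] \in cells refined 1 ->
  ~~ on_bd (facets refined) [set p] ->
  bc_equation 1 t [set t; p].

Definition bc_rules : Prop :=
  [/\ bc_rule1, bc_rule2, bc_rule3, bc_rule4_edges & bc_rule4_nodes].

End Dual.

Arguments mu {R N T} q t.
Arguments dual_integral {R N T} q t b.

Inductive bc_case := Closed | BCTraceZero | WhitneyTraceZero.

Section Spaces.
Variables (R : realType) (N : nat) (c : bc_case).

Definition dofs (T : mesh R N) (r : nat) : {set {set node T}} :=
  if c is WhitneyTraceZero then [set t in cells T r | ~~ on_bd (facets T) t]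
  else cells T r.

Definition case_mesh (T : bc_mesh R N) : Prop :=
  match c with
  | Closed => bd (facets T) = finset.set0
  | BCTraceZero => bd (facets T) != finset.set0 /\
      forall e, e \in cells T 1 ->
        on_bd (facets T) e \/ (#|[set a in e | bnode a]| <= 1)%N
  | WhitneyTraceZero => bd (facets T) != finset.set0
  end.

(* In the last case the basis mu is only known by its properties. *)
Definition case_coef (T : bc_mesh R N) : Prop :=
  if c is WhitneyTraceZero then
    (forall q s t, (q <= 2)%N -> s \in dofs T (2 - q) -> t \in dofs T (2 - q) ->
       dual_integral q s (mu q t) = (s == t)%:R) /\
    (forall q t, (q <= 1)%N -> t \in dofs T (2 - q) ->
       extd (mu q t) = fun K x V =>
         (-1) ^+ (1 - q) * \sum_(s in dofs T (1 - q))
            incid s t * mu q.+1 s K x V)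
  else bc_rules T.

Definition whitney_space (T : mesh R N) (r : nat) : set (pform T r) :=
  [set w | exists b : {set node T} -> R,
     w = fun K x V => \sum_(t in dofs T r) b t * lambda r t K x V]%classic.

Definition bc_space (T : bc_mesh R N) (q : nat) : set (pform (refined T) q) :=
  [set m | exists b : {set node T} -> R,
     m = fun K x V => \sum_(t in dofs T (2 - q)) b t * mu q t K x V]%classic.

Definition nondegenerate (T : bc_mesh R N) (r : nat) : Prop :=
  (forall w, whitney_space (T := T) (r := r) w ->
     (forall b, bc_space (T := T) (q := 2 - r) b -> pairing b w = 0) ->
     w = fun _ _ _ => 0) /\
  (forall b, bc_space (T := T) (q := 2 - r) b ->
     (forall w, whitney_space (T := T) (r := r) w -> pairing b w = 0) ->
     b = fun _ _ _ => 0).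

Definition bc_discretization (T : bc_mesh R N) : Prop :=
  [/\ triangulation T, cell_orders (refined T), case_mesh T, case_coef T &
      forall r, (r <= 2)%N -> nondegenerate T r].

Definition coupling_operator (Ti Tj : bc_mesh R N) (r : nat)
    (Q : pform Ti r -> pform Tj r) : Prop :=
  forall w, whitney_space w -> whitney_space (Q w) /\
    forall b, bc_space (T := Tj) (q := 2 - r) b -> pairing b (Q w) = pairing b w.

End Spaces.

(* Main.v *)
From HB Require Import structures.
From mathcomp Require Import all_boot all_order all_fingroup all_algebra.
From mathcomp Require Import all_classical all_reals all_analysis.
From mathcomp Require Import measurable_realfun ring lra.
Require Import Defs.

(** Let b range over the dual space of degree one less than that paired with w.
    Integration by parts moves the exterior derivative from the Whitney form
    to b without boundary term, up to a sign that depends on the degree only,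
    and db is again in the dual space.  Hence dQw, d applied to Q of w, pairs
    with b like db with Qw, by definition of Q like db with w, that is, like b
    with dw, and again by definition like b with Q(dw).  Since dQw and Q(dw)
    are Whitney forms, nondegeneracy of the pairing gives the equality: this is
    [commute].  It rests on two facts.

    Integration by parts ([core_sum], [stokes_edge_node], [stokes_node_edge]).
    The forms live on two unrelated triangulations of one surface, so their
    products are only piecewise smooth.  For basis forms the claim reduces to
    the integral of d(l_p l_v) /\ d l_a, where l_p and l_a are barycentric
    coordinates on one mesh and l_v is one on the other.  On a facet this form
    is integrated along the level lines of l_a, on which l_p l_v is continuous
    and piecewise quadratic; what is left are integrals of l_p l_v over the two
    edges at a ([core_facet]).  They cancel between neighbouring facets, and on
    a boundary edge of one mesh l_v vanishes unless v itself is on the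
    boundary ([boundary_vanish]).  If the two barycentric coordinates of one
    mesh are those of the Whitney form, the integrals are first moved to the
    facets of that mesh ([swap_term]).  All this needs of the barycentric
    refinement is that it is again a triangulation of the surface with coherent
    orientations ([regular_refined], [surface_refined], [orient_compat]).

    Invariance of the dual spaces under d ([equation0], [equation1]).  In terms
    of coefficients this is the equation E for all pairs of cells, whereas the
    rules only prescribe some of them.  Around an endpoint of an edge t all
    equations but one are prescribed, and the sum of all of them is an
    identity, because the orientations are coherent.  For a facet t the defect
    of the equation is a closed cochain on the refinement, by dd = 0 and the
    equations of degree one.  It vanishes on the edges that do not end at a
    node of T, hence vanishes on one edge at a node if and only if it does on
    all of them; one equation at each node is prescribed, or trivial on the
    boundary or outside of t ([spoke_iff], [spoke_start]). *)

Set Implicit Arguments.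
Unset Strict Implicit.
Unset Printing Implicit Defensive.

Import Order.TTheory GRing.Theory Num.Theory.
Import numFieldNormedType.Exports.

Local Open Scope ring_scope.

(** * Affine substitutions in planar integrals *)

Section Integration.
Local Open Scope classical_set_scope.
Local Open Scope ring_scope.

Section AffineSubstitution.
Variable R : realType.
Local Notation lam := (@lebesgue_measure R).
Local Notation R1 := (measurableTypeR R).

Lemma measurable_affine1 (a e : R) :
  measurable_fun [set: R1] (fun x : R1 => a * x + e : R1).
Proof.
by apply: measurable_funD => //; exact: measurable_funM.
Qed.

Lemma preimage_affine_itv (a e u v : R) : a != 0 ->
  lam ((fun x : R1 => a * x + e : R1) @^-1` `]u, v]) =
  (`|a|^-1%:E * lam `]u, v])%E.
Proof.
move=> a0; have [agt|alt] : 0 < a \/ a < 0.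
  by case: (ltrgtP a 0) a0 => //; [right|left].
- have -> : (fun x : R1 => a * x + e : R1) @^-1` `]u, v] =
            `](u - e) / a, (v - e) / a]%classic.
    apply/seteqP; split=> x /=; rewrite !in_itv/= ltr_pdivrMr// ler_pdivlMr//;
    by rewrite ltrBlDr lerBrDr (mulrC x).
  rewrite !lebesgue_measure_itv/= !lte_fin ltr_pM2r ?invr_gt0// ltrD2r.
  case: ifP => uv; last by rewrite mule0.
  rewrite (gtr0_norm agt) -!EFinD -EFinM; congr EFin; field.
  by rewrite gt_eqF.
- have -> : (fun x : R1 => a * x + e : R1) @^-1` `]u, v] =
            `[(v - e) / a, (u - e) / a[%classic.
    apply/seteqP; split=> x /=; rewrite !in_itv/= ltr_ndivlMr// ler_ndivrMr//;
    by rewrite ltrBlDr lerBrDr (mulrC x) andbC.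
  rewrite !lebesgue_measure_itv/= !lte_fin ltr_nM2r ?invr_lt0// ltrD2r.
  case: ifP => uv; last by rewrite mule0.
  rewrite (ltr0_norm alt) -!EFinD -EFinM; congr EFin; field.
  by rewrite lt_eqF.
Qed.

(** Both sides are measures of A which agree on intervals. *)
Lemma preimage_affine (a e : R) (A : set R1) : a != 0 -> measurable A ->
  lam ((fun x : R1 => a * x + e : R1) @^-1` A) = (`|a|^-1%:E * lam A)%E.
Proof.
move=> a0 mA.
pose g := (fun x : R1 => a * x + e : R1).
have mg : measurable_fun [set: R1] g by exact: measurable_affine1.
pose c : {nonneg R} := NngNum (normr_ge0 a).
have -> : lam A = mscale c (pushforward lam g) A; last first.
  rewrite /mscale/= /pushforward muleA -EFinM mulVf ?normr_eq0// mul1e.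
  by [].
have /(_ mg) := @lebesgue_measure_unique _ (mscale c (pushforward lam g)).
move=> H m; apply: H => //.
move=> _ [[u v] _ <-].
change (lam `]u, v] = `|a|%:E * lam ((fun x : R1 => (a * x + e)%R : R1) @^-1` `]u, v]))%E.
rewrite (preimage_affine_itv e u v a0) muleA -EFinM.
by rewrite mulfV ?normr_eq0// mul1e.
Qed.

Lemma ge0_integral_affine1 (a e : R) (f : R -> \bar R) : a != 0 ->
  measurable_fun [set: R] f -> (forall x, 0 <= f x)%E ->
  (\int[lam]_x f (a * x + e)%R = `|a|^-1%:E * \int[lam]_x f x)%E.
Proof.
move=> a0 mf f0.
pose g := (fun x : R1 => a * x + e : R1).
have mg : measurable_fun [set: R1] g by exact: measurable_affine1.
rewrite -[LHS]/(\int[lam]_(x in g @^-1` setT) (f \o g) x)%E.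
rewrite -(ge0_integral_pushforward mg)//.
have c0 : 0 <= `|a|^-1 by rewrite invr_ge0.
pose c : {nonneg R} := NngNum c0.
rewrite -(@ge0_integral_mscale _ _ _ lam _ measurableT c)//.
by apply: eq_measure_integral => //= A mA _; exact: preimage_affine.
Qed.

Lemma ge0_integralZ_lam (k : R) (F : R1 -> \bar R) : 0 <= k ->
  measurable_fun [set: R1] F -> (forall x, 0 <= F x)%E ->
  (\int[lam]_x (k%:E * F x) = k%:E * \int[lam]_x F x)%E.
Proof.
move=> k0 mF F0; apply: ge0_integralZl; first exact: measurableT.
- exact: mF.
- by move=> x _; exact: F0.
- by rewrite lee_fin.
Qed.

End AffineSubstitution.

Section AffineSubstitution2.
Variable R : realType.
Local Notation lam := (@lebesgue_measure R).
Local Notation R1 := (measurableTypeR R).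
Local Notation R2 := (R1 * R1)%type.
Local Notation mu2 := (lam \x lam)%E.

Definition plane_affine (a b c d e f : R) (z : R2) : R2 :=
  (a * z.1 + b * z.2 + e, c * z.1 + d * z.2 + f).

Lemma measurable_lin2 (a b e : R) :
  measurable_fun [set: R2] (fun z : R2 => a * z.1 + b * z.2 + e : R1).
Proof.
apply: measurable_funD => //; apply: measurable_funD => //; exact: measurable_funM.
Qed.

Lemma measurable_plane_affine a b c d e f :
  measurable_fun [set: R2] (plane_affine a b c d e f).
Proof. by apply: measurable_fun_pair; exact: measurable_lin2. Qed.

(** Tonelli's theorem reduces this to substitutions in one variable. *)
Lemma ge0_integral_plane_affine (a b c d e f : R) (g : R2 -> \bar R) :
  a * d - b * c != 0 -> measurable_fun [set: R2] g -> (forall z, 0 <= g z)%E ->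
  (\int[mu2]_z g (plane_affine a b c d e f z) =
   `|a * d - b * c|^-1%:E * \int[mu2]_z g z)%E.
Proof.
move=> det0 mg g0.
have mgx x : measurable_fun [set: R1] (fun y : R1 => g (x, y)).
  exact: measurable_fun_pair2.
rewrite (fubini_tonelli1 (g \o plane_affine a b c d e f)); last 2 first.
- exact: (measurableT_comp mg (measurable_plane_affine _ _ _ _ _ _)).
- by move=> z; exact: g0.
rewrite [X in (_ * X)%E](fubini_tonelli1 g)//.
have [b0|b0] := eqVneq b 0.
  have [a0 d0] : a != 0 /\ d != 0.
    by move: det0; rewrite b0 mul0r subr0 mulf_eq0 negb_or => /andP.
  have -> : (fubini_F lam (g \o plane_affine a b c d e f)) =
      (fun x : R1 => `|d|^-1%:E * fubini_F lam g (a * x + e)%R)%E.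
    apply/funext => x; rewrite /fubini_F/=.
    rewrite -(ge0_integral_affine1 (c * x + f) d0 (mgx _))//.
    apply: eq_integral => y _; congr g.
    by rewrite /plane_affine/= b0 mul0r addr0; congr pair; ring.
  have mF : measurable_fun [set: R] (fubini_F lam g).
    exact: (measurable_fun_fubini_tonelli_F g).
  rewrite ge0_integralZ_lam; last 3 first.
  - by rewrite invr_ge0.
  - exact: (measurableT_comp mF (@measurable_affine1 R a e)).
  - by move=> x; apply: integral_ge0 => y _; exact: g0.
  rewrite (ge0_integral_affine1 e a0 mF)//; last by move=> x; apply: integral_ge0.
  by rewrite muleA -EFinM b0 mul0r subr0 normrM invfM mulrC.
pose k := c - d * a / b.
have k0 : k != 0.
  apply: contraNneq det0 => k0; rewrite -[X in X == _]opprK.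
  have -> : - (a * d - b * c) = b * k by rewrite /k; field.
  by rewrite k0 mulr0 oppr0.
pose h (z : R2) := g (z.2, k * z.1 + (d / b) * z.2 + (f - d * e / b)).
have mh : measurable_fun [set: R2] h.
  apply: measurableT_comp => //; apply: measurable_fun_pair => //.
  exact: measurable_lin2.
have -> : (fubini_F lam (g \o plane_affine a b c d e f)) =
    (fun x : R1 => `|b|^-1%:E * fubini_F lam h x)%E.
  apply/funext => x; rewrite /fubini_F/=.
  rewrite -(ge0_integral_affine1 (a * x + e) b0 (measurable_fun_pair2 x mh))//.
  - apply: eq_integral => y _; congr g.
    by rewrite /plane_affine/= /k; congr pair; [ring|field].
  - by move=> y; exact: g0.
rewrite ge0_integralZ_lam; last 3 first.
- by rewrite invr_ge0.
- by apply: (measurable_fun_fubini_tonelli_F h) => // z; exact: g0.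
- by move=> x; apply: integral_ge0 => y _; exact: g0.
have -> : (\int[lam]_x fubini_F lam h x = \int[lam]_y \int[lam]_x h (x, y))%E.
  by apply: (fubini_tonelli h) => // z; exact: g0.
have -> : (\int[lam]_y \int[lam]_x h (x, y) =
           \int[lam]_y (`|k|^-1%:E * fubini_F lam g y))%E.
  apply: eq_integral => y _; rewrite /fubini_F.
  have gy0 z : (0 <= g (y, z))%E by exact: g0.
  rewrite -(ge0_integral_affine1 (d / b * y + (f - d * e / b)) k0 (mgx y) gy0).
  apply: eq_integral => x _; rewrite /h/=; congr (g (_, _)); ring.
rewrite ge0_integralZ_lam; last 3 first.
- by rewrite invr_ge0.
- by apply: (measurable_fun_fubini_tonelli_F g) => // z; exact: g0.
- by move=> x; apply: integral_ge0 => y _; exact: g0.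
rewrite muleA -EFinM -invfM -normrM.
congr (_^-1%:E * _)%E; rewrite -[LHS]normrN; congr (`| _ |).
by rewrite /k; field.
Qed.

Lemma integral_plane_affine (a b c d e f : R) (g : R2 -> R) :
  a * d - b * c != 0 -> measurable_fun [set: R2] g ->
  (\int[mu2]_z (g (plane_affine a b c d e f z)) =
   `|a * d - b * c|^-1 * \int[mu2]_z (g z)).
Proof.
move=> det0 mg; rewrite /Rintegral.
have mG : measurable_fun [set: R2] (EFin \o g) by exact/measurable_EFinP.
pose G := EFin \o g.
have E1 : (\int[mu2]_z G^\+ (plane_affine a b c d e f z) =
    `|a * d - b * c|^-1%:E * \int[mu2]_z G^\+ z)%E.
  apply: ge0_integral_plane_affine det0 (measurable_funepos mG) _ => z; exact: funepos_ge0.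
have E2 : (\int[mu2]_z G^\- (plane_affine a b c d e f z) =
    `|a * d - b * c|^-1%:E * \int[mu2]_z G^\- z)%E.
  apply: ge0_integral_plane_affine det0 (measurable_funeneg mG) _ => z; exact: funeneg_ge0.
rewrite [X in _ = _ * fine X]integralE.
have -> : (\int[mu2]_z (g (plane_affine a b c d e f z))%:E =
    \int[mu2]_z G^\+ (plane_affine a b c d e f z) -
    \int[mu2]_z G^\- (plane_affine a b c d e f z))%E.
  by rewrite integralE; congr (_ - _)%E; apply: eq_integral => z _;
    rewrite ?funeposE ?funenegE.
rewrite E1 E2.
have k0 : `|a * d - b * c|^-1 != 0 by rewrite invr_eq0 normr_eq0.
have kp : 0 < `|a * d - b * c|^-1 by rewrite lt_def k0 invr_ge0 normr_ge0.
have : (0 <= \int[mu2]_z G^\+ z)%E by exact: integral_ge0.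
have : (0 <= \int[mu2]_z G^\- z)%E by exact: integral_ge0.
rewrite -/G.
case: (\int[mu2]_z G^\+ z)%E => [x| |]; case: (\int[mu2]_z G^\- z)%E => [y| |] //= _ _.
- by rewrite mulrBr.
- by rewrite gt0_muley ?lte_fin//= mulr0.
- by rewrite gt0_muley ?lte_fin//= mulr0.
- by rewrite !gt0_muley ?lte_fin//= mulr0.
Qed.

End AffineSubstitution2.

(** * Piecewise polynomial functions *)

Section Tame.
Variables (R : realType) (V : lmodType R).

(** Affine functions are described by their values, since barycentric
    coordinates come as functions; f - f 0 is the linear part. *)
Definition affine_fun (f : V -> R) : Prop := forall k x y,
  f (k *: x + y) - f 0 = k * (f x - f 0) + (f y - f 0).

(** A class that contains all integrands of the pairing: its members are
    measurable and bounded on triangles, which makes every integral below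
    additive and accessible to Fubini's theorem. *)
Inductive tame : (V -> R) -> Prop :=
| tame_affine f : affine_fun f -> tame f
| tame_add f g : tame f -> tame g -> tame (fun x => f x + g x)
| tame_mul f g : tame f -> tame g -> tame (fun x => f x * g x)
| tame_step f : tame f -> tame (fun x => (0 <= f x)%R%:R).

Lemma affine_cst c : affine_fun (fun _ => c).
Proof. by move=> k x y; rewrite !subrr mulr0 addr0. Qed.

Lemma tame_cst c : tame (fun _ => c).
Proof. exact/tame_affine/affine_cst. Qed.

Lemma tame_opp f : tame f -> tame (fun x => - f x).
Proof.
move=> tf; rewrite (_ : (fun _ => _) = (fun x => -1 * f x)).
  exact: tame_mul (tame_cst _) tf.
by apply/funext => x; rewrite mulN1r.
Qed.

Lemma tame_sub f g : tame f -> tame g -> tame (fun x => f x - g x).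
Proof. by move=> tf tg; apply: tame_add => //; exact: tame_opp. Qed.

Lemma tame_sum (I : Type) (s : seq I) (P : pred I) (F : I -> V -> R) :
  (forall i, P i -> tame (F i)) -> tame (fun x => \sum_(i <- s | P i) F i x).
Proof.
move=> tF; elim: s => [|i s IH].
  rewrite (_ : (fun _ => _) = (fun _ => 0)); first exact: tame_cst.
  by apply/funext => x; rewrite big_nil.
have [Pi|Pi] := boolP (P i).
  rewrite (_ : (fun _ => _) = (fun x => F i x + \sum_(j <- s | P j) F j x)).
    by apply: tame_add => //; exact: tF.
  by apply/funext => x; rewrite big_cons Pi.
rewrite (_ : (fun _ => _) = (fun x => \sum_(j <- s | P j) F j x)) //.
by apply/funext => x; rewrite big_cons (negbTE Pi).
Qed.

Lemma tame_all (s : seq (V -> R)) : (forall f, List.In f s -> affine_fun f) ->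
  tame (fun x => (all (fun f : V -> R => 0 <= f x) s)%:R).
Proof.
elim: s => [|f s IH] sa; first exact: tame_cst.
have -> : (fun x => (all (fun f : V -> R => 0 <= f x) (f :: s))%:R) =
    (fun x : V => (0 <= f x)%R%:R * (all (fun f : V -> R => 0 <= f x) s)%:R) :> (V -> R).
  by apply/funext => x /=; rewrite -natrM mulnb.
apply: tame_mul; last by apply: IH => g gs; apply: sa; right.
  by apply/tame_step/tame_affine/sa; left.
Qed.

Lemma tame_max f g : tame f -> tame g -> tame (fun x => Num.max (f x) (g x)).
Proof.
move=> tf tg.
rewrite (_ : (fun _ => _) =
    (fun x => f x + (g x - f x) * (0 <= g x - f x)%R%:R)).
  apply: tame_add => //; apply: tame_mul; first exact: tame_sub.
  exact/tame_step/tame_sub.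
apply/funext => x; rewrite subr_ge0; case: (leP (f x) (g x)) => fg.
  by rewrite mulr1 addrC subrK.
by rewrite mulr0 addr0.
Qed.

Lemma measurable_tame d (T : measurableType d) (c : T -> V) :
  (forall f, affine_fun f -> measurable_fun [set: T] (f \o c)) ->
  forall f, tame f -> measurable_fun [set: T] (f \o c).
Proof.
move=> mc f; elim=> {f} [f|f g _ mf _ mg|f g _ mf _ mg|f _ mf].
- exact: mc.
- exact: measurable_funD.
- exact: measurable_funM.
- rewrite (_ : _ \o _ = (fun t => if 0 <= f (c t) then 1 else 0)).
    apply: measurable_fun_ifT => //.
    exact: (measurable_fun_ler (measurable_cst _) mf).
  by apply/funext => t /=; case: (0 <= _).
Qed.

Lemma bounded_tame (T : Type) (D : set T) (c : T -> V) :
  (forall f, affine_fun f -> exists C, forall t, D t -> `|f (c t)| <= C) ->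
  forall f, tame f -> exists C, forall t, D t -> `|f (c t)| <= C.
Proof.
move=> bc f; elim=> {f} [f|f g _ [C HC] _ [E HE]|f g _ [C HC] _ [E HE]|f _ _].
- exact: bc.
- exists (C + E) => t Dt; rewrite (le_trans (ler_normD _ _))//.
  by rewrite lerD ?HC ?HE.
- exists (C * E) => t Dt; rewrite normrM.
  by rewrite ler_pM ?HC ?HE.
- by exists 1 => t _; rewrite ger0_norm ?ler0n// lern1; case: (0 <= _).
Qed.

Lemma affineE f : affine_fun f -> forall k x y,
  f (k *: x + y) = k * (f x - f 0) + f y.
Proof. by move=> af k x y; rewrite -(subrK (f 0) (f (_ + _))) af -addrA subrK. Qed.

Lemma affine_par f p u v (s t : R) : affine_fun f ->
  f (p + s *: u + t *: v) = f p + s * (f u - f 0) + t * (f v - f 0).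
Proof.
move=> af; rewrite addrC affineE// addrC; congr (_ + _).
by rewrite addrC affineE// addrC.
Qed.

End Tame.

Section Triangle.
Variables (R : realType).
Local Notation lam := (@lebesgue_measure R).
Local Notation R1 := (measurableTypeR R).
Local Notation R2 := (R1 * R1)%type.
Local Notation mu2 := (lam \x lam)%E.

(** The standard triangle, over which [corner_integral] integrates. *)
Definition corner : set R2 := [set z | [/\ 0 <= z.1, 0 <= z.2 & z.1 + z.2 <= 1]].

Lemma measurable_le2 (f g : R2 -> R) : measurable_fun [set: R2] f ->
  measurable_fun [set: R2] g -> measurable [set z | f z <= g z].
Proof.
move=> mf mg.
have := measurable_fun_ler mf mg measurableT (Y := [set true]) I.
by rewrite setTI; congr measurable; apply/seteqP; split=> z /=; case: (_ <= _).
Qed.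

Lemma measurable_corner : measurable corner.
Proof.
rewrite (_ : corner = [set z | (cst 0 : R2 -> R) z <= z.1] `&`
  ([set z | (cst 0 : R2 -> R) z <= z.2] `&` [set z | z.1 + z.2 <= (cst 1 : R2 -> R) z])).
  apply: measurableI; last apply: measurableI; apply: measurable_le2 => //.
  exact: measurable_funD.
by apply/seteqP; split=> z /= [] => [? ? ?|? [? ?]]; do ?split.
Qed.

Lemma corner_lty : (mu2 corner < +oo)%E.
Proof.
apply: (@le_lt_trans _ _ (mu2 (`[0%R, 1%R] `*` `[0%R, 1%R]))).
  apply: le_measure; rewrite ?inE.
  - exact: measurable_corner.
  - by apply: measurableX.
  - move=> [x y] [/= x0 y0 xy]; split; rewrite /= in_itv/= ?x0 ?y0/=.
      by apply: le_trans xy; rewrite lerDl.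
    by apply: le_trans xy; rewrite lerDr.
rewrite product_measure1E//=.
rewrite [X in (X * _)%E](_ : _ = 1%E); last first.
  by rewrite lebesgue_measure_itv/= lte01 sube0.
rewrite [X in (_ * X)%E](_ : _ = 1%E); last first.
  by rewrite lebesgue_measure_itv/= lte01 sube0.
by rewrite mule1 ltry.
Qed.

Definition good2 (h : R2 -> R) :=
  measurable_fun [set: R2] h /\ exists C, forall z, corner z -> `|h z| <= C.

Lemma good2_integrable h : good2 h -> mu2.-integrable corner (EFin \o h).
Proof.
move=> [mh [C HC]]; apply: measurable_bounded_integrable.
- exact: measurable_corner.
- exact: corner_lty.
- exact: measurable_funTS.
- exists C; split; first exact: num_real.
  by move=> M CM z cz; rewrite /= (le_trans (HC _ cz))// ltW.
Qed.

Lemma itv_integrable (a b : R) (g : R1 -> R) : measurable_fun [set: R1] g ->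
  (exists C, forall y, a <= y <= b -> `|g y| <= C) ->
  lam.-integrable `[a, b] (EFin \o g).
Proof.
move=> mg [C HC]; apply: measurable_bounded_integrable => //.
- by rewrite /= lebesgue_measure_itv/=; case: ifP; rewrite ?ltry// -EFinB ltry.
- exact: measurable_funTS.
- exists C; split; first exact: num_real.
  by move=> M CM y; rewrite /= in_itv/= => yab; rewrite (le_trans (HC _ yab))// ltW.
Qed.

Lemma corner_integralE h : good2 h ->
  corner_integral 2 1 (fun s => h (s`_0, s`_1)) = \int[mu2]_(z in corner) h z.
Proof.
move=> gh; have ih := good2_integrable gh.
have ih' : mu2.-integrable setT (EFin \o (h \_ corner)).
  rewrite -restrict_EFin. apply/integrable_restrict => //; first exact: measurable_corner.
  by rewrite setTI.
rewrite [RHS]Rintegral_mkcond /Rintegral -integral12_prod_meas1//.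
rewrite /= [in LHS]/Rintegral; congr fine.
rewrite integral_mkcond; apply: eq_integral => x _.
rewrite /patch; case: ifPn => [|xn].
  rewrite inE/= in_itv/= => /andP[x0 x1].
  rewrite fineK; last first.
    apply: integrable_fin_num => //; apply: itv_integrable.
      by apply: measurable_fun_pair2; case: gh.
    have [_ [C HC]] := gh; exists C => y /andP[y0 y1]; apply: HC.
    by split => //=; rewrite -lerBrDl.
  rewrite integral_mkcond /fubini_F; congr integral. apply/funext => y.
  rewrite /patch.
  have -> : (y \in (`[0%R, (1 - x)%R]%classic : set R)) = ((x, y) \in corner).
    apply/idP/idP; rewrite !inE/= in_itv/= /corner/=.
      by move=> /andP[y0 y1]; split => //=; rewrite -lerBrDl.
    by move=> [_ y0 xy]; rewrite y0/= lerBrDl.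
  by case: ifP.
rewrite /fubini_F (_ : (fun y : R1 => _) = cst 0%E) ?integral0//.
apply/funext => y /=; case: ifPn => //; rewrite inE /corner/= => -[x0 y0 xy].
move: xn; rewrite notin_setE/= in_itv/= x0/=; case.
by apply: le_trans xy; rewrite lerDl.
Qed.

End Triangle.

(** * Integrals over a triangle *)

Section PlaneIntegral.
Variables (R : realType) (N : nat).
Local Notation lam := (@lebesgue_measure R).
Local Notation R1 := (measurableTypeR R).
Local Notation R2 := (R1 * R1)%type.
Local Notation mu2 := (lam \x lam)%E.
Local Notation V := 'rV[R]_N.

Definition par (p : seq V) (z : R2) : V :=
  p`_0 + z.1 *: (p`_1 - p`_0) + z.2 *: (p`_2 - p`_0).

Definition tint (p : seq V) (phi : V -> R) : R :=
  \int[mu2]_(z in @corner R) phi (par p z).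

Lemma affine_par_mx (f : V -> R) (p : seq V) z : affine_fun f ->
  f (par p z) = f p`_0 + z.1 * (f p`_1 - f p`_0) + z.2 * (f p`_2 - f p`_0).
Proof.
move=> af; rewrite /par affine_par//.
have fB x y : f (x - y) - f 0 = f x - f y.
  by rewrite (_ : x - y = -1 *: y + x) ?af; [ring|rewrite scaleN1r addrC].
by rewrite !fB.
Qed.

Lemma measurable_par (phi : V -> R) (p : seq V) : tame phi ->
  measurable_fun [set: R2] (phi \o par p).
Proof.
apply: measurable_tame => f af.
rewrite (_ : _ \o _ = fun z : R2 =>
    f p`_0 + z.1 * (f p`_1 - f p`_0) + z.2 * (f p`_2 - f p`_0)).
  apply: measurable_funD => //; first apply: measurable_funD => //;
  exact: measurable_funM.
by apply/funext => z /=; rewrite affine_par_mx.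
Qed.

Lemma good2_par (phi : V -> R) (p : seq V) : tame phi -> good2 (phi \o par p).
Proof.
move=> tphi; split; first exact: measurable_par.
apply: (bounded_tame _ tphi) => f af.
exists (`|f p`_0| + `|f p`_1 - f p`_0| + `|f p`_2 - f p`_0|) => z [z1 z2 z12].
rewrite affine_par_mx//.
have z1' : z.1 <= 1 by apply: le_trans z12; rewrite lerDl.
have z2' : z.2 <= 1 by apply: le_trans z12; rewrite lerDr.
rewrite (le_trans (ler_normD _ _))// lerD//; last first.
  by rewrite normrM ger0_norm// ler_piMl.
rewrite (le_trans (ler_normD _ _))// lerD//.
by rewrite normrM ger0_norm// ler_piMl.
Qed.

Lemma tint_integrable (phi : V -> R) (p : seq V) : tame phi ->
  mu2.-integrable (@corner R) (EFin \o (phi \o par p)).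
Proof. by move=> tphi; apply/good2_integrable/good2_par. Qed.

Lemma simplex_integralE (p : seq V) (w : form R N 2) :
  tame (fun x => w x (edgemx 2 p)) ->
  simplex_integral p w = tint p (fun x => w x (edgemx 2 p)).
Proof.
move=> tw; rewrite /simplex_integral /tint -(corner_integralE (good2_par p tw)).
congr corner_integral; apply/funext => s /=.
by rewrite /par !big_ord_recl big_ord0 addr0 addrA.
Qed.

Lemma tint_iterated (p : seq V) phi : tame phi -> tint p phi =
  \int[lam]_(x in `[0, 1]) \int[lam]_(y in `[0, 1 - x]) phi (par p (x, y)).
Proof. by move=> tphi; rewrite /tint -(corner_integralE (good2_par p tphi)). Qed.

Lemma tintD p phi psi : tame phi -> tame psi ->
  tint p (fun x => phi x + psi x) = tint p phi + tint p psi.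
Proof.
move=> t1 t2; rewrite /tint RintegralD//; first exact: measurable_corner.
  exact: tint_integrable t1.
exact: tint_integrable t2.
Qed.

Lemma tintZ p c phi : tame phi -> tint p (fun x => c * phi x) = c * tint p phi.
Proof.
move=> t1; rewrite /tint RintegralZl//; first exact: measurable_corner.
exact: tint_integrable t1.
Qed.

Lemma eq_tint p phi psi : phi =1 psi -> tint p phi = tint p psi.
Proof. by move=> /funext ->. Qed.

Lemma tint0 p : tint p (fun=> 0) = 0.
Proof. by rewrite -[RHS](mul0r (tint p (fun=> 0))) -tintZ//; [apply: eq_tint => x; rewrite mul0r|exact: tame_cst]. Qed.

Lemma tintN p phi : tame phi -> tint p (fun x => - phi x) = - tint p phi.
Proof. by move=> t; rewrite -mulN1r -tintZ//; apply: eq_tint => x; rewrite mulN1r. Qed.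

Lemma tint_sum (I : Type) (s : seq I) (P : pred I) p (F : I -> V -> R) :
  (forall i, P i -> tame (F i)) ->
  tint p (fun x => \sum_(i <- s | P i) F i x) = \sum_(i <- s | P i) tint p (F i).
Proof.
move=> tF; elim: s => [|i s IH].
  by rewrite big_nil -[RHS](tint0 p); apply: eq_tint => x; rewrite big_nil.
rewrite big_cons -IH; have [Pi|Pi] := boolP (P i).
  rewrite -tintD; [|exact: tF|exact: tame_sum].
  by apply: eq_tint => x; rewrite big_cons Pi.
by apply: eq_tint => x; rewrite big_cons (negbTE Pi).
Qed.

(** Change of variables between two parametrized triangles of one plane; the
    hypothesis compares the integrands, extended by zero outside of the two
    triangles. *)
Lemma tint_change (p q : seq V) (a b c d e f : R) (phi psi : V -> R) :
  a * d - b * c != 0 -> tame phi -> tame psi ->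
  (forall z, (z \in @corner R)%:R * phi (par q z) =
     let z' := plane_affine a b c d e f z in
     (z' \in @corner R)%:R * psi (par p z')) ->
  tint q phi = `|a * d - b * c|^-1 * tint p psi.
Proof.
move=> det0 tphi tpsi H.
have ext r chi : tint r chi =
    \int[mu2]_z ((z \in @corner R)%:R * chi (par r z)).
  rewrite /tint Rintegral_mkcond; apply: eq_Rintegral => z _.
  by rewrite /patch; case: ifP => _; rewrite ?mul1r ?mul0r.
rewrite !ext -(integral_plane_affine e f det0).
  by apply: eq_Rintegral => z _; rewrite H.
apply: measurable_funM; last exact: measurable_par.
have := @measurable_indic _ _ R setT _ (@measurable_corner R).
by congr measurable_fun; apply/funext => z; rewrite indicE.
Qed.

Lemma line_null (al be ga : R) : (be, ga) != (0, 0) ->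
  mu2.-negligible [set z : R2 | al + z.1 * be + z.2 * ga = 0].
Proof.
move=> bg.
have mZ : measurable [set z : R2 | al + z.1 * be + z.2 * ga = 0].
  have mf : measurable_fun [set: R2] (fun z : R2 => al + z.1 * be + z.2 * ga).
    apply: measurable_funD => //; first apply: measurable_funD => //;
    exact: measurable_funM.
  by rewrite -[X in measurable X]setTI; exact: mf measurableT _ (measurable_set1 0).
apply/negligibleP => //.
have [ga0|ga0] := eqVneq ga 0; last first.
  rewrite /product_measure1 -[RHS](@integral0 _ _ _ lam setT); congr integral.
  apply/funext => x /=.
  rewrite (_ : xsection _ _ = [set - (al + x * be) / ga]) ?lebesgue_measure_set1//.
  apply/seteqP; split=> y; rewrite /xsection/= inE/=.
    by move=> /eqP; rewrite addrC addr_eq0 => /eqP yE; rewrite -yE mulfK.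
  by move=> ->; rewrite divfK// subrr.
have be0 : be != 0 by move: bg; rewrite ga0 xpair_eqE eqxx andbT.
rewrite (_ : [set z | _] = [set - al / be] `*` [set: R1]); last first.
  apply/seteqP; split=> -[x y] /=; rewrite ga0 mulr0 addr0.
    by move=> /eqP; rewrite addrC addr_eq0 => /eqP xb; split => //; rewrite -xb mulfK.
  by move=> [-> _]; rewrite divfK// subrr.
rewrite -[LHS]/(mu2 ([set - al / be] `*` [set: R1])) product_measure1E//=.
by rewrite [X in (X * _)%E](_ : _ = 0%E) ?mul0e//; exact: lebesgue_measure_set1.
Qed.

Lemma tint_null (p : seq V) (phi : V -> R) (s : seq (V -> R)) : tame phi ->
  (forall f, List.In f s -> affine_fun f /\ (f p`_1, f p`_2) != (f p`_0, f p`_0)) ->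
  (forall z, corner z -> phi (par p z) != 0 -> exists2 f, List.In f s & f (par p z) = 0) ->
  tint p phi = 0.
Proof.
move=> tphi Hs Hphi.
have neg : mu2.-negligible [set z | exists2 f, List.In f s & f (par p z) = 0].
  elim: s Hs {Hphi} => [|f s IH] Hs.
    rewrite (_ : [set z | _] = set0); first exact: negligible_set0.
    by apply/seteqP; split=> z //= -[].
  rewrite (_ : [set z | _] = [set z | f (par p z) = 0] `|`
      [set z | exists2 f, List.In f s & f (par p z) = 0]).
    apply: negligibleU; last by apply: IH => g gs; apply: Hs; right.
    have [af fp] := Hs f (or_introl erefl).
    rewrite (_ : [set z | _] = [set z : R2 | f p`_0 + z.1 * (f p`_1 - f p`_0) +
       z.2 * (f p`_2 - f p`_0) = 0]).
      by apply: line_null; rewrite xpair_eqE !subr_eq0 -xpair_eqE.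
    by apply/seteqP; split=> z /=; rewrite affine_par_mx.
  apply/seteqP; split=> z /=.
    by move=> [g [<-|gs] gz]; [left|right; exists g].
  by move=> [fz|[g gs gz]]; [exists f => //; left|exists g => //; right].
rewrite /tint /Rintegral.
have -> : (\int[mu2]_(z in @corner R) (phi (par p z))%:E =
           \int[mu2]_(z in @corner R) (cst 0%E) z)%E.
  apply: ae_eq_integral => //.
  - exact: measurable_corner.
  - by apply/measurable_EFinP/measurable_funTS; exact: measurable_par.
  - apply: negligibleS neg => z /=.
    move=> /not_implyP[cz /eqP]; rewrite eqe => h.
    exact: Hphi.
by rewrite integral0.
Qed.

End PlaneIntegral.

(** * The fundamental theorem of calculus for piecewise quadratic functions *)

Lemma ltn_count (T : eqType) (a1 a2 : pred T) (s : seq T) (x : T) :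
  subpred a1 a2 -> x \in s -> a2 x -> ~~ a1 x -> (count a1 s < count a2 s)%N.
Proof.
move=> sub; elim: s => //= y s IH; rewrite inE => /predU1P[<-|xs] a2x na1.
  by rewrite a2x (negbTE na1) add0n add1n ltnS sub_count.
by rewrite -addnS leq_add ?IH//; case: (boolP (a1 y)) => // /sub ->.
Qed.

Section PiecewiseFTC.
Variable R : realType.
Local Notation lam := (@lebesgue_measure R).

(** Coded by the coefficients, so that the zeros can be listed. *)
Definition aff1 (ab : R * R) (y : R) : R := ab.1 + y * ab.2.

Definition dprod (p q : R * R) (y : R) : R := p.2 * aff1 q y + aff1 p y * q.2.

Lemma affine_aff1 ab : affine_fun (aff1 ab : R^o -> R).
Proof. by move=> k x y; rewrite /aff1 /= /GRing.scale/=; ring. Qed.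

Lemma affine1E (f : R^o -> R) : affine_fun f ->
  forall y : R, f y = f 0 + y * (f 1 - f 0).
Proof.
move=> af y; have := affineE af y 1 0; rewrite addr0 => H.
by rewrite addrC -H; congr f; rewrite -[LHS]mulr1.
Qed.

Lemma measurable_tame1 (f : R^o -> R) : tame f -> measurable_fun [set: measurableTypeR R] f.
Proof.
apply: (@measurable_tame R R^o _ (measurableTypeR R) id) => {}f af.
rewrite (_ : _ \o _ = fun y : R => f 0 + y * (f 1 - f 0)).
  by apply: measurable_funD => //; exact: measurable_funM.
by apply/funext => y; exact: affine1E.
Qed.

Lemma tame1_integrable (f : R^o -> R) a b : tame f ->
  lam.-integrable `[a, b] (EFin \o f).
Proof.
move=> tf; apply: itv_integrable; first exact: measurable_tame1.
have [] := @bounded_tame R R^o R [set y | a <= y <= b] id _ f tf.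
  move=> g ag; exists (`|g 0| + (`|a| + `|b|) * `|g 1 - g 0|) => y /andP[ay yb].
  rewrite /= (affine1E ag y) (le_trans (ler_normD _ _))// lerD2l normrM ler_wpM2r//.
  rewrite ler_norml; apply/andP; split.
    rewrite (le_trans _ ay)// lerNl (le_trans (ler_norm _))// normrN lerDl.
    exact: normr_ge0.
  by rewrite (le_trans yb)// (le_trans (ler_norm _))// lerDr.
by move=> C HC; exists C => y yab; exact: HC.
Qed.

Lemma tame_dprod p q : tame (dprod p q : R^o -> R).
Proof.
apply: tame_add; apply: tame_mul.
- exact: tame_cst.
- exact/tame_affine/affine_aff1.
- exact/tame_affine/affine_aff1.
- exact: tame_cst.
Qed.

Lemma is_derive_prod (p q : R * R) (y : R) :
  is_derive (y : R^o) (1 : R^o) ((fun y => aff1 p y * aff1 q y) : R^o -> R^o) (dprod p q y).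
Proof.
rewrite /aff1 /dprod /aff1; apply: is_derive_eq.
by rewrite /GRing.scale/=; ring.
Qed.

Lemma integral_dprod (p q : R * R) (a b : R) : a <= b ->
  \int[lam]_(y in `[a, b]) dprod p q y = aff1 p b * aff1 q b - aff1 p a * aff1 q a.
Proof.
rewrite le_eqVlt => /predU1P[->|ab].
  by rewrite set_itv1 Rintegral_set1 subrr.
rewrite /Rintegral (@continuous_FTC2 _ _ (fun y => aff1 p y * aff1 q y))//.
- apply: continuous_subspaceT => y.
  have dd : derivable (dprod p q : R^o -> R^o) (y : R^o) 1 by rewrite /dprod /aff1.
  exact/differentiable_continuous/derivable1_diffP.
- have dp (y : R^o) : derivable ((fun y => aff1 p y * aff1 q y) : R^o -> R^o) y 1.
    by have [] := is_derive_prod p q y.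
  have cp (y : R^o) : {for y, continuous ((fun y => aff1 p y * aff1 q y) : R^o -> R^o)}.
    exact/differentiable_continuous/derivable1_diffP.
  split=> [y _||]; first exact: dp.
    exact/cvg_at_right_filter/cp.
  exact/cvg_at_left_filter/cp.
- move=> y _; rewrite derive1E.
  by have [_ ->] := is_derive_prod p q y.
Qed.

Section Pieces.
Variables (I : finType) (P : pred I) (C : I -> seq (R * R)).
Variables (p q : I -> R * R).

Definition piece i (y : R) : bool := all (fun ab => 0 <= aff1 ab y) (C i).

Lemma tame_piece i : tame (fun y : R^o => (piece i y)%:R : R).
Proof.
rewrite (_ : (fun y : R^o => _) = (fun y : R^o =>
  (all (fun f : R^o -> R => 0 <= f y) [seq aff1 ab : R^o -> R | ab <- C i])%:R)).
  apply: tame_all => f; elim: (C i) => //= ab s IH [<-|/IH//].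
  exact: affine_aff1.
by apply/funext => y; rewrite /piece all_map.
Qed.

(** Without sign change in between, an affine condition fulfilled at one point
    of an open interval holds on its closure. *)
Lemma piece_closed i (a b m y : R) : a < m < b -> a <= y <= b -> piece i m ->
  (forall ab, ab \in C i -> ab.2 != 0 -> ~~ (a < - ab.1 / ab.2 < b)) -> piece i y.
Proof.
move=> /andP[am mb] /andP[ay yb] /allP Jm nob; apply/allP => -[al be] abC.
have := Jm _ abC; have := nob _ abC; rewrite /aff1/= => nb m0.
rewrite leNgt; apply/negP => y0.
have be0 : be != 0.
  by apply/negP => /eqP b0; move: m0 y0; rewrite b0 !mulr0 addr0 leNgt => /negP.
have /negP := nb be0; apply.
set r := - al / be.
have rE z : al + z * be = (z - r) * be by rewrite /r; field.
move: m0 y0; rewrite !rE.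
have [bgt|blt] : 0 < be \/ be < 0 by case: (ltrgtP be 0) be0 => //; [right|left].
  rewrite pmulr_lge0// pmulr_llt0// subr_ge0 subr_lt0 => rm yr.
  by rewrite (le_lt_trans ay yr) (le_lt_trans rm mb).
rewrite nmulr_lge0// nmulr_llt0// subr_le0 subr_gt0 => mr ry.
by rewrite (lt_le_trans am mr) (lt_le_trans ry yb).
Qed.

(** A continuous function that is quadratic on each of finitely many intervals
    which cover [a, b] and overlap at most at endpoints.  Induction on the
    number of possible endpoints in ]a, b[. *)
Lemma piecewise_FTC (g : R -> R) (a b : R) : a <= b ->
  (forall y, a <= y <= b -> exists2 i, P i & piece i y) ->
  (forall i y, P i -> a <= y <= b -> piece i y -> g y = aff1 (p i) y * aff1 (q i) y) ->
  (forall i j y z, P i -> P j -> a <= y -> y < z -> z <= b ->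
     piece i y -> piece i z -> piece j y -> piece j z -> i = j) ->
  \int[lam]_(y in `[a, b]) (\sum_(i | P i) (piece i y)%:R * dprod (p i) (q i) y) =
  g b - g a.
Proof.
pose bp := flatten [seq [seq - ab.1 / ab.2 | ab <- C i] | i <- enum I].
pose inn a b := [seq r <- bp | a < r < b].
have tint : tame (fun y : R^o =>
    \sum_(i | P i) (piece i y)%:R * dprod (p i) (q i) y).
  by apply: tame_sum => i _; apply: tame_mul; [exact: tame_piece|exact: tame_dprod].
have [n le_n] := ubnP (size (inn a b)).
elim: n => // n IH in a b le_n *.
rewrite le_eqVlt => /predU1P[-> *|ab cover val disj].
  by rewrite set_itv1 Rintegral_set1 subrr.
case E : (inn a b) le_n => [|r s].
  move=> _; pose m := (a + b) / 2.
  have amb : a < m < b by rewrite /m; apply/andP; split; lra.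
  have nob i c : c \in C i -> c.2 != 0 -> ~~ (a < - c.1 / c.2 < b).
    move=> ci _; apply/negP => h.
    suff : - c.1 / c.2 \in inn a b by rewrite E.
    rewrite mem_filter h/=; apply/flattenP.
    exists [seq - ab.1 / ab.2 | ab <- C i].
      by apply: map_f; rewrite mem_enum.
    by apply/mapP; exists c.
  have [i Pi Jm] : exists2 i, P i & piece i m.
    by apply: cover; case/andP: amb => ? ?; rewrite !ltW.
  have Ji y : a <= y <= b -> piece i y.
    by move=> yab; apply: piece_closed amb yab Jm _ => c; exact: nob.
  have Jj j y : P j -> a < y < b -> piece j y -> j = i.
    move=> Pj yab Jy; have Jja z : a <= z <= b -> piece j z.
      by move=> zab; apply: piece_closed yab zab Jy _ => c; exact: nob.
    by apply: (disj _ _ a b Pj Pi); rewrite ?Jja ?Ji ?lexx ?ltW.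
  rewrite [g b](val i)// ?[g a](val i)// ?lexx ?ltW// ?Ji ?lexx ?ltW//.
  rewrite -integral_dprod ?ltW//.
  have td : tame (dprod (p i) (q i) : R^o -> R) by exact: tame_dprod.
  have obnd (f : R^o -> R) : tame f ->
      \int[lam]_(y in `[a, b]) f y = \int[lam]_(y in `]a, b[) f y.
    move=> tf; have if0 := tame1_integrable a b tf.
    rewrite -Rintegral_itv_obnd_cbnd; last first.
      apply: integrableS if0 => // y; rewrite /= !in_itv/= => /andP[ay ->].
      by rewrite ltW.
    rewrite -Rintegral_itv_bndo_bndc//.
    apply: integrableS if0 => // y; rewrite /= !in_itv/= => /andP[ay yb].
    by rewrite !ltW.
  rewrite !obnd//; apply: eq_Rintegral => y; rewrite inE/= in_itv/= => yab.
  rewrite (bigD1 i)//= Ji ?mul1r; last by case/andP: yab => ? ?; rewrite !ltW.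
  rewrite big1 ?addr0// => j /andP[Pj ji].
  case Jy : (piece j y); last by rewrite mul0r.
  by move: ji; rewrite (Jj j y Pj yab Jy) eqxx.
move=> le_n.
have : r \in inn a b by rewrite E mem_head.
rewrite mem_filter => /andP[/andP[ar rb] rbp].
have sub c d : a <= c -> d <= b -> (c == r) || (d == r) -> (size (inn c d) < n)%N.
  move=> ac db cdr; have le' : (size (inn a b) <= n)%N by rewrite E.
  apply: leq_trans le'.
  rewrite !size_filter (@ltn_count _ _ _ _ r)//= ?ar ?rb//.
    by move=> x /= /andP[cx xd]; rewrite (le_lt_trans ac cx) (lt_le_trans xd db).
  by case/orP: cdr => /eqP->; rewrite ltxx ?andbF.
have iab := tame1_integrable a b tint.
have := @Rintegral_itvB R _ (BLeft a) (BRight b) r iab.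
rewrite !bnd_simp => /(_ (ltW ar) (ltW rb)) /eqP; rewrite subr_eq => /eqP ->.
rewrite Rintegral_itv_obnd_cbnd; last first.
  apply: integrableS iab => // y; rewrite /= !in_itv/= => /andP[ry ->].
  by rewrite (ltW (lt_trans ar ry)).
rewrite (IH r b) ?(IH a r) ?ltW//; last 8 first.
- by apply: sub; rewrite ?lexx ?eqxx ?orbT// ltW.
- by move=> y /andP[ay yr]; apply: cover; rewrite ay (le_trans yr (ltW rb)).
- by move=> i y Pi /andP[ay yr]; apply: val => //; rewrite ay (le_trans yr (ltW rb)).
- by move=> i j y z Pi Pj ay yz zr; apply: disj => //; rewrite (le_trans zr (ltW rb)).
- by apply: sub; rewrite ?lexx ?eqxx ?orbT// ltW.
- by move=> y /andP[ry yb]; apply: cover; rewrite yb (le_trans (ltW ar) ry).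
- by move=> i y Pi /andP[ry yb]; apply: val => //; rewrite yb (le_trans (ltW ar) ry).
- by move=> i j y z Pi Pj ry yz zb; apply: disj => //; rewrite (le_trans (ltW ar) ry).
by ring.
Qed.

End Pieces.
End PiecewiseFTC.

End Integration.

From mathcomp Require Import fintype finset.

(** * Permutation signs of two and three nodes *)

Lemma det_mx33 (R : comRingType) (A : 'M[R]_3) : \det A =
  A 0 0 * (A 1 1 * A (inord 2) (inord 2) - A 1 (inord 2) * A (inord 2) 1)
  - A 0 1 * (A 1 0 * A (inord 2) (inord 2) - A 1 (inord 2) * A (inord 2) 0)
  + A 0 (inord 2) * (A 1 0 * A (inord 2) 1 - A 1 1 * A (inord 2) 0).
Proof.
have [F AE] : exists F : nat -> nat -> R, forall i j, A i j = F i j.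
  by exists (fun i j => A (inord i) (inord j)) => i j; rewrite !inord_val.
rewrite (expand_det_row _ ord0) !big_ord_recl big_ord0 addr0 /cofactor.
have d2 (B : 'M[R]_2) : \det B = B 0 0 * B 1 1 - B 0 1 * B 1 0.
  rewrite (expand_det_row _ ord0) !big_ord_recl big_ord0 addr0 /cofactor.
  rewrite !det_mx11 !mxE /= expr0 expr1 mul1r mulN1r mulrN.
  by congr (_ * B _ _ - B _ _ * B _ _); exact: val_inj.
rewrite !d2 !mxE !AE /= !inordK//= /bump /= .
ring.
Qed.

Section Signs.
Variables (R : realType) (V : finType).
Implicit Types (x y z : V) (s : seq V).

Lemma perm3P x y z s : x != y -> x != z -> y != z -> perm_eq s [:: x; y; z] ->
  s \in [:: [:: x; y; z]; [:: x; z; y]; [:: y; x; z]; [:: y; z; x]; [:: z; x; y];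
            [:: z; y; x]].
Proof.
move=> xy xz yz ps.
have : uniq s by rewrite (perm_uniq ps)/= !inE negb_or xy xz yz.
have ms : {subset s <= [:: x; y; z]} by move=> u; rewrite (perm_mem ps).
have := perm_size ps; case: s ps ms => [|s0 [|s1 [|s2 [|]]]]//= ps ms _.
have := ms s0; have := ms s1; have := ms s2.
rewrite !inE !eqxx !orbT /= => /(_ isT) + /(_ isT) + /(_ isT).
rewrite !eqseq_cons !andbT.
by case/or3P => /eqP ->; case/or3P => /eqP ->; case/or3P => /eqP ->;
   rewrite ?eqxx ?orbT ?andbF//= ?(eq_sym y x) ?(eq_sym z x) ?(eq_sym z y)
   ?(negbTE xy) ?(negbTE xz) ?(negbTE yz) ?eqxx ?orbT ?orbF.
Qed.

Lemma perm2P x y s : x != y -> perm_eq s [:: x; y] ->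
  s = [:: x; y] \/ s = [:: y; x].
Proof.
move=> xy ps.
have : uniq s by rewrite (perm_uniq ps)/= !inE xy.
have ms : {subset s <= [:: x; y]} by move=> u; rewrite (perm_mem ps).
have := perm_size ps; case: s ps ms => [|s0 [|s1 [|]]]//= ps ms _.
have := ms s0; have := ms s1.
rewrite !inE !eqxx !orbT /= => /(_ isT) + /(_ isT).
by case/orP => /eqP ->; case/orP => /eqP ->; rewrite ?eqxx//; [right|left].
Qed.

Lemma perm_sign3 a (x0 x1 x2 y0 y1 y2 : V) :
  perm_sign R a [:: x0; x1; x2] [:: y0; y1; y2] =
  (x0 == y0)%:R * ((x1 == y1)%:R * (x2 == y2)%:R - (x1 == y2)%:R * (x2 == y1)%:R)
  - (x0 == y1)%:R * ((x1 == y0)%:R * (x2 == y2)%:R - (x1 == y2)%:R * (x2 == y0)%:R)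
  + (x0 == y2)%:R * ((x1 == y0)%:R * (x2 == y1)%:R - (x1 == y1)%:R * (x2 == y0)%:R).
Proof. by rewrite /perm_sign det_mx33 !mxE !inordK. Qed.

Lemma perm_sign2 a (x0 x1 y0 y1 : V) :
  perm_sign R a [:: x0; x1] [:: y0; y1] =
  (x0 == y0)%:R * (x1 == y1)%:R - (x0 == y1)%:R * (x1 == y0)%:R.
Proof.
rewrite /perm_sign (expand_det_row _ ord0) !big_ord_recl big_ord0 addr0 /cofactor.
by rewrite !det_mx11 !mxE /= expr0 expr1 mul1r mulN1r mulrN.
Qed.

(** Formulas that are alternating in the nodes do not depend on the chosen
    orderings of the cells, if these are accounted for by [perm_sign]. *)
Lemma alternating3 a x y z s (F : V -> V -> V -> R) :
  (forall x y z, F y x z = - F x y z) -> (forall x y z, F x z y = - F x y z) ->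
  x != y -> x != z -> y != z -> perm_eq s [:: x; y; z] ->
  exists s0 s1 s2 : V, [/\ s = [:: s0; s1; s2],
    F s0 s1 s2 = perm_sign R a [:: x; y; z] s * F x y z &
    F x y z = perm_sign R a [:: x; y; z] s * F s0 s1 s2].
Proof.
move=> F1 F2 xy xz yz ps; have := perm3P xy xz yz ps.
have n := (negbTE xy, negbTE xz, negbTE yz, eq_sym y x, eq_sym z x, eq_sym z y).
have F3 u v w : F w v u = - F u v w by rewrite F1 F2 F1 opprK.
have F4 u v w : F v w u = F u v w by rewrite F1 F3 F1 F2 opprK F1 opprK.
have F5 u v w : F w u v = F u v w by rewrite -F4.
rewrite !inE => /or4P[/eqP->|/eqP->|/eqP->|/or3P[]/eqP->];
  do 3 eexists; (split; first reflexivity);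
  rewrite perm_sign3 !eqxx ?n /= ?(F4 x y z) ?(F5 x y z) ?(F1 x y z) ?(F2 x y z) ?(F3 x y z) ; ring.
Qed.

Lemma perm_sign3_sqr a x y z s : x != y -> x != z -> y != z ->
  perm_eq s [:: x; y; z] ->
  perm_sign R a [:: x; y; z] s * perm_sign R a [:: x; y; z] s = 1.
Proof.
move=> xy xz yz ps; have := perm3P xy xz yz ps.
have n := (negbTE xy, negbTE xz, negbTE yz, eq_sym y x, eq_sym z x, eq_sym z y).
by rewrite !inE => /or4P[/eqP->|/eqP->|/eqP->|/or3P[]/eqP->];
  rewrite perm_sign3 !eqxx ?n /=; ring.
Qed.

Lemma perm_sign3C12 a b x y z (s0 s1 s2 : V) :
  perm_sign R a [:: y; x; z] [:: s0; s1; s2] = - perm_sign R b [:: x; y; z] [:: s0; s1; s2].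
Proof. by rewrite !perm_sign3; ring. Qed.

Lemma perm_sign3C23 a b x y z (s0 s1 s2 : V) :
  perm_sign R a [:: x; z; y] [:: s0; s1; s2] = - perm_sign R b [:: x; y; z] [:: s0; s1; s2].
Proof. by rewrite !perm_sign3; ring. Qed.

Lemma perm_sign2C a b x y (s0 s1 : V) :
  perm_sign R a [:: y; x] [:: s0; s1] = - perm_sign R b [:: x; y] [:: s0; s1].
Proof. by rewrite !perm_sign2; ring. Qed.

Lemma perm_sign2_sqr a x y s : x != y -> perm_eq s [:: x; y] ->
  perm_sign R a [:: x; y] s * perm_sign R a [:: x; y] s = 1.
Proof.
move=> xy ps; case: (perm2P xy ps) => ->;
by rewrite perm_sign2 !eqxx ?(eq_sym y x) ?(negbTE xy) /=; ring.
Qed.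

End Signs.

(** * Incidence numbers *)

Section SetOfThree.
Variable V : finType.
Implicit Types (x y z : V) (K : {set V}).

Lemma mem3 x y z u : (u \in [set x; y; z]) = [|| u == x, u == y | u == z].
Proof. by rewrite !inE -orbA. Qed.

Lemma cards3 x y z : x != y -> x != z -> y != z -> #|[set x; y; z]| = 3%N.
Proof.
move=> xy xz yz; rewrite setUC cardsU1 cards2 !inE negb_or.
by rewrite (eq_sym z x) (eq_sym z y) xz yz xy.
Qed.

Lemma card3_from K x : #|K| = 3%N -> x \in K ->
  exists y z, [/\ x != y, x != z, y != z & K = [set x; y; z]].
Proof.
move=> K3 xK; have : #|K :\ x| = 2%N by move: K3; rewrite (cardsD1 x K) xK => -[].
move=> /eqP/cards2P[y [z [yz Kx]]]; exists y, z.
have : y \in K :\ x by rewrite Kx !inE eqxx.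
have : z \in K :\ x by rewrite Kx !inE eqxx orbT.
rewrite !inE => /andP[zx zK] /andP[yx yK].
split; rewrite ?(eq_sym x)//.
by rewrite -(setD1K xK) Kx setUA.
Qed.

Lemma card3_from2 K x y : #|K| = 3%N -> x \in K -> y \in K -> x != y ->
  exists z, [/\ x != z, y != z & K = [set x; y; z]].
Proof.
move=> K3 xK yK xy; have [u [v [xu xv uv KE]]] := card3_from K3 xK.
move: yK; rewrite KE mem3 (eq_sym y x) (negbTE xy)/= => /orP[]/eqP->.
  by exists v.
by exists u; split => //; [rewrite eq_sym|rewrite -!setUA [[set v; u]]setUC].
Qed.

Lemma set3C12 x y z : [set y; x; z] = [set x; y; z].
Proof. by rewrite [[set y; x]]setUC. Qed.

Lemma set3C23 x y z : [set x; z; y] = [set x; y; z].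
Proof. by rewrite -!setUA [[set z; y]]setUC. Qed.

Lemma set3C13 x y z : [set z; y; x] = [set x; y; z].
Proof. by rewrite set3C12 set3C23 set3C12. Qed.

Lemma set3_rot x y z : [set z; x; y] = [set x; y; z].
Proof. by rewrite set3C12 set3C23. Qed.

Lemma perm_enum3 x y z s : x != y -> x != z -> y != z ->
  perm_eq s (enum [set x; y; z]) -> perm_eq s [:: x; y; z].
Proof.
move=> xy xz yz /perm_trans; apply; apply: uniq_perm; rewrite ?enum_uniq//=.
  by rewrite !inE negb_or xy xz yz.
by move=> u; rewrite mem_enum mem3 !inE.
Qed.

Lemma perm_enum2 x y s : x != y ->
  perm_eq s (enum [set x; y]) -> perm_eq s [:: x; y].
Proof.
move=> xy /perm_trans; apply; apply: uniq_perm; rewrite ?enum_uniq//=.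
  by rewrite !inE xy.
by move=> u; rewrite mem_enum !inE.
Qed.

Lemma subset_card2 K : #|K| = 2%N -> exists x y, x != y /\ K = [set x; y].
Proof. by move=> /eqP/cards2P[x [y [xy KE]]]; exists x, y. Qed.

End SetOfThree.

(** This part suffices to compute incidence numbers; it is available for the
    refinement before anything is known about its geometry. *)
Record ordered (R : realType) (N : nat) (M : mesh R N) : Prop := {
  reg_card : forall K, K \in facets M -> #|K| = 3%N;
  reg_ord : cell_orders M
}.

(** The part of [triangulation] that the barycentric refinement inherits. *)
Record regular (R : realType) (N : nat) (M : mesh R N) : Prop := {
  reg_ordered :> ordered M;
  reg_free : forall K, K \in facets M -> row_free (edgemx 2 (vert K));
  reg_inter : forall K L, K \in facets M -> L \in facets M ->
    (simplex K `&` simplex L `<=` simplex (K :&: L)%SET)%classic;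
  reg_coherent : forall e, e \in cells M 1 -> ~~ on_bd (facets M) e ->
    \sum_(K in facets M | e \subset K) orn K * incid e K = 0
}.

Lemma triangulation_regular (R : realType) (N : nat) (M : mesh R N) :
  triangulation M -> regular M.
Proof. by case=> *; split=> //; split. Qed.

Section Incidence.
Variables (R : realType) (N : nat) (M : mesh R N).
Hypothesis rM : ordered M.
Implicit Types (a b c : node M) (K L e : {set node M}).

Definition sgn2 a b : R := perm_sign R a [:: a; b] (ord [set a; b]).
Definition sgn3 a b c : R := perm_sign R a [:: a; b; c] (ord [set a; b; c]).

Lemma cellP r K : reflect (#|K| = r.+1 /\ exists2 L, L \in facets M & K \subset L)
  (K \in cells M r).
Proof.
rewrite inE; apply: (iffP andP) => -[/eqP cK].
  by move=> /existsP[L /andP[LM KL]]; split=> //; exists L.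
by move=> [L LM KL]; split; [exact: cK|apply/existsP; exists L; rewrite LM].
Qed.

Lemma facet_cell K : K \in facets M -> K \in cells M 2.
Proof. by move=> KM; apply/cellP; split; [exact: (reg_card rM KM)|exists K]. Qed.

Lemma cell_facet K : K \in cells M 2 -> K \in facets M.
Proof.
move=> /cellP[cK [L LM KL]].
by have /eqP -> : K == L by rewrite eqEcard KL cK (reg_card rM LM).
Qed.

Lemma facet_edge a b c : a != b -> [set a; b; c] \in facets M ->
  [set a; b] \in cells M 1.
Proof.
move=> ab KM; apply/cellP; rewrite cards2 ab; split => //.
by exists [set a; b; c] => //; exact: subsetUl.
Qed.

Lemma facet_node a K : K \in facets M -> a \in K -> [set a] \in cells M 0.
Proof.
by move=> KM aK; apply/cellP; rewrite cards1; split=> //; exists K; rewrite ?sub1set.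
Qed.

Lemma edge_node a b : [set a; b] \in cells M 1 -> [set a] \in cells M 0.
Proof.
move=> /cellP[_ [L LM /subsetP sub]]; apply: (facet_node LM).
by apply: sub; rewrite !inE eqxx.
Qed.

Lemma ord_node a : [set a] \in cells M 0 -> ord [set a] = [:: a].
Proof.
move=> aM; have := reg_ord rM aM; rewrite enum_set1.
by move=> /perm_small_eq; apply.
Qed.

Lemma ord_edge a b : a != b -> [set a; b] \in cells M 1 ->
  perm_eq (ord [set a; b]) [:: a; b].
Proof. by move=> ab eM; apply: perm_enum2 => //; exact: (reg_ord rM eM). Qed.

Lemma ord_facet a b c : a != b -> a != c -> b != c -> [set a; b; c] \in facets M ->
  perm_eq (ord [set a; b; c]) [:: a; b; c].
Proof.
move=> ab ac bc KM; apply: perm_enum3 => //.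
by apply: (reg_ord rM (r := 2)); exact: facet_cell.
Qed.

Lemma sgn2_sqr a b : a != b -> [set a; b] \in cells M 1 -> sgn2 a b * sgn2 a b = 1.
Proof. by move=> ab eM; apply: perm_sign2_sqr => //; exact: ord_edge. Qed.

Lemma sgn2C a b : a != b -> [set a; b] \in cells M 1 -> sgn2 b a = - sgn2 a b.
Proof.
move=> ab eM; rewrite /sgn2 [[set b; a]]setUC; have := ord_edge ab eM.
by move=> /(perm2P ab)[] ->; exact: perm_sign2C.
Qed.

Lemma sgn3_sqr a b c : a != b -> a != c -> b != c -> [set a; b; c] \in facets M ->
  sgn3 a b c * sgn3 a b c = 1.
Proof. by move=> ab ac bc KM; apply: perm_sign3_sqr => //; exact: ord_facet. Qed.

Lemma ord_facet_list a b c : a != b -> a != c -> b != c -> [set a; b; c] \in facets M ->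
  exists s0 s1 s2, ord [set a; b; c] = [:: s0; s1; s2].
Proof.
move=> ab ac bc KM; have := perm_size (ord_facet ab ac bc KM).
by case: (ord _) => [|s0 [|s1 [|s2 []]]]// _; exists s0, s1, s2.
Qed.

Lemma sgn3C12 a b c : a != b -> a != c -> b != c -> [set a; b; c] \in facets M ->
  sgn3 b a c = - sgn3 a b c.
Proof.
move=> ab ac bc KM; rewrite /sgn3 set3C12.
have [s0 [s1 [s2 ->]]] := ord_facet_list ab ac bc KM; exact: perm_sign3C12.
Qed.

Lemma sgn3C23 a b c : a != b -> a != c -> b != c -> [set a; b; c] \in facets M ->
  sgn3 a c b = - sgn3 a b c.
Proof.
move=> ab ac bc KM; rewrite /sgn3 set3C23.
have [s0 [s1 [s2 ->]]] := ord_facet_list ab ac bc KM; exact: perm_sign3C23.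
Qed.

Lemma sgn3_rot a b c : a != b -> a != c -> b != c -> [set a; b; c] \in facets M ->
  sgn3 c a b = sgn3 a b c.
Proof.
move=> ab ac bc KM.
have ca : c != a by rewrite eq_sym.
have cb : c != b by rewrite eq_sym.
have KM' : [set a; c; b] \in facets M by rewrite set3C23.
by rewrite (sgn3C12 ac ab cb KM') (sgn3C23 ab ac bc KM) opprK.
Qed.

Lemma incid_edge a b : a != b -> [set a; b] \in cells M 1 ->
  incid [set a] [set a; b] = sgn2 b a.
Proof.
move=> ab eM; rewrite /incid subsetUl cards2 cards1 ab /=.
have -> : [set a; b] :\: [set a] = [set b].
  by apply/setP => u; rewrite !inE; case: eqVneq => // ->; rewrite (negbTE ab).
by rewrite big_set1 (ord_node (edge_node eM)) /sgn2 [[set b; a]]setUC.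
Qed.

Lemma incid_facet a b c : a != b -> a != c -> b != c -> [set a; b; c] \in facets M ->
  incid [set a; b] [set a; b; c] = sgn2 a b * sgn3 a b c.
Proof.
move=> ab ac bc KM; rewrite /incid subsetUl cards2 cards3// ab /=.
have -> : [set a; b; c] :\: [set a; b] = [set c].
  apply/setP => u; rewrite !inE; case: (eqVneq u c) => [->|uc].
    by rewrite (eq_sym c a) (eq_sym c b) (negbTE ac) (negbTE bc).
  by rewrite orbF andNb.
rewrite big_set1.
have [s0 [s1 [s2 sE]]] := ord_facet_list ab ac bc KM.
have eM := facet_edge ab KM.
rewrite -(sgn3_rot ab ac bc KM) /sgn3 (set3_rot a b c) sE /sgn2.
have [->|->] := perm2P ab (ord_edge ab eM).
  by rewrite perm_sign2 !eqxx (negbTE ab) (eq_sym b) (negbTE ab)/=; ring.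
rewrite perm_sign2 !eqxx (negbTE ab) (eq_sym b) (negbTE ab)/= !perm_sign3; ring.
Qed.

End Incidence.

(** * Barycentric coordinates *)

Lemma big_set3 (V : finType) (W : nmodType) (a b c : V) (F : V -> W) :
  a != b -> a != c -> b != c -> \sum_(u in [set a; b; c]) F u = F a + F b + F c.
Proof.
move=> ab ac bc; rewrite setUC big_setU1/= ?big_setU1/= ?big_set1 ?inE.
- by rewrite addrC.
- by [].
- by rewrite negb_or eq_sym ac eq_sym bc.
Qed.

Section AffineFun.
Variables (R : realType) (V : lmodType R).

Lemma affine_add (f g : V -> R) : affine_fun f -> affine_fun g ->
  affine_fun (fun x => f x + g x).
Proof. by move=> af ag k x y; rewrite (affineE af) (affineE ag); ring. Qed.

Lemma affine_scale (k : R) (f : V -> R) : affine_fun f -> affine_fun (fun x => k * f x).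
Proof. by move=> af l x y; rewrite (affineE af); ring. Qed.

Lemma affine_opp (f : V -> R) : affine_fun f -> affine_fun (fun x => - f x).
Proof. by move=> af l x y; rewrite (affineE af); ring. Qed.

Lemma affine_sub (f : V -> R) : affine_fun f -> forall x y,
  f (x - y) - f 0 = f x - f y.
Proof.
move=> af x y.
by rewrite (_ : x - y = -1 *: y + x) ?(affineE af); [ring|rewrite scaleN1r addrC].
Qed.

Lemma affine_comb (f : V -> R) (I : finType) (P : pred I) (c : I -> R) (x : I -> V) :
  affine_fun f -> \sum_(i | P i) c i = 1 ->
  f (\sum_(i | P i) c i *: x i) = \sum_(i | P i) c i * f (x i).
Proof.
move=> af c1; rewrite -[LHS](subrK (f 0)).
have -> : f (\sum_(i | P i) c i *: x i) - f 0 = \sum_(i | P i) c i * (f (x i) - f 0).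
  apply: (big_ind2 (fun u v => f u - f 0 = v)); first by rewrite subrr.
    by move=> u s v t <- <-; have := affineE af 1 u v; rewrite scale1r => ->; ring.
  by move=> i _; have := affineE af (c i) (x i) 0; rewrite addr0 => ->; ring.
rewrite -[f 0 in X in _ + X]mul1r -c1 mulr_suml -big_split/=.
by apply: eq_bigr => i _; ring.
Qed.

Lemma affine_In (I : Type) (F : I -> V -> R) s f :
  List.In f [seq F i | i <- s] -> (forall i, affine_fun (F i)) -> affine_fun f.
Proof. by move=> + aF; elim: s => //= i s IH [<-|/IH]. Qed.

End AffineFun.

Section SumBary.
Variables (R : realType) (N : nat) (M : mesh R N).
Hypothesis rM : ordered M.
Implicit Types (K : {set node M}) (x : 'rV[R]_N).

Lemma facet_ord K : K \in facets M -> exists k0 k1 k2,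
  [/\ k0 != k1, k0 != k2, k1 != k2, K = [set k0; k1; k2] & ord K = [:: k0; k1; k2]].
Proof.
move=> KM; have pK := reg_ord rM (facet_cell rM KM).
have := perm_size pK; rewrite -cardE (reg_card rM KM).
have := perm_uniq pK; rewrite enum_uniq.
have mK := perm_mem pK.
case: (ord K) mK => [|k0 [|k1 [|k2 []]]]// mK /=.
rewrite !inE negb_or !andbT => /andP[/andP[n01 n02] n12] _.
exists k0, k1, k2; split => //; apply/setP => u.
by rewrite mem3 -(mem_enum K) -mK !inE.
Qed.

Lemma sum_bary K x : K \in facets M -> \sum_(a in K) bary K a x = 1.
Proof.
move=> KM; have [k0 [k1 [k2 [n01 n02 n12 KE oK]]]] := facet_ord KM.
rewrite {1}KE big_set3// /bary oK /= !eqxx (negbTE n01) (negbTE n02) (negbTE n12).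
rewrite !big_ord_recl big_ord0 addr0 /=.
set y := _ *m _; have -> : inord 0 = ord0 :> 'I_2 by apply: val_inj; rewrite /= inordK.
have -> : inord 1 = lift ord0 ord0 :> 'I_2 by apply: val_inj; rewrite /= inordK.
ring.
Qed.

End SumBary.

Section Barycentric.
Variables (R : realType) (N : nat) (M : mesh R N).
Hypothesis rM : regular M.
Implicit Types (a b c : node M) (K L : {set node M}) (x : 'rV[R]_N).

Lemma affine_coord (A : 'M[R]_(N, 2)) (p : 'rV[R]_N) j :
  affine_fun (fun x => ((x - p) *m A) 0 j).
Proof.
move=> k x y; rewrite !mulmxBl !mulmxDl mul0mx -scalemxAl !mxE; ring.
Qed.

Lemma affine_bary K a : affine_fun (bary K a).
Proof.
rewrite /bary; case: (index a (ord K)) => [|j]; last exact: affine_coord.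
rewrite (_ : (fun x => _) = (fun x => 1 +
   - (((x - (vert K)`_0) *m pinvmx (edgemx 2 (vert K))) 0 0 +
      ((x - (vert K)`_0) *m pinvmx (edgemx 2 (vert K))) 0 1))).
  apply: affine_add; first exact: affine_cst.
  by apply/affine_opp/affine_add; exact: affine_coord.
apply/funext => x; rewrite !big_ord_recl big_ord0 addr0.
by have -> : lift ord0 ord0 = 1 :> 'I_2 by exact: val_inj.
Qed.

Lemma edgemxE (p : seq 'rV[R]_N) (i : 'I_2) : row i (edgemx 2 p) = p`_i.+1 - p`_0.
Proof. by apply/rowP => j; rewrite !mxE. Qed.

Lemma par_edgemx (p : seq 'rV[R]_N) (y : 'rV[R]_2) :
  par p (y 0 0, y 0 1) = p`_0 + y *m edgemx 2 p.
Proof.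
rewrite mulmx_sum_row !big_ord_recl big_ord0 addr0 !edgemxE /par /= addrA.
by have -> : lift ord0 ord0 = 1 :> 'I_2 by exact: val_inj.
Qed.

Definition row2 (s t : R) : 'rV[R]_2 := \row_j [:: s; t]`_j.

Lemma par_row2 (p : seq 'rV[R]_N) s t : par p (s, t) = p`_0 + row2 s t *m edgemx 2 p.
Proof. by rewrite -par_edgemx !mxE. Qed.

Lemma bary_par K k0 k1 k2 s t : K \in facets M -> ord K = [:: k0; k1; k2] ->
  k0 != k1 -> k0 != k2 -> k1 != k2 ->
  [/\ bary K k0 (par (vert K) (s, t)) = 1 - s - t,
      bary K k1 (par (vert K) (s, t)) = s &
      bary K k2 (par (vert K) (s, t)) = t].
Proof.
move=> KM oK n01 n02 n12.
have yE : (par (vert K) (s, t) - (vert K)`_0) *m pinvmx (edgemx 2 (vert K)) = row2 s t.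
  by rewrite par_row2 addrC addKr -mulmxA mulmxVp ?mulmx1// (reg_free rM).
rewrite /bary yE oK /= !eqxx (negbTE n01) (negbTE n02) (negbTE n12) /=.
rewrite !big_ord_recl big_ord0 addr0 !mxE /= !inordK//=.
by split=> //; ring.
Qed.

Lemma vertE K k0 k1 k2 : ord K = [:: k0; k1; k2] ->
  vert K = [:: pos k0; pos k1; pos k2].
Proof. by rewrite /vert => ->. Qed.

Lemma bary_pos K a b : K \in facets M -> a \in K -> b \in K ->
  bary K a (pos b) = (a == b)%:R.
Proof.
move=> KM; have [k0 [k1 [k2 [n01 n02 n12 KE oK]]]] := facet_ord rM KM.
have vK := vertE oK.
have E s t := bary_par s t KM oK n01 n02 n12.
have p0 : pos k0 = par (vert K) (0, 0).
  by rewrite vK /par/= !scale0r !addr0.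
have p1 : pos k1 = par (vert K) (1, 0).
  by rewrite vK /par/= scale0r scale1r addr0 addrC subrK.
have p2 : pos k2 = par (vert K) (0, 1).
  by rewrite vK /par/= scale0r scale1r addr0 addrC subrK.
have [a0 a1 a2] := E 0 0; have [b0 b1 b2] := E 1 0; have [c0 c1 c2] := E 0 1.
rewrite {1 2}KE !mem3 => aK bK.
case/or3P: bK aK => /eqP-> /or3P[] /eqP->;
  rewrite ?p0 ?p1 ?p2 ?a0 ?a1 ?a2 ?b0 ?b1 ?b2 ?c0 ?c1 ?c2
    ?eqxx ?(eq_sym k1 k0) ?(eq_sym k2 k0) ?(eq_sym k2 k1)
    ?(negbTE n01) ?(negbTE n02) ?(negbTE n12) ?subr0 ?subrr//.
Qed.

Definition in_plane K x := (x - (vert K)`_0 <= edgemx 2 (vert K))%MS.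

Lemma in_planeP K x : in_plane K x <-> exists z, x = par (vert K) z.
Proof.
split=> [/submxP[y xE]|[[s t] ->]].
  exists (y 0 0, y 0 1); rewrite par_edgemx -xE addrC subrK //.
by rewrite /in_plane par_row2 addrC addKr submxMl.
Qed.

Lemma in_plane_decomp K x : K \in facets M -> in_plane K x ->
  x = \sum_(a in K) bary K a x *: pos a.
Proof.
move=> KM /in_planeP[[s t] ->].
have [k0 [k1 [k2 [n01 n02 n12 KE oK]]]] := facet_ord rM KM.
have [e0 e1 e2] := bary_par s t KM oK n01 n02 n12.
rewrite [in RHS]KE big_set3// -KE e0 e1 e2 (vertE oK) /par/=.
by apply/rowP => j; rewrite !mxE; ring.
Qed.

Lemma in_plane_comb K (c : node M -> R) : K \in facets M ->
  \sum_(a in K) c a = 1 -> in_plane K (\sum_(a in K) c a *: pos a).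
Proof.
move=> KM; have [k0 [k1 [k2 [n01 n02 n12 KE oK]]]] := facet_ord rM KM.
rewrite {1 3}KE !big_set3// => c1; apply/in_planeP; exists (c k1, c k2).
rewrite (vertE oK) /par/=.
have -> : c k0 = 1 - c k1 - c k2 by rewrite -c1; ring.
by apply/rowP => j; rewrite !mxE; ring.
Qed.

Lemma bary_comb K (S : {set node M}) (c : node M -> R) a : K \in facets M ->
  S \subset K -> a \in K -> \sum_(b in S) c b = 1 ->
  bary K a (\sum_(b in S) c b *: pos b) = if a \in S then c a else 0.
Proof.
move=> KM /subsetP SK aK c1; rewrite (affine_comb _ (affine_bary K a) c1).
rewrite (eq_bigr (fun b => if a == b then c b else 0)); last first.
  move=> b bS; rewrite (bary_pos KM aK (SK _ bS)).
  by case: (a == b); rewrite ?mulr1 ?mulr0.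
rewrite -big_mkcondr/=; case: ifPn => aS.
  by rewrite (big_pred1 a)// => b; rewrite /= (eq_sym a); case: eqVneq => [->|_]; rewrite ?aS ?andbF.
by rewrite big_pred0// => b; case: eqVneq => [<-|_]; rewrite ?(negbTE aS) ?andbF.
Qed.

Lemma simplexP K (S : {set node M}) x : K \in facets M -> S \subset K ->
  simplex S x <-> [/\ in_plane K x, (forall a, a \in K -> 0 <= bary K a x) &
    forall a, a \in K -> a \notin S -> bary K a x = 0].
Proof.
move=> KM SK; split=> [[c [c0 c1 ->]]|[xK x0 xS]].
  have bE a : a \in K -> bary K a (\sum_(a in S) c a *: pos a) = if a \in S then c a else 0.
    by move=> aK; exact: bary_comb.
  split.
  - rewrite (_ : \sum_(a in S) _ = \sum_(a in K) (if a \in S then c a else 0) *: pos a).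
      apply: in_plane_comb => //; rewrite -big_mkcondr/= -c1; apply: eq_bigl => a.
      by apply: andb_idl; exact/subsetP.
    rewrite [in RHS](eq_bigr (fun a => if a \in S then c a *: pos a else 0)).
      rewrite -big_mkcondr/=; apply: eq_bigl => a; apply/esym/andb_idl; exact/subsetP.
    by move=> a _; case: ifP; rewrite ?scale0r.
  - by move=> a aK; rewrite bE//; case: ifP => // aS; exact: c0.
  - by move=> a aK aS; rewrite bE// (negbTE aS).
exists (fun a => bary K a x); split.
- by move=> a aS; apply/x0/(subsetP SK).
- rewrite -(sum_bary rM x KM) [in RHS](big_setID S)/= (setIidPr SK).
  by rewrite [X in _ + X]big1 ?addr0// => a; rewrite !inE => /andP[aS aK]; rewrite xS.
- rewrite {1}(in_plane_decomp KM xK) (big_setID S)/= (setIidPr SK).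
  by rewrite [X in _ + X]big1 ?addr0// => a; rewrite !inE => /andP[aS aK]; rewrite xS ?scale0r.
Qed.

Lemma facetP K x : K \in facets M ->
  simplex K x <-> in_plane K x /\ forall a, a \in K -> 0 <= bary K a x.
Proof.
move=> KM; rewrite (simplexP x KM (subxx K)); split=> [[? ? _]//|[? ?]].
by split=> // a ->.
Qed.

Lemma open_simplexP K x : K \in facets M ->
  open_simplex K x <-> in_plane K x /\ forall a, a \in K -> 0 < bary K a x.
Proof.
move=> KM; split=> [[c [c0 c1 ->]]|[xK x0]].
  split; first exact: in_plane_comb.
  by move=> a aK; rewrite bary_comb// aK c0.
by exists (fun a => bary K a x); rewrite (sum_bary rM)// -in_plane_decomp.
Qed.

(** A point of both facets is in their common face, and it has the same
    coordinates there. *)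
Lemma bary_agree K L a x : K \in facets M -> L \in facets M ->
  simplex K x -> simplex L x -> a \in K ->
  bary K a x = if a \in L then bary L a x else 0.
Proof.
move=> KM LM xK xL aK.
have [c [_ c1 ->]] := reg_inter rM KM LM (conj xK xL).
rewrite bary_comb ?subsetIl// in_setI aK/=; case: ifP => // aL.
by rewrite bary_comb ?subsetIr// in_setI aK aL.
Qed.

(** The closed facet, cut out by finitely many affine inequalities. *)
Definition facet_ineqs K : seq ('rV[R]_N -> R) :=
  [seq bary K a | a <- ord K] ++
  [seq (fun x => ((x - (vert K)`_0) *m cokermx (edgemx 2 (vert K))) 0 j) | j <- enum 'I_N] ++
  [seq (fun x => - ((x - (vert K)`_0) *m cokermx (edgemx 2 (vert K))) 0 j) | j <- enum 'I_N].

Lemma facet_ineqs_affine K f : List.In f (facet_ineqs K) -> affine_fun f.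
Proof.
have cok j : affine_fun (fun x => ((x - (vert K)`_0) *m cokermx (edgemx 2 (vert K))) 0 j).
  move=> k x y; rewrite !mulmxBl !mulmxDl mul0mx -scalemxAl !mxE; ring.
rewrite /facet_ineqs => h; case: (List.in_app_or _ _ _ h) => {}h;
  last case: (List.in_app_or _ _ _ h) => {}h; apply: (affine_In h) => i //.
- exact: affine_bary.
- exact: affine_opp.
Qed.

Lemma facet_ineqsP K x : K \in facets M ->
  simplex K x <-> all (fun f : 'rV[R]_N -> R => 0 <= f x) (facet_ineqs K).
Proof.
move=> KM; rewrite facetP// /facet_ineqs !all_cat !all_map.
have pK a : (a \in ord K) = (a \in K).
  by rewrite (perm_mem (reg_ord rM (facet_cell rM KM))) mem_enum.
rewrite /in_plane submxE; split.
  move=> [/eqP h b0]; apply/and3P; split; apply/allP => j /=.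
  - by rewrite pK; exact: b0.
  - by rewrite h mxE.
  - by rewrite h mxE oppr0.
move=> /and3P[/allP b0 /allP h1 /allP h2]; split; last by move=> a; rewrite -pK => /b0.
apply/eqP/rowP => j; rewrite [RHS]mxE; apply/eqP; rewrite eq_le -oppr_ge0.
by rewrite [X in X && _]h2 ?mem_enum// [X in true && X]h1 ?mem_enum.
Qed.

Definition chi K x : R := (all (fun f : 'rV[R]_N -> R => 0 <= f x) (facet_ineqs K))%:R.

Lemma chiE K : K \in facets M -> \1_(simplex K) = chi K.
Proof.
move=> KM; apply/funext => x; rewrite /chi indicE; congr (_%:R).
congr nat_of_bool; apply/idP/idP.
  by move=> /set_mem /(facet_ineqsP x KM).
by move=> h; apply/mem_set/(facet_ineqsP x KM).
Qed.

Lemma tame_chi K : tame (chi K).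
Proof. by apply: tame_all => f; exact: facet_ineqs_affine. Qed.

End Barycentric.

(** * Two-forms on a plane *)

Section Swap.
Variables (R : realType) (N : nat).
Local Notation V := 'rV[R]_N.

(** The linear part of an affine function. *)
Definition dlin (f : V -> R) (v : V) : R := f v - f 0.

Definition wedge2 (f g : V -> R) (E : 'M[R]_(2, N)) : R :=
  dlin f (row 0 E) * dlin g (row 1 E) - dlin f (row 1 E) * dlin g (row 0 E).

Lemma dlin_comb (f : V -> R) (s t : R) (u v : V) : affine_fun f ->
  dlin f (s *: u + t *: v) = s * dlin f u + t * dlin f v.
Proof.
move=> af; rewrite /dlin (affineE af); have := affineE af t v 0.
rewrite addr0 => ->; ring.
Qed.

Lemma dlin_sub (f : V -> R) (u v : V) : affine_fun f -> dlin f (u - v) = f u - f v.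
Proof. by move=> af; rewrite /dlin affine_sub. Qed.

Lemma row_mul2 (A : 'M[R]_2) (E : 'M[R]_(2, N)) i :
  row i (A *m E) = A i 0 *: row 0 E + A i 1 *: row 1 E.
Proof.
rewrite row_mul mulmx_sum_row !big_ord_recl big_ord0 addr0 !mxE.
by have -> : lift ord0 ord0 = 1 :> 'I_2 by exact: val_inj.
Qed.

Lemma det2 (A : 'M[R]_2) : \det A = A 0 0 * A 1 1 - A 0 1 * A 1 0.
Proof.
rewrite (expand_det_row _ ord0) !big_ord_recl big_ord0 addr0 /cofactor.
rewrite !det_mx11 !mxE /= expr0 expr1 mul1r mulN1r mulrN.
by congr (_ * A _ _ - A _ _ * A _ _); exact: val_inj.
Qed.

(** Alternating two-forms scale with the determinant. *)
Definition two_form (eta : 'M[R]_(2, N) -> R) : Prop :=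
  forall A E, eta (A *m E) = \det A * eta E.

Lemma two_form_wedge2 (f g : V -> R) : affine_fun f -> affine_fun g ->
  two_form (wedge2 f g).
Proof.
move=> af ag A E; rewrite /wedge2 !row_mul2 !dlin_comb// det2; ring.
Qed.

Lemma in_plane_vert (M : mesh R N) (K : {set node M}) a : regular M ->
  K \in facets M -> a \in K -> in_plane K (pos a).
Proof.
move=> rM KM aK; have -> : pos a = \sum_(b in K) (b == a)%:R *: pos b.
  rewrite (bigD1 a)//= eqxx scale1r big1 ?addr0// => b /andP[_ /negbTE ->].
  by rewrite scale0r.
apply: in_plane_comb => //; rewrite (bigD1 a)//= eqxx big1 ?addr0// => b.
by move=> /andP[_ /negbTE ->].
Qed.

Section Pair.
Variables (A B : mesh R N).
Hypotheses (rA : regular A) (rB : regular B).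
Variables (K : {set node A}) (L : {set node B}).
Hypotheses (KA : K \in facets A) (LB : L \in facets B).

Definition coplanar : Prop := forall i, (i < 3)%N -> in_plane L ((vert K)`_i).

Lemma coplanar_coords : coplanar -> exists (C : 'M[R]_2) (b : 'rV[R]_2),
  [/\ \det C != 0, edgemx 2 (vert K) = C *m edgemx 2 (vert L) &
      (vert K)`_0 = (vert L)`_0 + b *m edgemx 2 (vert L)].
Proof.
move=> cop; have /submxP[b bE] := cop 0%N isT.
have /submxP[C CE] : (edgemx 2 (vert K) <= edgemx 2 (vert L))%MS.
  apply/row_subP => i; rewrite edgemxE.
  have -> : (vert K)`_i.+1 - (vert K)`_0 =
     ((vert K)`_i.+1 - (vert L)`_0) - ((vert K)`_0 - (vert L)`_0).
    by rewrite opprB addrA subrK.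
  apply: addmx_sub; first by apply: cop; rewrite !ltnS; case: i.
  by rewrite eqmx_opp; exact: (cop 0%N).
exists C, b; split => //; last by rewrite -bE addrC subrK.
rewrite -unitfE -[_ \is a GRing.unit]/(C \in unitmx) -row_free_unit.
have := reg_free rA KA; rewrite CE /row_free => /eqP rk.
by rewrite eqn_leq rank_leq_row -{1}rk mxrankM_maxl.
Qed.

Lemma par_corner (z : measurableTypeR R * measurableTypeR R) :
  simplex K (par (vert K) z) <-> corner z.
Proof.
rewrite (facetP rA _ KA); case: z => s t.
have [k0 [k1 [k2 [n01 n02 n12 KE oK]]]] := facet_ord rA KA.
have [e0 e1 e2] := bary_par rA s t KA oK n01 n02 n12.
split=> [[_ h]|[/= s0 t0 st]].
  have h0 : 0 <= 1 - s - t by rewrite -e0 h// KE mem3 eqxx.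
  have h1 : 0 <= s by rewrite -e1 h// KE mem3 eqxx orbT.
  have h2 : 0 <= t by rewrite -e2 h// KE mem3 eqxx !orbT.
  split=> //=; lra.
split; first by apply/in_planeP; exists (s, t).
move=> a; rewrite {1}KE mem3 => /or3P[]/eqP-> //; rewrite ?e0 ?e1 ?e2 //.
by move: st => /= st; lra.
Qed.

(** The plane of L cuts K in the zero set of an affine function that is not
    constant on K. *)
Lemma null_not_coplanar (phi : V -> R) : ~ coplanar -> tame phi ->
  tint (vert K) (fun x => chi L x * phi x) = 0.
Proof.
move=> ncop tphi.
pose f j (x : V) := ((x - (vert L)`_0) *m cokermx (edgemx 2 (vert L))) 0 j.
have fL x j : simplex L x -> f j x = 0.
  move=> /(facetP rB x LB)[]; rewrite /in_plane submxE => /eqP h _.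
  by rewrite /f h mxE.
have af j : affine_fun (f j).
  move=> k x y; rewrite /f !mulmxBl !mulmxDl mul0mx -scalemxAl !mxE; ring.
have chi0 x : chi L x * phi x != 0 -> simplex L x.
  move=> h; apply/(facet_ineqsP rB x LB); move: h; rewrite /chi.
  by case: (all _ _) => //; rewrite mul0r eqxx.
have tt : tame (fun x => chi L x * phi x) by apply: tame_mul => //; exact: tame_chi.
have [[j fj]|nf] := pselect (exists j,
    (f j (vert K)`_1, f j (vert K)`_2) != (f j (vert K)`_0, f j (vert K)`_0)).
  apply: (@tint_null _ _ _ _ [:: f j]) => // [g [<-|//]|z _ /chi0 zL].
    by split.
  by exists (f j); [left|exact: fL].
have fc j z : f j (par (vert K) z) = f j (vert K)`_0.
  rewrite affine_par_mx//.
  have /eqP : (f j (vert K)`_1, f j (vert K)`_2) = (f j (vert K)`_0, f j (vert K)`_0).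
    by apply/eqP/negPn/negP => h; apply: nf; exists j.
  by rewrite xpair_eqE => /andP[/eqP -> /eqP ->]; ring.
apply: (@tint_null _ _ _ _ [::]) => // z _ /chi0 zL; exfalso; apply: ncop => i i3.
rewrite /in_plane submxE; apply/eqP/rowP => j; rewrite [RHS]mxE -[LHS]/(f j _).
have f0 : f j (vert K)`_0 = 0 by rewrite -(fc j z) fL.
have fpar : exists z', (vert K)`_i = par (vert K) z'.
  case: i i3 => [|[|[|]]]// _.
  - by exists (0, 0); rewrite /par/= !scale0r !addr0.
  - by exists (1, 0); rewrite /par/= scale0r scale1r addr0 addrC subrK.
  - by exists (0, 1); rewrite /par/= scale0r scale1r addr0 addrC subrK.
by have [z' ->] := fpar; rewrite fc f0.
Qed.

End Pair.

Lemma coplanar_sym (A B : mesh R N) (rA : regular A) (K : {set node A})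
  (L : {set node B}) : K \in facets A -> coplanar K L -> coplanar L K.
Proof.
move=> KA cop; have [C [b [detC EK vK]]] := coplanar_coords rA KA cop.
have uC : C \in unitmx by rewrite unitmxE unitfE.
have EL : edgemx 2 (vert L) = invmx C *m edgemx 2 (vert K).
  by rewrite EK mulKmx.
have v0 : (vert L)`_0 - (vert K)`_0 = - b *m invmx C *m edgemx 2 (vert K).
  by rewrite vK opprD addrA subrr add0r -mulmxA -EL mulNmx.
move=> i i3; rewrite /in_plane.
have -> : (vert L)`_i - (vert K)`_0 = ((vert L)`_i - (vert L)`_0) + ((vert L)`_0 - (vert K)`_0).
  by rewrite addrA subrK.
apply: addmx_sub; last by rewrite v0 submxMl.
case: i i3 => [|i i3]; first by rewrite subrr sub0mx.
rewrite -(edgemxE (vert L) (Ordinal (i3 : (i < 2)%N))) EL row_mul.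
exact: submxMl.
Qed.

End Swap.

(** * Exchanging the two meshes in an integral *)

Section SwapTerm.
Variables (R : realType) (N : nat).
Local Notation V := 'rV[R]_N.

Lemma dbary_edge (A : mesh R N) (rA : regular A) (K : {set node A}) (y : 'rV[R]_2)
   (j : 'I_2) : K \in facets A ->
  [seq dbary K a (y *m edgemx 2 (vert K)) | a <- ord K]`_j.+1 = y 0 j.
Proof.
move=> KA; have [k0 [k1 [k2 [n01 n02 n12 KE oK]]]] := facet_ord rA KA.
have [_ e1 e2] := bary_par rA (y 0 0) (y 0 1) KA oK n01 n02 n12.
have [_ f1 f2] := bary_par rA 0 0 KA oK n01 n02 n12.
have d a : dbary K a (y *m edgemx 2 (vert K)) =
    bary K a (par (vert K) (y 0 0, y 0 1)) - bary K a (par (vert K) (0, 0)).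
  have -> : par (vert K) (0, 0) = (vert K)`_0 by rewrite /par/= !scale0r !addr0.
  rewrite par_edgemx /dbary.
  have := affine_sub (affine_bary K a) ((vert K)`_0 + y *m edgemx 2 (vert K)) (vert K)`_0.
  by rewrite addrAC subrr add0r.
rewrite oK; case: j => -[|[|]]//= i; rewrite d ?e1 ?e2 ?f1 ?f2 subr0;
  by congr (y 0 _); exact: val_inj.
Qed.

Lemma orient_edgemx (A : mesh R N) (rA : regular A) (K : {set node A}) (C : 'M[R]_2) :
  K \in facets A -> orient K (C *m edgemx 2 (vert K)) = orn K * Num.sg (\det C).
Proof.
move=> KA; rewrite /orient; congr (_ * Num.sg (\det _)); apply/matrixP => i j.
by rewrite mxE row_mul dbary_edge// mxE.
Qed.

Lemma chi_neq0 (A : mesh R N) (rA : regular A) (K : {set node A}) x (r : R) :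
  K \in facets A -> chi K x * r != 0 -> simplex K x.
Proof.
move=> KA h; apply/(facet_ineqsP rA x KA); move: h; rewrite /chi.
by case: (all _ _) => //; rewrite mul0r eqxx.
Qed.

Lemma chi_par (A : mesh R N) (rA : regular A) (K : {set node A}) z :
  K \in facets A -> chi K (par (vert K) z) = (z \in @corner R)%:R.
Proof.
move=> KA; rewrite -chiE// indicE; congr (_%:R); congr nat_of_bool.
by apply/idP/idP => /set_mem h; apply/mem_set/(par_corner rA KA).
Qed.

Lemma tame_two_form (eta : V -> 'M[R]_(2, N) -> R) (B : mesh R N) (L : {set node B}) E :
  (forall E, tame (fun x => eta x E)) -> tame (fun x => chi L x * eta x E).
Proof. by move=> te; apply: tame_mul; [exact: tame_chi|exact: te]. Qed.

(** A point of both facets is on an edge line of one of them, as it would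
    be interior to both otherwise; these lines are null sets. *)
Lemma null_disjoint (A B : mesh R N) (rA : regular A) (rB : regular B)
  (K : {set node A}) (L : {set node B}) (phi : V -> R) :
  K \in facets A -> L \in facets B -> coplanar K L -> tame phi ->
  ~ (open_simplex K `&` open_simplex L !=set0)%classic ->
  tint (vert K) (fun x => chi L x * phi x) = 0.
Proof.
move=> KA LB cop tphi nop.
have tt : tame (fun x => chi L x * phi x) by apply: tame_mul => //; exact: tame_chi.
have ndeg a : a \in L -> (bary L a (vert K)`_1, bary L a (vert K)`_2) !=
    (bary L a (vert K)`_0, bary L a (vert K)`_0).
  move=> aL; apply/negP; rewrite xpair_eqE => /andP[/eqP h1 /eqP h2].
  have cst z : bary L a (par (vert K) z) = bary L a (vert K)`_0.
    rewrite affine_par_mx ?h1 ?h2; last exact: affine_bary.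
    ring.
  have inK b : b \in L -> bary L a (pos b) = bary L a (vert K)`_0.
    move=> bL; suff /in_planeP[z ->] : in_plane K (pos b) by exact: cst.
    have copL := coplanar_sym rA KA cop.
    have [y yE] := submxP (in_plane_vert rB LB bL).
    have [C [d [_ EL vL]]] := coplanar_coords rB LB copL.
    rewrite /in_plane (_ : _ - _ = (y *m C + d) *m edgemx 2 (vert K)) ?submxMl//.
    by rewrite mulmxDl -mulmxA -EL -yE vL opprD addrA subrK.
  have [b [bL ba]] : exists b, b \in L /\ b != a.
    have [b [c [ab _ _ LE]]] := card3_from (reg_card rB LB) aL.
    by exists b; rewrite LE mem3 eqxx orbT eq_sym.
  have := inK a aL; rewrite -(inK b bL) !(bary_pos rB)// eqxx eq_sym (negbTE ba).
  by move/eqP; rewrite oner_eq0.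
have ndegK a : a \in K -> (bary K a (vert K)`_1, bary K a (vert K)`_2) !=
    (bary K a (vert K)`_0, bary K a (vert K)`_0).
  have [k0 [k1 [k2 [n01 n02 n12 KE oK]]]] := facet_ord rA KA.
  have k0K : k0 \in K by rewrite KE mem3 eqxx.
  have k1K : k1 \in K by rewrite KE mem3 eqxx orbT.
  have k2K : k2 \in K by rewrite KE mem3 eqxx !orbT.
  move=> aK; rewrite (vertE oK)/= !(bary_pos rA)// xpair_eqE.
  move: aK; rewrite {1}KE mem3 => /or3P[]/eqP->; rewrite !eqxx ?(eq_sym k1 k0)
    ?(eq_sym k2 k0) ?(eq_sym k2 k1) ?(negbTE n01) ?(negbTE n02) ?(negbTE n12)
    ?oner_eq0 ?(eq_sym 0%R) ?oner_eq0 ?andbF//.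
apply: (@tint_null _ _ _ _ ([seq bary K a | a <- enum K] ++ [seq bary L a | a <- enum L])) => //.
  move=> f h.
  have : (exists2 a, a \in K & f = bary K a) \/ (exists2 a, a \in L & f = bary L a).
    case: (List.in_app_or _ _ _ h) => {}h; [left|right].
      have : all (mem K) (enum K) by apply/allP => a; rewrite mem_enum.
      by elim: (enum K) h => //= a s IH [<-|/IH h] /andP[aK sK]; [exists a|exact: h].
    have : all (mem L) (enum L) by apply/allP => a; rewrite mem_enum.
    by elim: (enum L) h => //= a s IH [<-|/IH h] /andP[aK sK]; [exists a|exact: h].
  move=> [[a aK ->]|[a aL ->]]; split; [exact: affine_bary|exact: ndegK|exact: affine_bary|exact: ndeg].
move=> z zc /(chi_neq0 rB LB) zL.
have zK : simplex K (par (vert K) z) by exact/(par_corner rA KA).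
have mem_map_In (C : mesh R N) (M : {set node C}) a : a \in M ->
    List.In (bary M a) [seq bary M a | a <- enum M].
  rewrite -mem_enum; elim: (enum M) => //= b s IH; rewrite inE => /predU1P[->|/IH]; by [left|right].
apply: contrapT => no; apply: nop; exists (par (vert K) z); split.
  apply/open_simplexP => //; have [h1 h2] := (facetP rA _ KA).1 zK; split=> // a aK.
  rewrite lt_def h2// andbT; apply/eqP => a0; apply: no; exists (bary K a) => //.
  by apply: List.in_or_app; left; exact: mem_map_In.
apply/open_simplexP => //; have [h1 h2] := (facetP rB _ LB).1 zL; split=> // a aL.
rewrite lt_def h2// andbT; apply/eqP => a0; apply: no; exists (bary L a) => //.
by apply: List.in_or_app; right; exact: mem_map_In.
Qed.

(** For coplanar facets this is an affine change of variables: the sign of its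
    determinant is that by which the two orientations differ.  Otherwise the
    facets meet in a null set. *)
Lemma swap_term (A B : mesh R N) (rA : regular A) (rB : regular B)
  (K : {set node A}) (L : {set node B}) (eta : V -> 'M[R]_(2, N) -> R) :
  K \in facets A -> L \in facets B ->
  ((open_simplex K `&` open_simplex L !=set0)%classic ->
     orient K (edgemx 2 (vert L)) = orn L) ->
  (forall x, two_form (eta x)) -> (forall E, tame (fun x => eta x E)) ->
  orn K * tint (vert K) (fun x => chi L x * eta x (edgemx 2 (vert K))) =
  orn L * tint (vert L) (fun x => chi K x * eta x (edgemx 2 (vert L))).
Proof.
move=> KA LB comp teta tt.
have [cop|ncop] := pselect (coplanar K L); last first.
  rewrite null_not_coplanar// null_not_coplanar ?mulr0// => /(coplanar_sym rB LB).
  exact: ncop.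
have copL := coplanar_sym rA KA cop.
have [op|nop] := pselect (open_simplex K `&` open_simplex L !=set0)%classic; last first.
  rewrite null_disjoint// null_disjoint ?mulr0//.
  by move=> [x [xL xK]]; apply: nop; exists x.
have [C [b [detC EL vL]]] := coplanar_coords rB LB copL.
rewrite -(comp op) EL orient_edgemx// -EL.
have E z : par (vert L) z = par (vert K)
    (plane_affine (C 0 0) (C 1 0) (C 0 1) (C 1 1) (b 0 0) (b 0 1) z).
  case: z => s t; rewrite par_row2 vL EL mulmxA -addrA -mulmxDl -par_edgemx.
  congr (par _ (_, _)); rewrite !mxE !big_ord_recl big_ord0 addr0 !mxE /=;
  have -> : lift ord0 ord0 = 1 :> 'I_2 by exact: val_inj.
    by rewrite /= addrC (mulrC s) (mulrC t).
  by rewrite /= addrC (mulrC s) (mulrC t).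
have detE : C 0 0 * C 1 1 - C 1 0 * C 0 1 = \det C by rewrite det2 (mulrC (C 1 0)).
rewrite (tint_change (p := vert K) (q := vert L) (a := C 0 0) (b := C 1 0)
   (c := C 0 1) (d := C 1 1) (e := b 0 0) (f := b 0 1)
   (psi := fun x => chi L x * eta x (edgemx 2 (vert L)))); last 4 first.
- by rewrite detE.
- exact: tame_two_form.
- exact: tame_two_form.
- by move=> z; cbv zeta; rewrite -(chi_par rB z LB) -(chi_par rA _ KA) -E; ring.
have -> : tint (vert K) (fun x => chi L x * eta x (edgemx 2 (vert L))) =
    \det C * tint (vert K) (fun x => chi L x * eta x (edgemx 2 (vert K))).
  rewrite -tintZ; last exact: tame_two_form.
  by apply: eq_tint => x; rewrite EL teta; ring.
rewrite detE !mulrA; congr (_ * _); rewrite -!mulrA -[LHS]mulr1; congr (_ * _).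
have := detC; rewrite -normr_eq0 => nd.
by rewrite mulrCA -normrEsg mulVf.
Qed.

End SwapTerm.

(** * Changing the order of the nodes of a facet *)

Section Reorder.
Variables (R : realType) (N : nat).
Local Notation V := 'rV[R]_N.

Lemma in_corner (z : measurableTypeR R * measurableTypeR R) :
  (z \in @corner R) = [&& 0 <= z.1, 0 <= z.2 & z.1 + z.2 <= 1].
Proof.
apply/idP/idP => [/set_mem[? ? ?]|/and3P[? ? ?]]; first exact/and3P.
by apply/mem_set.
Qed.

Lemma tint_swap01 (p0 p1 p2 : V) phi : tame phi ->
  tint [:: p1; p0; p2] phi = tint [:: p0; p1; p2] phi.
Proof.
move=> tp.
rewrite (@tint_change _ _ [:: p0; p1; p2] _ (-1) (-1) 0 1 1 0 _ phi)//.
  by rewrite [X in `|X|](_ : _ = -1) ?normrN1 ?invr1 ?mul1r//; ring.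
move=> [s t] /=; congr (_%:R * phi _).
  congr nat_of_bool; rewrite !in_corner/=; apply/idP/idP => /and3P[? ? ?];
  apply/and3P; split; lra.
by apply/rowP => j; rewrite /par/= !mxE; ring.
Qed.

Lemma tint_swap12 (p0 p1 p2 : V) phi : tame phi ->
  tint [:: p0; p2; p1] phi = tint [:: p0; p1; p2] phi.
Proof.
move=> tp.
rewrite (@tint_change _ _ [:: p0; p1; p2] _ 0 1 1 0 0 0 _ phi)//.
  by rewrite [X in `|X|](_ : _ = -1) ?normrN1 ?invr1 ?mul1r//; ring.
move=> [s t] /=; congr (_%:R * phi _).
  congr nat_of_bool; rewrite !in_corner/=; apply/idP/idP => /and3P[? ? ?];
  apply/and3P; split; lra.
by apply/rowP => j; rewrite /par/= !mxE; ring.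
Qed.

Lemma two_form_rows (eta : 'M[R]_(2, N) -> R) (a b c d : R) (E F : 'M[R]_(2, N)) :
  two_form eta -> row 0 F = a *: row 0 E + b *: row 1 E ->
  row 1 F = c *: row 0 E + d *: row 1 E -> eta F = (a * d - b * c) * eta E.
Proof.
move=> te r0 r1.
pose C : 'M[R]_2 := \matrix_(i, j) if i == 0 then (if j == 0 then a else b)
                                   else (if j == 0 then c else d).
have -> : F = C *m E.
  apply/row_matrixP => i; rewrite row_mul2 !mxE/=.
  case: (eqVneq i 0) => [->//|i0].
  have -> : i = 1 by apply: val_inj; case: i i0 => -[|[|]].
  exact: r1.
by rewrite te det2 !mxE.
Qed.

Lemma row_edgemx0 (p : seq V) : row 0 (edgemx 2 p) = p`_1 - p`_0.
Proof. exact: edgemxE. Qed.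

Lemma row_edgemx1 (p : seq V) : row 1 (edgemx 2 p) = p`_2 - p`_0.
Proof. exact: edgemxE. Qed.

Lemma two_form_swap01 (eta : 'M[R]_(2, N) -> R) p0 p1 p2 : two_form eta ->
  eta (edgemx 2 [:: p1; p0; p2]) = - eta (edgemx 2 [:: p0; p1; p2]).
Proof.
move=> te; rewrite (@two_form_rows _ (-1) 0 (-1) 1 (edgemx 2 [:: p0; p1; p2]))//; first ring.
- by rewrite !row_edgemx0 !row_edgemx1 /=; apply/rowP => j; rewrite !mxE; ring.
- by rewrite !row_edgemx0 !row_edgemx1 /=; apply/rowP => j; rewrite !mxE; ring.
Qed.

Lemma two_form_swap12 (eta : 'M[R]_(2, N) -> R) p0 p1 p2 : two_form eta ->
  eta (edgemx 2 [:: p0; p2; p1]) = - eta (edgemx 2 [:: p0; p1; p2]).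
Proof.
move=> te; rewrite (@two_form_rows _ 0 1 1 0 (edgemx 2 [:: p0; p1; p2]))//; first ring.
- by rewrite !row_edgemx0 !row_edgemx1 /=; apply/rowP => j; rewrite !mxE; ring.
- by rewrite !row_edgemx0 !row_edgemx1 /=; apply/rowP => j; rewrite !mxE; ring.
Qed.

(** Exchanging two nodes changes the sign of the two-form on the edge vectors,
    but not the integral of a function. *)
Lemma tint_reorder (M : mesh R N) (rM : regular M) (x y z : node M)
    (eta : V -> 'M[R]_(2, N) -> R) :
  x != y -> x != z -> y != z -> [set x; y; z] \in facets M ->
  (forall u, two_form (eta u)) -> (forall E, tame (fun u => eta u E)) ->
  tint (vert [set x; y; z]) (fun u => eta u (edgemx 2 (vert [set x; y; z]))) =
  sgn3 x y z * tint [:: pos x; pos y; pos z]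
                 (fun u => eta u (edgemx 2 [:: pos x; pos y; pos z])).
Proof.
move=> xy xz yz KM te tt.
pose F (x y z : node M) := tint [:: pos x; pos y; pos z]
                 (fun u => eta u (edgemx 2 [:: pos x; pos y; pos z])).
have F1 u v w : F v u w = - F u v w.
  rewrite /F tint_swap01// -tintN//; apply: eq_tint => s.
  by rewrite two_form_swap01.
have F2 u v w : F u w v = - F u v w.
  rewrite /F tint_swap12// -tintN//; apply: eq_tint => s.
  by rewrite two_form_swap12.
have [s0 [s1 [s2 [oE <- _]]]] := alternating3 x F1 F2 xy xz yz (ord_facet rM xy xz yz KM).
by rewrite (vertE oE).
Qed.

End Reorder.

Section FiniteExceptions.
Variable R : realType.
Local Notation lam := (@lebesgue_measure R).
Local Notation R1 := (measurableTypeR R).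

Lemma Rintegral_except (X : seq R) (D : set R1) (f g : R1 -> R) : measurable D ->
  measurable_fun [set: R1] g ->
  (forall x, D x -> x \notin X -> f x = g x) ->
  \int[lam]_(x in D) f x = \int[lam]_(x in D) g x.
Proof.
move=> mD; elim: X g => [|x0 X IH] g mg fg.
  by apply: eq_Rintegral => x /set_mem Dx; exact: fg.
pose g' x := if x == x0 then f x0 else g x.
have mg' : measurable_fun [set: R1] g'.
  apply: measurable_fun_ifT => //.
  apply: (measurable_fun_bool true); rewrite classical_sets.setTI.
  have -> : ((fun x : R1 => x == x0) @^-1` [set true] = [set x0])%classic; last exact: measurable_set1.
  by apply/seteqP; split=> x /=; [move=> /eqP|move=> ->; rewrite eqxx].
rewrite (IH g' mg'); last first.
  move=> x Dx xX; rewrite /g'; case: eqVneq => [->//|xx0].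
  by rewrite fg// inE negb_or xx0.
rewrite /Rintegral; congr fine; apply: ae_eq_integral => //.
- exact/measurable_EFinP/measurable_funTS.
- exact/measurable_EFinP/measurable_funTS.
exists [set x0]%classic; split.
- exact: measurable_set1.
- exact: lebesgue_measure_set1.
move=> x /= /not_implyP[Dx]; rewrite /g'; case: eqVneq => [->//|_ []]; by [].
Qed.

End FiniteExceptions.

(** * Stokes' theorem on one facet *)

Section Hat.
Variables (R : realType) (N : nat) (M : mesh R N).
Hypothesis rM : regular M.
Local Notation V := 'rV[R]_N.
Implicit Types (a v : node M) (K L : {set node M}) (x : V).

(** Extended by zero to the facets without the node a. *)
Definition hat a K x : R := if (K \in facets M) && (a \in K) then bary K a x else 0.

Lemma affine_hat a K : affine_fun (hat a K).
Proof.
case h : ((K \in facets M) && (a \in K)).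
  by rewrite (_ : hat a K = bary K a) ?h; [exact: affine_bary|apply/funext => x; rewrite /hat h].
by rewrite (_ : hat a K = fun=> 0); [exact: affine_cst|apply/funext => x; rewrite /hat h].
Qed.

Lemma hat_agree K L a x : K \in facets M -> L \in facets M ->
  simplex K x -> simplex L x -> hat a K x = hat a L x.
Proof.
move=> KM LM xK xL; rewrite /hat KM LM /=; case: ifPn => aK.
  by rewrite (bary_agree rM KM LM).
by case: ifPn => // aL; rewrite (bary_agree rM LM KM xL xK)// (negbTE aK).
Qed.

Lemma hat_ge0 K a x : K \in facets M -> simplex K x -> 0 <= hat a K x.
Proof.
move=> KM /(facetP rM x KM)[_ h]; rewrite /hat KM; case: ifP => // aK; exact: h.
Qed.

(** The maximum selects the value on a facet that contains x, because the
    function is nonnegative there. *)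
Definition ghat v x : R := \big[Num.max/0]_(L in facets M) (chi L x * hat v L x).

Lemma ghatE L v x : L \in facets M -> simplex L x -> ghat v x = hat v L x.
Proof.
move=> LM xL; have chiL : chi L x = 1 by rewrite /chi (facet_ineqsP rM x LM).1.
apply/eqP; rewrite eq_le; apply/andP; split; last first.
  rewrite /ghat (bigD1 L)//= chiL mul1r le_max lexx //.
rewrite /ghat; elim/big_ind: _ => [|x1 x2 h1 h2|K KM].
- exact: hat_ge0.
- by rewrite ge_max h1.
- have [xK|xK] := boolP (all (fun f : V -> R => 0 <= f x) (facet_ineqs K)).
    rewrite /chi xK mul1r; rewrite (hat_agree v KM LM)//.
    by apply/(facet_ineqsP rM x KM).
  by rewrite /chi (negbTE xK) mul0r hat_ge0.
Qed.

Lemma tame_ghat v : tame (ghat v).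
Proof.
rewrite /ghat; elim: (index_enum _) => [|L s IH].
  rewrite (_ : (fun x => _) = fun=> 0); first exact: tame_cst.
  by apply/funext => x; rewrite big_nil.
have [LM|LM] := boolP (L \in facets M).
  rewrite (_ : (fun x => _) = (fun x => Num.max (chi L x * hat v L x)
      (\big[Num.max/0]_(L <- s | L \in facets M) (chi L x * hat v L x)))).
    apply: tame_max => //; apply: tame_mul; first exact: tame_chi.
    by apply/tame_affine; exact: affine_hat.
  by apply/funext => x; rewrite big_cons LM.
by move: IH; congr tame; apply/funext => x; rewrite big_cons (negbTE LM).
Qed.

End Hat.

Section Core.
Variables (R : realType) (N : nat) (A B : mesh R N).
Hypotheses (rA : regular A) (rB : regular B).
Hypothesis sAB : (surface A `<=` surface B)%classic.
Local Notation V := 'rV[R]_N.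
Local Notation lam := (@lebesgue_measure R).

(** The form d(l_p l_v) /\ d l_a, with l_p and l_a on [A] and l_v on [B]. *)
Definition core_form (p a : node A) (v : node B) K L (x : V) (E : 'M[R]_(2, N)) : R :=
  hat v L x * wedge2 (hat p K) (hat a K) E + hat p K x * wedge2 (hat v L) (hat a K) E.

Lemma two_form_core p a v K L x : two_form (core_form p a v K L x).
Proof.
move=> C E; rewrite /core_form !two_form_wedge2; try exact: affine_hat.
ring.
Qed.

Lemma tame_core p a v K L E : tame (fun x => core_form p a v K L x E).
Proof.
apply: tame_add; apply: tame_mul; try exact: tame_cst;
  apply: tame_affine; exact: affine_hat.
Qed.

(** The integral of l_p l_v along the edge ab, in the parameter l_a. *)
Definition edge_int (p a b : node A) (v : node B) : R :=
  \int[lam]_(x in `[0%R, 1%R]%classic)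
    (((p == b)%:R + x * ((p == a)%:R - (p == b)%:R)) *
     ghat v (pos b + x *: (pos a - pos b))).

Lemma measurable_edge (p a b : node A) (v : node B) :
  measurable_fun [set: measurableTypeR R] (fun x : R =>
    (((p == b)%:R + x * ((p == a)%:R - (p == b)%:R)) *
     ghat v (pos b + x *: (pos a - pos b)))).
Proof.
apply: measurable_funM.
  by apply: measurable_funD => //; exact: measurable_funM.
apply: (@measurable_tame R V _ (measurableTypeR R)
  (fun x : R => pos b + x *: (pos a - pos b)) _ _ (tame_ghat v)) => f af.
rewrite (_ : _ \o _ = fun x : R => f (pos b) + x * (f (pos a) - f (pos b))).
  by apply: measurable_funD => //; exact: measurable_funM.
by apply/funext => x /=; rewrite addrC (affineE af) affine_sub// addrC.
Qed.

Lemma edge_integrable (p a b : node A) (v : node B) :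
  lam.-integrable `[0%R, 1%R]%classic (EFin \o (fun x : R =>
    (((p == b)%:R + x * ((p == a)%:R - (p == b)%:R)) *
     ghat v (pos b + x *: (pos a - pos b))))).
Proof.
apply: itv_integrable; first exact: measurable_edge.
have [] := @bounded_tame R V R [set x | 0 <= x <= 1]%classic
  (fun x => pos b + x *: (pos a - pos b)) _ _ (tame_ghat v).
  move=> f af; exists (`|f (pos b)| + `|f (pos a) - f (pos b)|) => x /andP[x0 x1].
  rewrite addrC (affineE af) affine_sub// addrC (le_trans (ler_normD _ _))// lerD2l.
  by rewrite normrM ger0_norm// ler_piMl.
move=> C HC; exists ((`|(p == b)%:R| + `|(p == a)%:R - (p == b)%:R|) * C) => x x01.
rewrite normrM ler_pM//; last exact: HC.
case/andP: x01 => x0 x1; rewrite (le_trans (ler_normD _ _))// lerD2l.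
by rewrite normrM ger0_norm// ler_piMl.
Qed.

(** Two facets of [B] share at most one point with a level line of f that
    avoids the nodes of [B]: otherwise f would be constant on a common edge. *)
Lemma generic_slice (f k : V -> R) (L L' : {set node B}) (u u' : V) (x : R) :
  affine_fun f -> affine_fun k -> L \in facets B -> L' \in facets B ->
  simplex L u -> simplex L' u -> simplex L u' -> simplex L' u' ->
  f u = x -> f u' = x -> k u != k u' -> x \notin [seq f (pos w) | w <- enum (node B)] ->
  L = L'.
Proof.
move=> af ak LB L'B uL uL' u'L u'L' fu fu' ku xX; apply/eqP/negPn/negP => LL'.
have /subsetPn[w3 w3L w3L'] : ~~ (L \subset L').
  by apply: contra LL' => sub; rewrite eqEcard sub (reg_card rB LB) (reg_card rB L'B).
have [w1 [w2 [w31 w32 w12 LE]]] := card3_from (reg_card rB LB) w3L.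
have w1L : w1 \in L by rewrite LE mem3 eqxx orbT.
have w2L : w2 \in L by rewrite LE mem3 eqxx !orbT.
have dec (g : V -> R) y : affine_fun g -> simplex L y -> simplex L' y ->
    g y = g (pos w2) + bary L w1 y * (g (pos w1) - g (pos w2)).
  move=> ag yL yL'; have [yp _] := (facetP rB y LB).1 yL.
  have b3 : bary L w3 y = 0 by rewrite (bary_agree rB LB L'B)// (negbTE w3L').
  have s1 := sum_bary rB y LB.
  rewrite {1}(in_plane_decomp rB LB yp) (affine_comb _ ag s1).
  move: s1; rewrite {1 3}LE !big_set3// b3.
  by rewrite !add0r mul0r add0r => s1; rewrite -[bary L w2 y](addKr (bary L w1 y)) s1; ring.
have f12 : f (pos w1) = f (pos w2).
  have : bary L w1 u != bary L w1 u'.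
    by apply: contra ku => /eqP e; rewrite (dec k u)// (dec k u')// e.
  rewrite -subr_eq0 => h; apply/eqP; rewrite -subr_eq0.
  have : (bary L w1 u - bary L w1 u') * (f (pos w1) - f (pos w2)) = 0.
    by move: (dec f u af uL uL') (dec f u' af u'L u'L'); rewrite fu fu' => -> /eqP;
       rewrite -subr_eq0 opprD addrACA subrr add0r -mulrBl => /eqP.
  by move/eqP; rewrite mulf_eq0 (negbTE h).
move: xX; rewrite -fu (dec f u af uL uL') f12 subrr mulr0 addr0.
by rewrite map_f// mem_enum.
Qed.

(** On a level line of l_a the form is the derivative of l_p l_v, which is
    continuous and piecewise quadratic; the ends of the line are on the edges
    ab and ac. *)
Lemma core_facet p a b c v : a != b -> a != c -> b != c ->
  [set a; b; c] \in facets A ->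
  tint [:: pos b; pos a; pos c] (fun x => \sum_(L in facets B)
     chi L x * core_form p a v [set a; b; c] L x (edgemx 2 [:: pos b; pos a; pos c])) =
  edge_int p a b v - edge_int p a c v.
Proof.
move=> ab ac bc KA; set K := [set a; b; c]; set q := [:: _; _; _].
have aK : a \in K by rewrite mem3 eqxx.
have bK : b \in K by rewrite mem3 eqxx orbT.
have cK : c \in K by rewrite mem3 eqxx !orbT.
have ba : b != a by rewrite eq_sym.
have ca : c != a by rewrite eq_sym.
have cb : c != b by rewrite eq_sym.
have n := (eqxx, negbTE ab, negbTE ac, negbTE bc, negbTE ba, negbTE ca, negbTE cb).
have hatpos d e : d \in K -> hat e K (pos d) = (e == d)%:R.
  move=> dK; rewrite /hat KA /=; case: ifPn => eK; first exact: bary_pos.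
  by case: eqVneq => // ed; move: eK; rewrite ed dK.
have hat_q w x y (f := hat w K) : f (par q (x, y)) =
   (w == b)%:R + x * ((w == a)%:R - (w == b)%:R) + y * ((w == c)%:R - (w == b)%:R).
  by rewrite /f affine_par_mx ?hatpos//; exact: affine_hat.
have ww L : wedge2 (hat p K) (hat a K) (edgemx 2 q) = - ((p == c)%:R - (p == b)%:R) /\
    wedge2 (hat v L) (hat a K) (edgemx 2 q) = - (hat v L (pos c) - hat v L (pos b)).
  rewrite /wedge2 !row_edgemx0 !row_edgemx1 /= !dlin_sub ?hatpos//;
    try exact: affine_hat.
  by rewrite !eqxx (negbTE ab) (negbTE ac) /=; split; ring.
have tt : tame (fun x => \sum_(L in facets B) chi L x * core_form p a v K L x (edgemx 2 q)).
  by apply: tame_sum => L _; apply: tame_mul; [exact: tame_chi|exact: tame_core].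
have inK x y : 0 <= x -> 0 <= y -> x + y <= 1 -> simplex K (par q (x, y)).
  move=> x0 y0 xy; exists (fun w => (w == b)%:R + x * ((w == a)%:R - (w == b)%:R) +
     y * ((w == c)%:R - (w == b)%:R)); rewrite /K !big_set3//.
  rewrite !n /=; split.
  - by move=> w; rewrite mem3 => /or3P[]/eqP->; rewrite !n /=; lra.
  - ring.
  - by apply/rowP => j; rewrite /par /q /= !mxE; ring.
rewrite tint_iterated//.
pose h d (x : R) := (((p == d)%:R + x * ((p == a)%:R - (p == d)%:R)) *
     ghat v (pos d + x *: (pos a - pos d))).
rewrite (@Rintegral_except R [seq hat a K (pos w) | w <- enum (node B)] _ _
   (fun x => h b x - h c x))//; last 2 first.
- by apply: measurable_funB; exact: measurable_edge.
- move=> x; rewrite /= in_itv/= => /andP[x0 x1] xX.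
  pose C (L : {set node B}) := [seq (f (pos b) + x * (f (pos a) - f (pos b)), f (pos c) - f (pos b)) |
     f <- facet_ineqs L].
  have pieceE L y : piece C L y = all (fun f : V -> R => 0 <= f (par q (x, y))) (facet_ineqs L).
    rewrite /piece all_map; have : forall f, List.In f (facet_ineqs L) -> affine_fun f.
      exact: facet_ineqs_affine.
    elim: (facet_ineqs L) => //= f s IH af.
    rewrite IH; last by move=> f' fs; apply: af; right.
    by rewrite /aff1/= affine_par_mx//; apply: af; left.
  pose P (L : {set node B}) : R * R :=
    ((p == b)%:R + x * ((p == a)%:R - (p == b)%:R), (p == c)%:R - (p == b)%:R).
  pose Q (L : {set node B}) : R * R := (hat v L (pos b) + x * (hat v L (pos a) - hat v L (pos b)),
     hat v L (pos c) - hat v L (pos b)).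
  pose g y := aff1 (P set0) y * ghat v (par q (x, y)).
  have PE L y : aff1 (P L) y = hat p K (par q (x, y)) by rewrite hat_q.
  have QE L y : aff1 (Q L) y = hat v L (par q (x, y)).
    by rewrite affine_par_mx//; exact: affine_hat.
  have -> : h b x - h c x = - (g (1 - x) - g 0).
    rewrite opprB /g /h /aff1 /P /=; congr (_ * ghat v _ - _ * ghat v _).
    + by rewrite mul0r addr0.
    + by rewrite /par /q /= scale0r addr0.
    + ring.
    + by apply/rowP => j; rewrite /par /q /= !mxE; ring.
  (* the breakpoints are where the line crosses the edges of B *)
  rewrite -(piecewise_FTC (I := {set node B}) (P := mem (facets B)) (C := C) (p := P) (q := Q)); last 4 first.
  + lra.
  + move=> y /andP[y0 y1].
    have [L LB yL] : surface B (par q (x, y)) by apply: sAB; exists K => //; apply: inK => //; lra.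
    by exists L => //; rewrite pieceE; apply/(facet_ineqsP rB _ LB).
  + move=> L y LB y01; rewrite pieceE => /(facet_ineqsP rB _ LB) yL.
    by rewrite /g PE QE (ghatE rB v LB yL).
  + move=> L L' y z LB L'B y0 yz z1.
    rewrite !pieceE => /(facet_ineqsP rB _ LB) h1 /(facet_ineqsP rB _ LB) h2
      /(facet_ineqsP rB _ L'B) h3 /(facet_ineqsP rB _ L'B) h4.
    apply: (@generic_slice (hat a K) (hat c K) _ _ _ _ x _ _ LB L'B h1 h3 h2 h4) => //.
    * exact: affine_hat.
    * exact: affine_hat.
    * by rewrite hat_q !n /=; ring.
    * by rewrite hat_q !n /=; ring.
    * by rewrite !hat_q !n !subrr !mulr0 !add0r subr0 !mulr1 lt_eqF.
  have tpd : tame (fun y : R^o => \sum_(L in facets B)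
      (piece C L y)%:R * dprod (P L) (Q L) y).
    by apply: tame_sum => L _; apply: tame_mul; [exact: tame_piece|exact: tame_dprod].
  rewrite -[RHS]mulN1r -RintegralZl//; last exact: (tame1_integrable _ _ tpd).
  apply: eq_Rintegral => y _; rewrite mulr_sumr; apply: eq_bigr => L LB.
  rewrite /chi -pieceE /core_form -QE -(PE L) (ww L).1 (ww L).2 /dprod /=; ring.
by rewrite RintegralB//; exact: edge_integrable.
Qed.

End Core.

(** * Boundary edges of two meshes of one surface *)

Section Small.
Variable R : realType.

(** One-sided neighbourhoods of 0, in a form in which conditions for finitely
    many facets combine. *)
Definition small (P : R -> Prop) : Prop :=
  exists2 e0 : R, 0 < e0 & forall e, 0 < e -> e <= e0 -> P e.

Lemma small_and P Q : small P -> small Q -> small (fun e => P e /\ Q e).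
Proof.
move=> [e1 e10 H1] [e2 e20 H2]; exists (Num.min e1 e2); first by rewrite lt_min e10.
by move=> e e0; rewrite le_min => /andP[h1 h2]; split; [exact: H1|exact: H2].
Qed.

Lemma small_impl (P Q : R -> Prop) : (forall e, 0 < e -> P e -> Q e) -> small P -> small Q.
Proof. by move=> PQ [e0 e00 H]; exists e0 => // e h1 h2; apply: PQ => //; exact: H. Qed.

Lemma small_all (T : eqType) (s : seq T) (P : T -> R -> Prop) :
  (forall i, i \in s -> small (P i)) -> small (fun e => forall i, i \in s -> P i e).
Proof.
elim: s => [|i s IH] h; first by exists 1.
have h1 : small (P i) by apply: h; rewrite mem_head.
have h2 : small (fun e => forall i, i \in s -> P i e).
  by apply: IH => j js; apply: h; rewrite inE js orbT.
apply: small_impl (small_and h1 h2) => e _ [p1 p2] j; rewrite inE => /predU1P[->//|].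
exact: p2.
Qed.

Lemma small_ex P : small P -> exists2 e, 0 < e & P e.
Proof. by move=> [e0 e00 H]; exists e0 => //; exact: H. Qed.

Lemma small_lt (al be : R) : 0 < al -> small (fun e => 0 < al + e * be).
Proof.
move=> al0; exists (al / (`|be| + 1) / 2).
  by rewrite !divr_gt0// ltr_wpDl.
have b1 : 0 < `|be| + 1 by rewrite ltr_wpDl.
move=> e e0; rewrite -mulrA -invfM ler_pdivlMr ?mulr_gt0// => h.
have : - (e * `|be|) <= e * be.
  rewrite -mulrN; apply: ler_wpM2l; first exact: ltW.
  by have := ler_norm (- be); rewrite normrN lerNl.
have : 0 <= e * `|be| by rewrite mulr_ge0// ltW.
move: h; rewrite mulrA mulrDr mulr1 => h1 h2 h3; lra.
Qed.

Lemma small_le (al be : R) : (0 < al \/ al = 0 /\ 0 <= be) ->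
  small (fun e => 0 <= al + e * be).
Proof.
move=> [al0|[-> be0]]; first by apply: small_impl (small_lt be al0) => e _ /ltW.
by exists 1 => // e e0 _; rewrite add0r mulr_ge0// ltW.
Qed.

End Small.

Section Boundary.
Variables (R : realType) (N : nat).
Local Notation V := 'rV[R]_N.

Lemma span_nodes (M : mesh R N) (rM : regular M) (K : {set node M}) a b :
  K \in facets M -> a \in K -> b \in K -> (pos a - pos b <= edgemx 2 (vert K))%MS.
Proof.
move=> KM aK bK.
have -> : pos a - pos b = (pos a - (vert K)`_0) - (pos b - (vert K)`_0).
  by rewrite opprB addrA subrK.
by apply: addmx_sub; rewrite ?eqmx_opp; exact: (in_plane_vert rM).
Qed.

Lemma in_plane_add (M : mesh R N) (K : {set node M}) (x w : V) :
  in_plane K x -> (w <= edgemx 2 (vert K))%MS -> in_plane K (x + w).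
Proof. by move=> xK wK; rewrite /in_plane addrAC addmx_sub. Qed.

Lemma affine_dir (f : V -> R) (x w : V) (e : R) : affine_fun f ->
  f (x + e *: w) = f x + e * dlin f w.
Proof. by move=> af; rewrite addrC (affineE af) addrC. Qed.

Lemma small_simplex (M : mesh R N) (rM : regular M) (K : {set node M}) (x w : V) :
  K \in facets M -> simplex K x -> (w <= edgemx 2 (vert K))%MS ->
  (forall k, k \in K -> 0 < bary K k x \/ 0 <= dlin (bary K k) w) ->
  small (fun e => simplex K (x + e *: w)).
Proof.
move=> KM xK wK dir; have [xp x0] := (facetP rM x KM).1 xK.
have : small (fun e => forall k, k \in enum K -> 0 <= bary K k x + e * dlin (bary K k) w).
  apply: small_all => k; rewrite mem_enum => kK; apply: small_le.
  have := x0 k kK; rewrite le_eqVlt => /predU1P[k0|]; last by left.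
  have [|h] := dir k kK; first by rewrite -k0 ltxx.
  by right.
apply: small_impl => e e0 h; apply/(facetP rM _ KM); split.
  by apply: in_plane_add => //; exact: scalemx_sub.
move=> k kK; rewrite affine_dir; last exact: affine_bary.
by apply: h; rewrite mem_enum.
Qed.

Variables (A B : mesh R N).
Hypotheses (rA : regular A) (rB : regular B).
Hypothesis sBA : (surface B `<=` surface A)%classic.

Section AtBoundary.
Variables (a b c : node A) (t : R).
Hypotheses (ab : a != b) (ac : a != c) (bc : b != c).
Let L := [set a; b; c].
Hypotheses (LA : L \in facets A) (t0 : 0 < t) (t1 : t < 1).
Hypothesis uniqL : forall K, K \in facets A -> [set a; b] \subset K -> K = L.
Let x : V := pos b + t *: (pos a - pos b).
Let aL : a \in L. Proof. by rewrite mem3 eqxx. Qed.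
Let bL : b \in L. Proof. by rewrite mem3 eqxx orbT. Qed.
Let cL : c \in L. Proof. by rewrite mem3 eqxx !orbT. Qed.
Let phi := dlin (bary L c).

Let baryx k : k \in L -> bary L k x = (k == b)%:R + t * ((k == a)%:R - (k == b)%:R).
Proof.
move=> kL; rewrite affine_dir; last exact: affine_bary.
by rewrite dlin_sub ?(bary_pos rA)//; exact: affine_bary.
Qed.

Let ba : b != a. Proof. by rewrite eq_sym. Qed.
Let ca : c != a. Proof. by rewrite eq_sym. Qed.
Let cb : c != b. Proof. by rewrite eq_sym. Qed.

Let baryxa : bary L a x = t.
Proof. by rewrite baryx// eqxx (negbTE ab) /=; ring. Qed.
Let baryxb : bary L b x = 1 - t.
Proof. by rewrite baryx// eqxx (negbTE ba) /=; ring. Qed.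
Let baryxc : bary L c x = 0.
Proof. by rewrite baryx// (negbTE ca) (negbTE cb) /=; ring. Qed.

Let xL : simplex L x.
Proof.
apply/(facetP rA _ LA); split.
  apply: in_plane_add; first exact: (in_plane_vert rA).
  by apply: scalemx_sub; exact: span_nodes.
move=> k; rewrite {1}/L mem3 => /or3P[]/eqP->; rewrite ?baryxa ?baryxb ?baryxc//.
  exact: ltW.
by rewrite subr_ge0 ltW.
Qed.

(** All facets but L stay away from x.  Hence near x the surface is the half
    disc of the plane of L on which the coordinate of the third node c is
    nonnegative. *)
Lemma boundary_dir (w : V) : small (fun e => surface A (x + e *: w)) ->
  (w <= edgemx 2 (vert L))%MS /\ 0 <= phi w.
Proof.
move=> sw.
have far : small (fun e => forall K, K \in enum (facets A) -> K != L ->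
    ~ simplex K (x + e *: w)).
  apply: small_all => K; rewrite mem_enum => KA.
  have [->|KL] := eqVneq K L; first by exists 1 => //; rewrite ltr01.
  have xK : ~ simplex K x.
    move=> xK; move/eqP: KL; apply; apply: uniqL => //.
    have aK : a \in K.
      have := bary_agree rA LA KA xL xK aL; rewrite baryxa; case: ifP => // _ h.
      by move: t0; rewrite h ltxx.
    have bK : b \in K.
      have := bary_agree rA LA KA xL xK bL; rewrite baryxb; case: ifP => // _ h.
      by move: t1; rewrite -subr_gt0 h ltxx.
    by apply/subsetP => k; rewrite !inE => /orP[]/eqP->.
  have [f [fK af fx]] : exists f : V -> R, [/\ forall y, simplex K y -> 0 <= f y,
      affine_fun f & f x < 0].
    apply: contrapT => no; apply: xK; apply/(facet_ineqsP rA x KA).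
    have : forall f, List.In f (facet_ineqs K) -> 0 <= f x.
      move=> f fK; rewrite leNgt; apply/negP => fx; apply: no; exists f; split => //.
        move=> y /(facet_ineqsP rA y KA); elim: (facet_ineqs K) fK => //= g s IH.
        by move=> [<-|/IH h] /andP[].
      exact: facet_ineqs_affine fK.
    by elim: (facet_ineqs K) => //= g s IH h; rewrite h ?IH//; [move=> f fs; apply: h; right|left].
  have : small (fun e => 0 < - f x + e * - dlin f w) by apply: small_lt; rewrite oppr_gt0.
  apply: small_impl => e e0 h _ /fK; rewrite affine_dir// leNgt => /negP; apply.
  by rewrite -oppr_gt0 opprD -mulrN.
have [e e0 [[K KA yK] h]] := small_ex (small_and sw far).
have yL : simplex L (x + e *: w).
  have [<-//|KL] := eqVneq K L.
  by have := h K _ KL yK; rewrite mem_enum => /(_ KA).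
have [yp y0] := (facetP rA _ LA).1 yL; have [xp _] := (facetP rA _ LA).1 xL.
split.
  have : (e *: w <= edgemx 2 (vert L))%MS.
    have -> : e *: w = (x + e *: w - (vert L)`_0) - (x - (vert L)`_0).
      by rewrite opprB addrA subrK addrC addKr.
    by apply: addmx_sub => //; rewrite eqmx_opp.
  by rewrite (eqmx_scale _ (lt0r_neq0 e0)).
have := y0 c cL; rewrite affine_dir ?baryxc ?add0r; last exact: affine_bary.
by rewrite pmulr_rge0.
Qed.

Lemma boundary_line (w : V) : (w <= edgemx 2 (vert L))%MS -> phi w = 0 ->
  exists s, w = s *: (pos a - pos b).
Proof.
move=> wL w0.
have pb := in_plane_vert rA LA bL.
have := in_plane_decomp rA LA (in_plane_add pb wL).
rewrite {1}/L big_set3// => e.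
have bE k : k \in L -> bary L k (pos b + w) = (k == b)%:R + dlin (bary L k) w.
  move=> kL; rewrite -[w in LHS]scale1r affine_dir ?mul1r ?(bary_pos rA)//.
  exact: affine_bary.
have := sum_bary rA (pos b + w) LA; rewrite {1}/L big_set3// !bE//.
rewrite -/phi w0 eqxx (negbTE ab) (negbTE cb) /= => s1.
exists (dlin (bary L a) w); move: e; rewrite !bE// -/phi w0 eqxx (negbTE ab) (negbTE cb) /=.
have -> : 1%:R + dlin (bary L b) w = 1 - dlin (bary L a) w.
  by apply: (addIr (dlin (bary L a) w)); rewrite subrK -[RHS]s1; ring.
rewrite !add0r scale0r addr0 => e.
rewrite -[LHS](addKr (pos b)) e; apply/rowP => j; rewrite !mxE; ring.
Qed.

(** A facet is not contained in the line of the boundary edge. *)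
Lemma boundary_degenerate (K : {set node B}) (v : node B) : K \in facets B -> v \in K ->
  (forall k, k \in K -> (pos k - pos v <= edgemx 2 (vert L))%MS /\ phi (pos k - pos v) = 0) ->
  False.
Proof.
move=> KB vK h.
have aff : affine_fun (bary L c) by exact: affine_bary.
have hh k l : k \in K -> l \in K ->
    (pos k - pos l <= edgemx 2 (vert L))%MS /\ phi (pos k - pos l) = 0.
  move=> kK lK; have -> : pos k - pos l = (pos k - pos v) - (pos l - pos v).
    by rewrite opprB addrA subrK.
  have [k1 k2] := h k kK; have [l1 l2] := h l lK; split.
    by apply: addmx_sub => //; rewrite eqmx_opp.
  have := dlin_comb 1 (-1) (pos k - pos v) (pos l - pos v) aff.
  by rewrite scale1r scaleN1r -/phi k2 l2 => ->; ring.
have [k0 [k1 [k2 [n01 n02 n12 KE oK]]]] := facet_ord rB KB.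
have k0K : k0 \in K by rewrite KE mem3 eqxx.
have k1K : k1 \in K by rewrite KE mem3 eqxx orbT.
have k2K : k2 \in K by rewrite KE mem3 eqxx !orbT.
have rowK i : row i (edgemx 2 (vert K)) = pos k1 - pos k0 \/
              row i (edgemx 2 (vert K)) = pos k2 - pos k0.
  by rewrite edgemxE (vertE oK); case: i => -[|[|]]//= _; [left|right].
have KL : (edgemx 2 (vert K) <= edgemx 2 (vert L))%MS.
  by apply/row_subP => i; case: (rowK i) => ->; apply: (hh _ _ _ _).1.
have LK : (edgemx 2 (vert L) <= edgemx 2 (vert K))%MS.
  have [_ <-] := mxrank_leqif_sup KL.
  have /eqP -> := reg_free rB KB; have /eqP -> := reg_free rA LA; exact: eqxx.
have phi0 w : (w <= edgemx 2 (vert K))%MS -> phi w = 0.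
  move=> /submxP[y ->]; rewrite mulmx_sum_row !big_ord_recl big_ord0 addr0.
  rewrite /phi dlin_comb// -/phi.
  have r0 i : phi (row i (edgemx 2 (vert K))) = 0.
    by case: (rowK i) => ->; apply: (hh _ _ _ _).2.
  by rewrite !r0; ring.
have := phi0 (pos c - pos a) (submx_trans (span_nodes rA LA cL aL) LK).
rewrite /phi dlin_sub// !(bary_pos rA)// eqxx (negbTE ca) /= subr0 => /eqP.
by rewrite oner_eq0.
Qed.

(** If x were in the interior of a facet of [B], or in the interior of an edge
    at which two facets of [B] meet, then one could leave x within the surface
    in directions that the half disc around x does not contain. *)
Lemma boundary_vanish (K : {set node B}) (v : node B) :
  K \in facets B -> simplex K x -> v \in K -> bary K v x != 0 ->
  ~~ on_bd (facets B) [set v] -> x = pos v.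
Proof.
move=> KB xK vK bv nbd.
have [xp x0] := (facetP rB _ KB).1 xK.
have bv0 : 0 < bary K v x by rewrite lt_def bv x0.
have adm (K' : {set node B}) w : K' \in facets B -> simplex K' x -> (w <= edgemx 2 (vert K'))%MS ->
   (forall k, k \in K' -> 0 < bary K' k x \/ 0 <= dlin (bary K' k) w) ->
   (w <= edgemx 2 (vert L))%MS /\ 0 <= phi w.
  move=> K'B xK' wK' dir; apply: boundary_dir.
  apply: small_impl (small_simplex rB K'B xK' wK' dir) => e _ h.
  by apply: sBA; exists K'.
have aphi : affine_fun (bary L c) by exact: affine_bary.
have phiN w : phi (- w) = - phi w.
  have := dlin_comb (-1) 0 w 0 aphi; rewrite scaleN1r scale0r addr0 mul0r addr0 mulN1r.
  by [].
have [k1 [k2 [vk1 vk2 k12 KE]]] := card3_from (reg_card rB KB) vK.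
wlog k12pos : k1 k2 vk1 vk2 k12 KE / bary K k2 x != 0 -> bary K k1 x != 0.
  move=> H; have [h|h] := eqVneq (bary K k1 x) 0; last by apply: (H k1 k2).
  have [h2|h2] := eqVneq (bary K k2 x) 0; first by apply: (H k1 k2) => //; rewrite h2 eqxx.
  by apply: (H k2 k1) => //; rewrite 1?eq_sym// KE -!setUA [[set k2; k1]]setUC.
have k1K : k1 \in K by rewrite KE mem3 eqxx orbT.
have k2K : k2 \in K by rewrite KE mem3 eqxx !orbT.
have [b1|b1] := eqVneq (bary K k1 x) 0.
  have b2 : bary K k2 x = 0 by apply/eqP/negPn/negP => /k12pos; rewrite b1 eqxx.
  have := sum_bary rB x KB; rewrite {1}KE big_set3// b1 b2 !addr0 => bv1.
  by rewrite {1}(in_plane_decomp rB KB xp) {1}KE big_set3// bv1 b1 b2 !scale0r !addr0 scale1r.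
have b1p : 0 < bary K k1 x by rewrite lt_def b1 x0.
have pm (K' : {set node B}) w : K' \in facets B -> simplex K' x -> (w <= edgemx 2 (vert K'))%MS ->
   (forall k, k \in K' -> 0 < bary K' k x \/ dlin (bary K' k) w = 0) ->
   (w <= edgemx 2 (vert L))%MS /\ phi w = 0.
  move=> K'B xK' wK' dir.
  have [w1 w2] : (w <= edgemx 2 (vert L))%MS /\ 0 <= phi w.
    by apply: (adm K') => // k /dir[]; [left|move=> ->; right].
  have [_ w3] : (- w <= edgemx 2 (vert L))%MS /\ 0 <= phi (- w).
    apply: (adm K') => //; first by rewrite eqmx_opp.
    move=> k /dir[]; [by left|move=> dk; right].
    have := dlin_comb (-1) 0 w 0 (affine_bary K' k).
    by rewrite scaleN1r scale0r addr0 dk => ->; rewrite mulr0 mul0r addr0.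
  split=> //; apply/eqP; rewrite eq_le w2 andbT.
  by rewrite phiN oppr_ge0 in w3.
have dK (K' : {set node B}) k l m : K' \in facets B -> k \in K' -> l \in K' -> m \in K' ->
    dlin (bary K' m) (pos k - pos l) = (m == k)%:R - (m == l)%:R.
  by move=> K'B kK lK mK; rewrite dlin_sub ?(bary_pos rB)//; exact: affine_bary.
have k1v : k1 != v by rewrite eq_sym.
have k2v : k2 != v by rewrite eq_sym.
have k21 : k2 != k1 by rewrite eq_sym.
(* x cannot be interior to K: all directions in the plane of K would be
   tangent to the boundary edge *)
exfalso; have [b2|b2] := eqVneq (bary K k2 x) 0; last first.
  have b2p : 0 < bary K k2 x by rewrite lt_def b2 x0.
  apply: (boundary_degenerate KB vK) => k kK; apply: (pm K) => //.
    exact: span_nodes.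
  by move=> m; rewrite {1}KE mem3 => /or3P[]/eqP->; left.
(* x is in the relative interior of the edge {v, k1} *)
have [K' K'B [K'K vK' k1K']] : exists2 K', K' \in facets B & [/\ K' != K, v \in K' & k1 \in K'].
  apply: contrapT => no; move/negP: nbd; apply; apply/existsP.
  exists [set v; k1]; rewrite subsetUl andbT inE; apply/cards1P; exists K.
  apply/setP => K'; rewrite !inE; apply/idP/eqP => [/and3P[K'B sub _]|->].
    apply/eqP/negPn/negP => K'K; apply: no; exists K' => //; split => //;
    by apply: (subsetP sub); rewrite !inE eqxx ?orbT.
  rewrite KB (reg_card rB KB) cards2 vk1 andbT /=.
  by apply/subsetP => k; rewrite !inE => /orP[]/eqP->.
have [k3 [vk3 k13 K'E]] := card3_from2 (reg_card rB K'B) vK' k1K' vk1.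
have k3K' : k3 \in K' by rewrite K'E mem3 eqxx !orbT.
have k2K' : k2 \notin K'.
  apply/negP => k2K'; move/eqP: K'K; apply; apply/esym/eqP.
  rewrite eqEcard (reg_card rB KB) (reg_card rB K'B) leqnn andbT.
  by apply/subsetP => k; rewrite {1}KE mem3 => /or3P[]/eqP->.
have k3K : k3 \notin K.
  by rewrite KE mem3 !negb_or eq_sym vk3 eq_sym k13; apply: contra k2K' => /eqP <-.
have xK' : simplex K' x.
  have : simplex [set v; k1] x.
    apply/(simplexP rB x KB).
      by apply/subsetP => k; rewrite !inE => /orP[]/eqP->.
    split => // k; rewrite {1}KE mem3 => /or3P[]/eqP->; rewrite !inE ?eqxx ?orbT//.
  move=> xS; have sub : [set v; k1] \subset K'.
    by apply/subsetP => k; rewrite !inE => /orP[]/eqP->.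
  by have [? ? _] := (simplexP rB x K'B sub).1 xS; apply/(facetP rB _ K'B).
have bv' : 0 < bary K' v x by have := bary_agree rB K'B KB xK' xK vK'; rewrite vK => ->.
have b1' : 0 < bary K' k1 x by have := bary_agree rB K'B KB xK' xK k1K'; rewrite k1K => ->.
pose d := pos k1 - pos v; pose n := pos k2 - pos v; pose n' := pos k3 - pos v.
have [dL phid] : (d <= edgemx 2 (vert L))%MS /\ phi d = 0.
  apply: (pm K) => //; first exact: span_nodes.
  move=> m; rewrite {1}KE mem3 => /or3P[]/eqP->; [by left|by left|right].
  by rewrite dK// (negbTE k21) (negbTE k2v) subrr.
have [nL phin] : (n <= edgemx 2 (vert L))%MS /\ 0 <= phi n.
  apply: (adm K) => //; first exact: span_nodes.
  move=> m; rewrite {1}KE mem3 => /or3P[]/eqP->; [by left|by left|right].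
  by rewrite dK// eqxx (negbTE k2v) subr0.
have [n'L phin'] : (n' <= edgemx 2 (vert L))%MS /\ 0 <= phi n'.
  apply: (adm K') => //; first exact: span_nodes.
  move=> m; rewrite {1}K'E mem3 => /or3P[]/eqP->; [by left|by left|right].
  by rewrite dK// eqxx (eq_sym k3) (negbTE vk3) subr0.
have phi_pos (K2 : {set node B}) k : K2 \in facets B -> K2 = [set v; k1; k] -> 0 <= phi (pos k - pos v) ->
    (pos k - pos v <= edgemx 2 (vert L))%MS -> 0 < phi (pos k - pos v).
  move=> K2B K2E p0 pL; rewrite lt_def p0 andbT; apply/eqP => pk.
  have vK2 : v \in K2 by rewrite K2E mem3 eqxx.
  apply: (boundary_degenerate K2B vK2) => m; rewrite K2E mem3 => /or3P[]/eqP-> //.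
  rewrite subrr sub0mx; split=> //; have := dlin_comb 0 0 (0 : V) 0 aphi.
  by rewrite !scale0r addr0 !mul0r addr0.
have np := phi_pos K k2 KB KE phin nL.
have np' := phi_pos K' k3 K'B K'E phin' n'L.
have phi_lin s1 s2 (u1 u2 : V) : phi (s1 *: u1 + s2 *: u2) = s1 * phi u1 + s2 * phi u2.
  exact: dlin_comb.
have [s sE] : exists s, phi n' *: n + (- phi n) *: n' = s *: (pos a - pos b).
  apply: boundary_line; first by apply: addmx_sub; exact: scalemx_sub.
  by rewrite phi_lin; ring.
have [r rE] := boundary_line dL phid.
have r0 : r != 0.
  apply/eqP => r0; move: rE; rewrite r0 scale0r => d0.
  have := dK K k1 v k1 KB k1K vK k1K; rewrite -/d d0 eqxx (negbTE k1v) /= subr0 => /eqP.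
  have := dlin_comb 0 0 (0 : V) 0 (affine_bary K k1).
  by rewrite !scale0r addr0 !mul0r addr0 => ->; rewrite eq_sym oner_eq0.
(* up to a multiple of d, the direction w points from the edge into K and also
   into K', although these facets only share the edge *)
pose w := phi n' *: n; have wE : w = phi n *: n' + (s / r) *: d.
  rewrite rE scalerA divfK// -sE scaleNr addrCA subrr addr0 //.
have wK : small (fun e => simplex K (x + e *: w)).
  apply: small_simplex => //; first by apply: scalemx_sub; exact: span_nodes.
  move=> m; rewrite {1}KE mem3 => /or3P[]/eqP->; [by left|by left|right].
  rewrite /w -[_ *: n]addr0 -(scale0r (0 : V)) dlin_comb ?mul0r ?addr0; last exact: affine_bary.
  by rewrite dK// eqxx (negbTE k2v) subr0 mulr1.
have wK' : small (fun e => simplex K' (x + e *: w)).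
  apply: small_simplex => //.
    by rewrite wE; apply: addmx_sub; apply: scalemx_sub; exact: span_nodes.
  move=> m; rewrite {1}K'E mem3 => /or3P[]/eqP->; [by left|by left|right].
  rewrite wE dlin_comb; last exact: affine_bary.
  rewrite !dK// eqxx !(eq_sym k3) (negbTE vk3) (negbTE k13) subrr mulr0 addr0 subr0 mulr1.
  exact: ltW.
have [e e0 [yK yK']] := small_ex (small_and wK wK').
have := bary_agree rB KB K'B yK yK' k2K; rewrite (negbTE k2K').
rewrite affine_dir ?b2 ?add0r; last exact: affine_bary.
rewrite /w -[_ *: n]addr0 -(scale0r (0 : V)) dlin_comb ?mul0r ?addr0; last exact: affine_bary.
rewrite dK// eqxx (negbTE k2v) subr0 mulr1 => /eqP.
by rewrite mulf_eq0 (gt_eqF e0) (gt_eqF np').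
Qed.

End AtBoundary.
End Boundary.

(** * Stokes' theorem on the surface *)

Section CoreSum.
Variables (R : realType) (N : nat) (A B : mesh R N).
Hypotheses (rA : regular A) (rB : regular B).
Hypotheses (sAB : (surface A `<=` surface B)%classic)
           (sBA : (surface B `<=` surface A)%classic).
Local Notation V := 'rV[R]_N.

Lemma bdP (M : mesh R N) (rM : ordered M) (w : {set node M}) :
  w \in bd (facets M) -> #|w| = 2%N /\ exists K, [/\ K \in facets M, w \subset K &
    forall K', K' \in facets M -> w \subset K' -> K' = K].
Proof.
rewrite inE => /cards1P[K KE]; have : K \in [set K] by rewrite inE.
rewrite -KE !inE => /and3P[KM wK]; rewrite (reg_card rM KM) => /eqP[w2].
split=> //; exists K; split=> // K' K'M wK'; apply/set1P; rewrite -KE !inE K'M wK'.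
by rewrite (reg_card rM K'M) w2 eqxx.
Qed.

Lemma mem_bd (M : mesh R N) (rM : ordered M) (w K : {set node M}) :
  #|w| = 2%N -> K \in facets M -> w \subset K ->
  (forall K', K' \in facets M -> w \subset K' -> K' = K) -> w \in bd (facets M).
Proof.
move=> w2 KM wK uK; rewrite inE; apply/cards1P; exists K; apply/setP => K'.
rewrite !inE; apply/idP/eqP => [/and3P[? ? _]|->]; first exact: uK.
by rewrite KM wK (reg_card rM KM) w2.
Qed.

Lemma on_bd_edge (M : mesh R N) (rM : ordered M) (w : {set node M}) :
  #|w| = 2%N -> on_bd (facets M) w = (w \in bd (facets M)).
Proof.
move=> w2; apply/existsP/idP => [[u /andP[ub wu]]|wb]; last by exists w; rewrite wb subxx.
have [u2 _] := bdP rM ub.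
by have /eqP -> : w == u by rewrite eqEcard wu u2 w2.
Qed.

(** On the edge l_p vanishes in the first case; in the second case l_v does,
    with finitely many exceptions. *)
Lemma edge_int_bd (p a b : node A) (v : node B) : a != b -> p != a ->
  [set a; b] \in bd (facets A) ->
  ([set p; a] \notin bd (facets A)) || ~~ on_bd (facets B) [set v] ->
  edge_int p a b v = 0.
Proof.
move=> ab pa abb; rewrite /edge_int.
have z0 : \int[@lebesgue_measure R]_(x in `[0%R, 1%R]%classic) (0 : R) = 0.
  by rewrite Rintegral_cst ?mul0r.
case/orP => [pab|vb].
  rewrite -[RHS]z0; apply: eq_Rintegral => x _.
  rewrite (negbTE pa) (_ : p == b = false) ?subrr ?mulr0 ?addr0 ?mul0r//.
  by apply: contraNF pab => /eqP ->; rewrite [[set b; a]]setUC.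
have [_ [L [LA abL uL]]] := bdP rA abb.
have aL : a \in L by apply: (subsetP abL); rewrite !inE eqxx.
have bL : b \in L by apply: (subsetP abL); rewrite !inE eqxx orbT.
have [c [ac bc LE]] := card3_from2 (reg_card rA LA) aL bL ab.
rewrite -[RHS]z0; apply: (@Rintegral_except R [:: 0; 1; bary L a (pos (v : node B))]) => //.
move=> x; rewrite /= in_itv/= => /andP[x0 x1]; rewrite !inE !negb_or => /and3P[nx0 nx1 nxv].
have xp : 0 < x by rewrite lt_def nx0.
have xl : x < 1 by rewrite lt_def eq_sym nx1.
set u := pos b + x *: (pos a - pos b).
have bau : bary L a u = x.
  rewrite affine_dir; last exact: affine_bary.
  rewrite dlin_sub; last exact: affine_bary.
  by rewrite !(bary_pos rA)// eqxx (negbTE ab) /=; ring.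
have uLA : simplex L u.
  apply/(facetP rA _ LA); split.
    apply: in_plane_add; first exact: (in_plane_vert rA).
    by apply: scalemx_sub; exact: span_nodes.
  move=> k kL; rewrite affine_dir; last exact: affine_bary.
  rewrite dlin_sub; last exact: affine_bary.
  rewrite !(bary_pos rA)//; have : (0 : R) <= (k == a)%:R by [].
  have : (0 : R) <= (k == b)%:R by [].
  move=> h1 h2; rewrite mulrBr addrCA -[X in X - _]mul1r -mulrBl addr_ge0// mulr_ge0//.
  by rewrite subr_ge0.
have [K KB uK] : surface B u by apply: sAB; exists L.
rewrite (ghatE rB v KB uK) /hat KB /=; case: ifPn => vK; last by rewrite mulr0.
have [->|bv] := eqVneq (bary K v u) 0; first by rewrite mulr0.
have LA' : [set a; b; c] \in facets A by rewrite -LE.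
have uL' K' : K' \in facets A -> [set a; b] \subset K' -> K' = [set a; b; c].
  by rewrite -LE; exact: uL.
have uv := boundary_vanish rA rB sBA ab ac bc LA' xp xl uL' KB uK vK bv vb.
by move: nxv; rewrite -uv bau eqxx.
Qed.

Lemma core_term (p a : node A) (v : node B) (K : {set node A}) : K \in facets A ->
  tint (vert K) (fun x => \sum_(L in facets B)
     chi L x * core_form p a v K L x (edgemx 2 (vert K))) =
  - \sum_(y | (y != a) && ([set a; y] \subset K))
      incid [set a; y] K * (sgn2 a y * edge_int p a y v).
Proof.
move=> KA; have [aK|aK] := boolP (a \in K); last first.
  rewrite big_pred0 ?oppr0; last first.
    move=> y; apply/negP => /andP[_ /subsetP sub]; move/negP: aK; apply.
    by apply: sub; rewrite !inE eqxx.
  rewrite -[RHS](tint0 (vert K)); apply: eq_tint => x; rewrite big1// => L _.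
  have h0 : hat a K = fun=> 0.
    by apply/funext => y; rewrite /hat (negbTE aK) andbF.
  by rewrite /core_form h0 /wedge2 /dlin !subrr !mulr0 !subrr !mulr0 addr0 mulr0.
have [b [c [ab ac bc KE]]] := card3_from (reg_card rA KA) aK.
have ba : b != a by rewrite eq_sym.
have ca : c != a by rewrite eq_sym.
have cb : c != b by rewrite eq_sym.
have KA1 : [set b; a; c] \in facets A by rewrite set3C12 -KE.
have KA0 : [set a; b; c] \in facets A by rewrite -KE.
have KA2 : [set a; c; b] \in facets A by rewrite set3C23 -KE.
pose eta x E := \sum_(L in facets B) chi L x * core_form p a v K L x E.
have te x : two_form (eta x).
  move=> C E; rewrite /eta mulr_sumr; apply: eq_bigr => L _.
  by rewrite two_form_core mulrCA.
have tt E : tame (fun x => eta x E).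
  by apply: tame_sum => L _; apply: tame_mul; [exact: tame_chi|exact: tame_core].
have := tint_reorder rA ba bc ac KA1 te tt.
rewrite set3C12 -KE /eta => ->.
have := core_facet rA rB sAB p v ab ac bc KA0; rewrite -KE => ->.
rewrite (bigD1 b)/=; last first.
  by rewrite ba KE; apply/subsetP => y; rewrite !inE => /orP[]/eqP->; rewrite eqxx ?orbT.
rewrite (bigD1 c)/=; last first.
  rewrite ca cb KE andbT; apply/subsetP => y.
  by rewrite !inE => /orP[]/eqP->; rewrite eqxx ?orbT.
rewrite [X in _ + (_ + X)]big_pred0; last first.
  move=> y; apply/negP => /andP[/andP[/andP[ya /subsetP sub] yb] yc].
  have : y \in K by apply: sub; rewrite !inE eqxx orbT.
  by rewrite KE mem3 (negbTE ya) (negbTE yb) (negbTE yc).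
have -> : incid [set a; b] K = sgn2 a b * sgn3 a b c.
  by rewrite KE (incid_facet rA ab ac bc KA0).
have -> : incid [set a; c] K = sgn2 a c * sgn3 a c b.
  by rewrite KE -set3C23 (incid_facet rA ac ab cb KA2).
rewrite (sgn3C23 rA ab ac bc KA0) (sgn3C12 rA ab ac bc KA0).
have s1 := sgn2_sqr rA ab (facet_edge ab KA0).
have s2 := sgn2_sqr rA ac (facet_edge ac KA2).
move: (edge_int p a b v) (edge_int p a c v) (sgn3 a b c) s1 s2 => e1 e2 s.
move: (sgn2 a b) (sgn2 a c) => t1 t2 s1 s2.
have -> : t1 * s * (t1 * e1) = (t1 * t1) * (s * e1) by ring.
have -> : t2 * - s * (t2 * e2) = - (t2 * t2) * (s * e2) by ring.
rewrite s1 s2; ring.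
Qed.

(** An interior edge gets contributions from two facets, with opposite signs;
    those of boundary edges vanish. *)
Theorem core_sum (p a : node A) (v : node B) : p != a ->
  ([set p; a] \notin bd (facets A)) || ~~ on_bd (facets B) [set v] ->
  \sum_(K in facets A) orn K * tint (vert K) (fun x => \sum_(L in facets B)
     chi L x * core_form p a v K L x (edgemx 2 (vert K))) = 0.
Proof.
move=> pa bc.
rewrite (eq_bigr (fun K : {set node A} => - \sum_(y | (y != a) && ([set a; y] \subset K))
    orn K * incid [set a; y] K * (sgn2 a y * edge_int p a y v))); last first.
  move=> K KA; rewrite core_term// mulrN mulr_sumr; congr (- _).
  by apply: eq_bigr => y _; exact: mulrA.
rewrite sumrN (exchange_big_dep (fun y : node A => y != a))/=; last by move=> K y _ /andP[].
rewrite big1 ?oppr0// => y ya.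
have ay : a != y by rewrite eq_sym.
rewrite -mulr_suml.
have [yb|yb] := boolP ([set a; y] \in bd (facets A)).
  by rewrite edge_int_bd ?mulr0.
suff -> : \sum_(K : {set node A} | (K \in facets A) && ((y != a) && ([set a; y] \subset K)))
   orn K * incid [set a; y] K = 0 by rewrite mul0r.
rewrite (eq_bigl (fun K : {set node A} => (K \in facets A) && ([set a; y] \subset K))); last first.
  by move=> K; rewrite ya.
have [ec|ec] := boolP ([set a; y] \in cells A 1).
  by apply: (reg_coherent rA ec); rewrite (on_bd_edge rA) ?cards2 ?ay.
rewrite big_pred0// => K; apply/negP => /andP[KA sub]; move/negP: ec; apply.
by apply/cellP; rewrite cards2 ay; split=> //; exists K.
Qed.

End CoreSum.

(** * Orientation of a facet by its nodes *)

Section Orientation.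
Variables (R : realType) (N : nat) (M : mesh R N).
Hypothesis rM : ordered M.
Implicit Types (a b c : node M) (K : {set node M}) (E : 'M[R]_(2, N)).

(** The orientation of the facet abc, relative to the order of its nodes. *)
Definition orn3 a b c : R := orn [set a; b; c] * sgn3 a b c.

Lemma orn3C12 a b c : a != b -> a != c -> b != c -> [set a; b; c] \in facets M ->
  orn3 b a c = - orn3 a b c.
Proof. by move=> *; rewrite /orn3 set3C12 (sgn3C12 rM)// mulrN. Qed.

Lemma orn3C23 a b c : a != b -> a != c -> b != c -> [set a; b; c] \in facets M ->
  orn3 a c b = - orn3 a b c.
Proof. by move=> *; rewrite /orn3 set3C23 (sgn3C23 rM)// mulrN. Qed.

Lemma orn3_rot a b c : a != b -> a != c -> b != c -> [set a; b; c] \in facets M ->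
  orn3 c a b = orn3 a b c.
Proof. by move=> *; rewrite /orn3 set3_rot (sgn3_rot rM). Qed.

Lemma orn_incid a b c : a != b -> a != c -> b != c -> [set a; b; c] \in facets M ->
  orn [set a; b; c] * incid [set a; b] [set a; b; c] = sgn2 a b * orn3 a b c.
Proof. by move=> *; rewrite (incid_facet rM)// mulrCA. Qed.

Lemma sg_sgn3 a b c (r : R) : a != b -> a != c -> b != c -> [set a; b; c] \in facets M ->
  Num.sg (sgn3 a b c * r) = sgn3 a b c * Num.sg r.
Proof.
move=> ab ac bc KM; have := sgn3_sqr rM ab ac bc KM; rewrite sgrM => h.
have : sgn3 a b c ^+ 2 == 1 by rewrite expr2 h.
by rewrite sqrf_eq1 => /orP[]/eqP->; rewrite ?sgr1 ?sgrN ?sgr1.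
Qed.

Lemma sum_dlin_bary K w : K \in facets M -> \sum_(k in K) dlin (bary K k) w = 0.
Proof.
move=> KM; rewrite /dlin big_split/= sumrN.
by rewrite !(sum_bary rM)// subrr.
Qed.

Lemma dbary_pinvmx K k0 k1 k2 E : K = [set k0; k1; k2] -> ord K = [:: k0; k1; k2] ->
  k0 != k1 -> k0 != k2 -> k1 != k2 ->
  \matrix_(i < 2, j < 2) ([seq dbary K a (row i E) | a <- ord K]`_j.+1) =
  E *m pinvmx (edgemx 2 (vert K)).
Proof.
move=> KE oK n01 n02 n12; apply/matrixP => i j; rewrite [LHS]mxE oK.
have d (j' : 'I_2) k : index k [:: k0; k1; k2] = j'.+1 ->
    dbary K k (row i E) = (E *m pinvmx (edgemx 2 (vert K))) i j'.
  move=> ik; rewrite /dbary /bary oK ik !mulmxBl mul0mx.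
  have -> : inord j' = j' :> 'I_2 by exact: inord_val.
  rewrite -row_mul !mxE; ring.
case: j => -[|[|]]//= ij; [apply: (d _ k1)|apply: (d _ k2)];
by rewrite /= ?eqxx ?(negbTE n01) ?(negbTE n02) ?(negbTE n12).
Qed.

Lemma det_dbary K k0 k1 k2 E : K = [set k0; k1; k2] -> ord K = [:: k0; k1; k2] ->
  k0 != k1 -> k0 != k2 -> k1 != k2 ->
  \det (\matrix_(i < 2, j < 2) ([seq dbary K a (row i E) | a <- ord K]`_j.+1)) =
  wedge2 (bary K k1) (bary K k2) E.
Proof.
move=> KE oK n01 n02 n12; rewrite det2 !mxE oK /= /wedge2 /dlin /dbary; ring.
Qed.

(** All the two-forms d l_j /\ d l_k of a facet agree up to sign, so that any
    two of its nodes can be used to test an orientation. *)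
Lemma orient_nodes a b c E : a != b -> a != c -> b != c -> [set a; b; c] \in facets M ->
  orient [set a; b; c] E =
  orn3 a b c * Num.sg (wedge2 (bary [set a; b; c] b) (bary [set a; b; c] c) E) /\
  (wedge2 (bary [set a; b; c] b) (bary [set a; b; c] c) E != 0 -> row_free E).
Proof.
move=> ab ac bc KM; set K := [set a; b; c].
pose F (x y z : node M) := wedge2 (bary K y) (bary K z) E -
  wedge2 (bary K x) (bary K z) E + wedge2 (bary K x) (bary K y) E.
have F1 x y z : F y x z = - F x y z by rewrite /F /wedge2; ring.
have F2 x y z : F x z y = - F x y z by rewrite /F /wedge2; ring.
have F3 x y z : K = [set x; y; z] -> x != y -> x != z -> y != z ->
    F x y z = 3%:R * wedge2 (bary K y) (bary K z) E.
  move=> KE xy xz yz.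
  have d w : dlin (bary K x) w = - dlin (bary K y) w - dlin (bary K z) w.
    have := sum_dlin_bary w KM; rewrite -/K {1}KE big_set3// => h.
    by apply: (addIr (dlin (bary K y) w + dlin (bary K z) w)); rewrite addrA h; ring.
  rewrite /F /wedge2 !d; ring.
have oabc := ord_facet rM ab ac bc KM.
have [s0 [s1 [s2 [oK FE _]]]] := alternating3 a F1 F2 ab ac bc oabc.
have us : uniq [:: s0; s1; s2].
  by rewrite -oK (perm_uniq oabc)/= !inE negb_or ab ac bc.
have [n01 n02 n12] : [/\ s0 != s1, s0 != s2 & s1 != s2].
  by move: us; rewrite /= !inE negb_or !andbT => /andP[/andP[-> ->] ->].
have KE : K = [set s0; s1; s2].
  by apply/setP => u; rewrite mem3 mem3; have := perm_mem oabc u; rewrite oK !inE.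
have W : wedge2 (bary K s1) (bary K s2) E = sgn3 a b c * wedge2 (bary K b) (bary K c) E.
  have h3 : 3%:R != 0 :> R by rewrite pnatr_eq0.
  apply: (mulfI h3); rewrite -(F3 s0 s1 s2)// FE (F3 a b c)//.
  by rewrite /sgn3 mulrCA.
split.
  by rewrite /orient (det_dbary E KE oK n01 n02 n12) W sg_sgn3// /orn3 mulrA.
move=> w0; have dn0 : \det (E *m pinvmx (edgemx 2 (vert K))) != 0.
  rewrite -(dbary_pinvmx E KE oK n01 n02 n12) (det_dbary E KE oK n01 n02 n12) W.
  rewrite mulf_neq0//; apply/eqP => s0'; have := sgn3_sqr rM ab ac bc KM.
  by rewrite s0' mul0r => /eqP; rewrite eq_sym oner_eq0.
have : row_free (E *m pinvmx (edgemx 2 (vert K))).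
  by rewrite row_free_unit unitmxE unitfE.
rewrite /row_free => /eqP rk; rewrite eqn_leq rank_leq_row -{1}rk.
exact: mxrankM_maxl.
Qed.

Lemma orient_mulmx K (D : 'M[R]_2) E : K \in facets M ->
  orient K (D *m E) = Num.sg (\det D) * orient K E.
Proof.
move=> KM; have [a aK] : exists a, a \in K.
  by apply/card_gt0P; rewrite (reg_card rM KM).
have [b [c [ab ac bc KE]]] := card3_from (reg_card rM KM) aK.
rewrite KE in KM *.
have [-> _] := orient_nodes (D *m E) ab ac bc KM; have [-> _] := orient_nodes E ab ac bc KM.
rewrite (two_form_wedge2 (affine_bary _ _) (affine_bary _ _)) sgrM.
exact: mulrCA.
Qed.

End Orientation.

(** * Facets of the barycentric refinement *)

Section Refined.
Variables (R : realType) (N : nat) (T : bc_mesh R N).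
Hypothesis rT : regular T.
Hypothesis oR : cell_orders (refined T).
Local Notation V := 'rV[R]_N.
Local Notation T' := (refined T).
Implicit Types (a b c k : node T) (s u e f : {set node T}) (z w : {set node T'}).

(** The triangle between the node a, the midpoint of ab and the barycenter of
    abc. *)
Definition flag a b c : {set node T'} :=
  [set ([set a] : node T'); [set a; b]; [set a; b; c]].

Lemma flag_neq a b c : a != b -> a != c -> b != c ->
  [/\ ([set a] : node T') != [set a; b], ([set a] : node T') != [set a; b; c] &
      ([set a; b] : node T') != [set a; b; c]].
Proof.
move=> ab ac bc; split; apply/eqP => /(congr1 (fun s : {set node T} => #|s|));
by rewrite ?cards1 ?cards2 ?cards3// ab.
Qed.

Lemma ordered_refined : ordered T'.
Proof. by split => // z; rewrite inE => /and3P[/eqP]. Qed.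

Lemma is_cellP s : reflect (s != set0 /\ exists2 K, K \in facets T & s \subset K) (is_cell s).
Proof.
apply: (iffP andP) => -[s0]; first by move=> /existsP[K /andP[KT sK]]; split=> //; exists K.
by move=> [K KT sK]; split=> //; apply/existsP; exists K; rewrite KT.
Qed.

Lemma flag_facet a b c : a != b -> a != c -> b != c -> [set a; b; c] \in facets T ->
  flag a b c \in facets T'.
Proof.
move=> ab ac bc KT; rewrite inE; have [n1 n2 n3] := flag_neq ab ac bc.
have sub1 : [set a] \subset [set a; b] by exact: subsetUl.
have sub2 : [set a; b] \subset [set a; b; c] by exact: subsetUl.
have sub3 := subset_trans sub1 sub2.
apply/and3P; split; first by rewrite cards3.
  apply/forallP => s; apply/implyP; rewrite mem3 => /or3P[]/eqP->; apply/is_cellP;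
  by split; [apply/set0Pn; exists a; rewrite !inE eqxx|exists [set a; b; c]].
apply/forallP => s; apply/implyP => sz; apply/forallP => u; apply/implyP.
by move: sz; rewrite !mem3 => /or3P[]/eqP-> /or3P[]/eqP->;
  rewrite ?subxx ?sub1 ?sub2 ?sub3 ?orbT.
Qed.

Lemma facet_flag z : z \in facets T' -> exists a b c,
  [/\ a != b, a != c, b != c, [set a; b; c] \in facets T & z = flag a b c].
Proof.
rewrite inE => /and3P[/eqP z3 /forallP zc /forallP zch].
have cell s : s \in z -> s != set0 /\ exists2 K, K \in facets T & s \subset K.
  by move=> sz; apply/is_cellP; move/implyP: (zc s); apply.
have chain s u : s \in z -> u \in z -> (s \subset u) || (u \subset s).
  move=> sz uz; move/implyP: (zch s) => /(_ sz)/forallP/(_ u)/implyP; exact.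
have card_lt s : s \in z -> (0 < #|s| < 4)%N.
  move=> sz; have [s0 [K KT sK]] := cell s sz.
  by rewrite card_gt0 s0 ltnS -(reg_card rT KT) subset_leq_card.
have inj : {in z &, injective (fun s : {set node T} => inord #|s| : 'I_4)}.
  move=> s u sz uz /(congr1 (@nat_of_ord 4)); rewrite !inordK; last 2 first.
  - by case/andP: (card_lt u uz).
  - by case/andP: (card_lt s sz).
  move=> su; apply/eqP; case/orP: (chain s u sz uz) => h.
    by rewrite eqEcard h; apply: eq_leq; exact: esym su.
  by rewrite eq_sym eqEcard h; apply: eq_leq; exact: su.
have im : [set (inord #|s| : 'I_4) | s : {set node T} in z] = [set~ ord0].
  apply/eqP; rewrite eqEcard card_in_imset// z3 cardsC1 card_ord leqnn andbT.
  apply/subsetP => i /imsetP[s sz ->]; rewrite !inE; apply/eqP => /(congr1 (@nat_of_ord 4)).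
  by rewrite inordK; case/andP: (card_lt s sz) => // + _ => /[swap] ->.
have get i : (0 < i < 4)%N -> exists2 s, s \in z & #|s| = i.
  move=> /andP[i0 i4]; have : inord i \in [set~ (ord0 : 'I_4)].
    by rewrite !inE; apply/eqP => /(congr1 (@nat_of_ord 4)); rewrite inordK// => i0'; rewrite i0' in i0.
  rewrite -im => /imsetP[s sz /(congr1 (@nat_of_ord 4))]; rewrite !inordK//; first by exists s.
  by case/andP: (card_lt s sz).
have [s1 s1z c1] := get 1%N isT; have [s2 s2z c2] := get 2%N isT.
have [s3 s3z c3] := get 3%N isT.
have sub12 : s1 \subset s2.
  case/orP: (chain _ _ s1z s2z) => // /subset_leq_card; by rewrite c1 c2.
have sub23 : s2 \subset s3.
  case/orP: (chain _ _ s2z s3z) => // /subset_leq_card; by rewrite c2 c3.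
have zE : z = [set s1; s2; s3].
  apply/esym/eqP; rewrite eqEcard z3 cards3 ?andbT; last 3 first.
  - by apply/eqP => h; move: c1; rewrite h c2.
  - by apply/eqP => h; move: c1; rewrite h c3.
  - by apply/eqP => h; move: c2; rewrite h c3.
  by apply/subsetP => s; rewrite mem3 => /or3P[]/eqP->.
have /eqP/cards1P[a s1E] := c1.
have as2 : a \in s2 by apply: (subsetP sub12); rewrite s1E inE.
have [b ab s2E] : exists2 b, a != b & s2 = [set a; b].
  have : #|s2 :\ a| = 1%N by move: c2; rewrite (cardsD1 a) as2 => -[].
  move=> /eqP/cards1P[b sb]; exists b; last by rewrite -(setD1K as2) sb.
  have : b \in s2 :\ a by rewrite sb inE.
  by rewrite !inE eq_sym => /andP[].
have as3 : a \in s3 by apply: (subsetP sub23).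
have bs3 : b \in s3 by apply: (subsetP sub23); rewrite s2E !inE eqxx orbT.
have [c [ac bc s3E]] := card3_from2 c3 as3 bs3 ab.
exists a, b, c; split=> //; last by rewrite zE s1E s2E s3E.
rewrite -s3E; have [_ [K KT sK]] := cell s3 s3z.
by have /eqP -> : s3 == K by rewrite eqEcard sK c3 (reg_card rT KT).
Qed.

Definition mid s : V := (#|s|%:R)^-1 *: \sum_(a in s) pos a.

Lemma posE s : @pos R N T' s = mid s. Proof. by []. Qed.

Lemma mid_comb s : mid s = \sum_(a in s) (#|s|%:R)^-1 *: pos a.
Proof. by rewrite /mid scaler_sumr. Qed.

Lemma sum_inv s : s != set0 -> \sum_(a in s) (#|s|%:R)^-1 = 1 :> R.
Proof.
move=> s0; rewrite sumr_const -[_ *+ _]mulr_natr mulVf// pnatr_eq0 -lt0n.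
by rewrite card_gt0.
Qed.

Lemma bary_mid f s k : f \in facets T -> s != set0 -> s \subset f -> k \in f ->
  bary f k (mid s) = if k \in s then (#|s|%:R)^-1 else 0.
Proof.
move=> fT s0 sf kf.
by rewrite mid_comb (bary_comb rT (S := s) (c := fun=> (#|s|%:R)^-1))// sum_inv.
Qed.

Lemma flag_edge_wedge a b c (f := [set a; b; c]) : a != b -> a != c -> b != c ->
  f \in facets T ->
  wedge2 (bary f b) (bary f c) (edgemx 2 [:: mid [set a]; mid [set a; b]; mid f]) =
  6%:R^-1.
Proof.
move=> ab ac bc fT; rewrite /wedge2 !row_edgemx0 !row_edgemx1 /=.
have ne s x : x \in s -> s != set0 by move=> xs; apply/set0Pn; exists x.
have a1 : [set a] != set0 by apply: (ne _ a); rewrite inE.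
have a2 : [set a; b] != set0 by apply: (ne _ a); rewrite !inE eqxx.
have a3 : f != set0 by apply: (ne _ a); rewrite mem3 eqxx.
have sub1 : [set a] \subset f by rewrite sub1set mem3 eqxx.
have sub2 : [set a; b] \subset f by exact: subsetUl.
have bf : b \in f by rewrite mem3 eqxx orbT.
have cf : c \in f by rewrite mem3 eqxx !orbT.
rewrite !dlin_sub; try exact: affine_bary.
rewrite !bary_mid// bf cf !inE eqxx orbT (eq_sym b a) (eq_sym c a) (eq_sym c b).
rewrite (negbTE ab) (negbTE ac) (negbTE bc) /= cards2 ab cards3//.
have -> : true.+1%:R = 2%:R :> R by [].
by rewrite !subr0 mulr0 subr0 -invfM -natrM.
Qed.

Lemma facet_ordl (M : mesh R N) (oM : ordered M) (x y v : node M) : x != y -> x != v -> y != v ->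
  [set x; y; v] \in facets M -> forall (F : node M -> node M -> node M -> R),
  (forall x y v, F y x v = - F x y v) -> (forall x y v, F x v y = - F x y v) ->
  exists s0 s1 s2 : node M, ord [set x; y; v] = [:: s0; s1; s2] /\
    F s0 s1 s2 = sgn3 x y v * F x y v.
Proof.
move=> xy xv yv KM F F1 F2.
have [s0 [s1 [s2 [oE FE _]]]] := alternating3 x F1 F2 xy xv yv (ord_facet oM xy xv yv KM).
by exists s0, s1, s2; split.
Qed.

Lemma orn_refined z f : z \in facets T' -> f \in facets T -> f \in z ->
  orn z = orient f (edgemx 2 (vert z)).
Proof.
move=> zT fT fz; rewrite /= (big_pred1 f)// => u /=; apply/andP/eqP => [[uT uz]|->//].
have [a [b [c [ab ac bc KT zE]]]] := facet_flag zT.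
have cf := reg_card rT fT; have cu := reg_card rT uT.
have h s : s \in z -> #|s| = 3%N -> s = [set a; b; c].
  by rewrite zE mem3 => /or3P[]/eqP->//; rewrite ?cards1 ?cards2 ?ab.
by rewrite (h u) // (h f).
Qed.

(** The refinement of abc at the flag (a, ab, abc) has the orientation of abc. *)
Lemma orient_flag a b c (f := [set a; b; c]) (z := flag a b c) :
  a != b -> a != c -> b != c -> f \in facets T ->
  orn z = orn3 a b c * sgn3 ([set a] : node T') [set a; b] [set a; b; c] /\
  row_free (edgemx 2 (vert z)).
Proof.
move=> ab ac bc fT; have zT := flag_facet ab ac bc fT.
have fz : f \in z by rewrite mem3 eqxx !orbT.
rewrite (orn_refined zT fT fz).
have [n1 n2 n3] := flag_neq ab ac bc.
pose F (x y v : node T') :=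
  wedge2 (bary f b) (bary f c) (edgemx 2 [:: pos x; pos y; pos v]).
have tw : two_form (wedge2 (bary f b) (bary f c)).
  by apply: two_form_wedge2; exact: affine_bary.
have F1 (x y v : node T') : F y x v = - F x y v by exact: two_form_swap01.
have F2 (x y v : node T') : F x v y = - F x y v by exact: two_form_swap12.
have [s0 [s1 [s2 [oz FE]]]] := facet_ordl ordered_refined n1 n2 n3 zT F1 F2.
have WE : wedge2 (bary f b) (bary f c) (edgemx 2 (vert z)) =
    sgn3 ([set a] : node T') [set a; b] [set a; b; c] * 6%:R^-1.
  rewrite -(flag_edge_wedge ab ac bc fT) (vertE oz) -/(F s0 s1 s2) FE.
  by [].
have [-> rf] := orient_nodes rT (edgemx 2 (vert z)) ab ac bc fT.
split; last first.
  apply: rf; rewrite WE mulf_neq0// ?invr_eq0 ?pnatr_eq0//.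
  apply/eqP => s0'; have := sgn3_sqr ordered_refined n1 n2 n3 zT.
  by rewrite s0' mul0r => /eqP; rewrite eq_sym oner_eq0.
by rewrite WE sg_sgn3 ?gtr0_sg ?mulr1 ?invr_gt0 ?ltr0n//; exact: ordered_refined.
Qed.

Lemma orn3_flag a b c : a != b -> a != c -> b != c -> [set a; b; c] \in facets T ->
  orn3 ([set a] : node T') [set a; b] [set a; b; c] = orn3 a b c.
Proof.
move=> ab ac bc fT; have [n1 n2 n3] := flag_neq ab ac bc.
rewrite {1}/orn3 -/(flag a b c) (orient_flag ab ac bc fT).1 -mulrA.
by rewrite (sgn3_sqr ordered_refined n1 n2 n3 (flag_facet ab ac bc fT)) mulr1.
Qed.

End Refined.

(** * The barycentric refinement is a mesh of the same surface *)

Section Third.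
Variables (R : realType) (N : nat) (M : mesh R N).
Hypothesis oM : ordered M.

Lemma set3_inj (x y u v : node M) : x != u -> y != u -> [set x; y; u] = [set x; y; v] -> u = v.
Proof.
move=> xu yu h; have : u \in [set x; y; v] by rewrite -h mem3 eqxx !orbT.
by rewrite mem3 eq_sym (negbTE xu) eq_sym (negbTE yu) => /eqP.
Qed.

Lemma orn_incid_sum (x y : node M) : x != y ->
  \sum_(K in facets M | [set x; y] \subset K) orn K * incid [set x; y] K =
  sgn2 x y * \sum_(v | [&& x != v, y != v & [set x; y; v] \in facets M]) orn3 x y v.
Proof.
move=> xy.
pose D := [set v | [&& x != v, y != v & [set x; y; v] \in facets M]].
have -> : \sum_(K in facets M | [set x; y] \subset K) orn K * incid [set x; y] K =
    \sum_(K in [set [set x; y; v] | v in D]) orn K * incid [set x; y] K.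
  apply: eq_bigl => K; apply/andP/imsetP => [[KM sub]|[v]].
    have xK : x \in K by apply: (subsetP sub); rewrite !inE eqxx.
    have yK : y \in K by apply: (subsetP sub); rewrite !inE eqxx orbT.
    have [v [xv yv KE]] := card3_from2 (reg_card oM KM) xK yK xy.
    by exists v => //; rewrite inE xv yv -KE.
  by rewrite inE => /and3P[xv yv KM] ->; rewrite KM subsetUl.
rewrite big_imset/=; last first.
  by move=> u v; rewrite !inE => /and3P[xu yu _] _; exact: set3_inj.
rewrite mulr_sumr; apply: eq_big => [v|v]; first by rewrite inE.
by rewrite inE => /and3P[xv yv KM]; exact: orn_incid.
Qed.

End Third.

Section RefinedRegular.
Variables (R : realType) (N : nat) (T : bc_mesh R N).
Hypothesis rT : regular T.
Hypothesis oR : cell_orders (refined T).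
Local Notation V := 'rV[R]_N.
Local Notation T' := (refined T).
Implicit Types (a b c k : node T) (s u e f : {set node T}) (z w : {set node T'}).
Let oT' : ordered T' := ordered_refined oR.

Lemma mem_flag1 a a' b' c' : a' != b' -> a' != c' -> b' != c' ->
  ([set a] : node T') \in flag a' b' c' -> a = a'.
Proof.
move=> ab ac bc; rewrite mem3 => /or3P[]/eqP h.
- by apply/set1P; rewrite -h inE.
- by have := congr1 (fun s : {set node T} => #|s|) h; rewrite cards1 cards2 ab.
- by have := congr1 (fun s : {set node T} => #|s|) h; rewrite cards1 cards3.
Qed.

Lemma mem_flag2 a b a' b' c' : a != b -> a' != b' -> a' != c' -> b' != c' ->
  ([set a; b] : node T') \in flag a' b' c' -> [set a; b] = [set a'; b'].
Proof.
move=> nab ab ac bc; rewrite mem3 => /or3P[]/eqP h //.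
- by have := congr1 (fun s : {set node T} => #|s|) h; rewrite cards1 cards2 nab.
- by have := congr1 (fun s : {set node T} => #|s|) h; rewrite cards2 cards3// nab.
Qed.

Lemma mem_flag3 f a' b' c' : f \in facets T -> a' != b' -> a' != c' -> b' != c' ->
  (f : node T') \in flag a' b' c' -> f = [set a'; b'; c'].
Proof.
move=> fT ab ac bc; have f3 := reg_card rT fT; rewrite mem3 => /or3P[]/eqP h //.
- by move: f3; rewrite h cards1.
- by move: f3; rewrite h cards2 ab.
Qed.

Lemma flag_of_edge z a b : z \in facets T' -> a != b ->
  ([set a] : node T') \in z -> ([set a; b] : node T') \in z ->
  exists c, [/\ a != c, b != c, [set a; b; c] \in facets T & z = flag a b c].
Proof.
move=> zT ab; have [a' [b' [c' [ab' ac' bc' fT ->]]]] := facet_flag rT zT.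
move=> /(mem_flag1 ab' ac' bc') aa'; subst a' => /(mem_flag2 ab ab' ac' bc') e.
have bb' : b = b'.
  have : b \in [set a; b'] by rewrite -e !inE eqxx orbT.
  by rewrite !inE eq_sym (negbTE ab) => /eqP.
by subst b'; exists c'.
Qed.

Lemma flag_of_corner z a f : z \in facets T' -> f \in facets T ->
  ([set a] : node T') \in z -> (f : node T') \in z ->
  exists b c, [/\ a != b, a != c, b != c, f = [set a; b; c] & z = flag a b c].
Proof.
move=> zT fT; have [a' [b' [c' [ab' ac' bc' fT' ->]]]] := facet_flag rT zT.
move=> /(mem_flag1 ab' ac' bc') aa'; subst a' => /(mem_flag3 fT ab' ac' bc') fE.
by exists b', c'.
Qed.

Lemma flag_of_link z a b f : z \in facets T' -> a != b -> f \in facets T ->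
  ([set a; b] : node T') \in z -> (f : node T') \in z ->
  exists c, [/\ a != c, b != c, f = [set a; b; c] & z = flag a b c \/ z = flag b a c].
Proof.
move=> zT ab fT; have [a' [b' [c' [ab' ac' bc' fT' ->]]]] := facet_flag rT zT.
move=> /(mem_flag2 ab ab' ac' bc') e /(mem_flag3 fT ab' ac' bc') fE.
have : a' \in [set a; b] by rewrite e !inE eqxx.
have : b' \in [set a; b] by rewrite e !inE eqxx orbT.
rewrite !inE => /orP[]/eqP E1 /orP[]/eqP E2; subst b'.
- by move: ab'; rewrite E2 eqxx.
- by subst a'; exists c'; split=> //; [rewrite fE set3C12|right].
- by subst a'; exists c'; split=> //; left.
- by move: ab'; rewrite E2 eqxx.
Qed.

Lemma flag_swap23 a b c z : a != b -> a != c -> b != c ->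
  [set a; b; c] \in facets T -> z \in facets T' ->
  ([set a] : node T') \in z -> ([set a; b; c] : node T') \in z ->
  z = flag a b c \/ z = flag a c b.
Proof.
move=> ab ac bc fT zT az fz.
have [b' [c' [ab' ac' bc' fE zE]]] := flag_of_corner zT fT az fz.
have bf : b \in [set a; b'; c'] by rewrite -fE mem3 eqxx orbT.
have cf : c \in [set a; b'; c'] by rewrite -fE mem3 eqxx !orbT.
move: bf cf; rewrite !mem3 ![_ == a]eq_sym (negbTE ab) (negbTE ac) /=.
move=> /orP[]/eqP E1 /orP[]/eqP E2.
- by move: bc; rewrite E1 E2 eqxx.
- by left; rewrite E1 E2.
- by right; rewrite E1 E2.
- by move: bc; rewrite E1 E2 eqxx.
Qed.

Lemma refined_edge w : w \in cells T' 1 -> exists a b c,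
  [/\ a != b, a != c, b != c, [set a; b; c] \in facets T &
   [\/ w = [set ([set a] : node T'); [set a; b]],
       w = [set ([set a] : node T'); [set a; b; c]] |
       w = [set ([set a; b] : node T'); [set a; b; c]]]].
Proof.
move=> /cellP[w2 [z zT wz]].
have [a [b [c [ab ac bc fT zE]]]] := facet_flag rT zT.
exists a, b, c; split=> //.
have [x [y [xy wE]]] := subset_card2 w2.
have : x \in z by apply: (subsetP wz); rewrite wE !inE eqxx.
have : y \in z by apply: (subsetP wz); rewrite wE !inE eqxx orbT.
rewrite zE !mem3 wE => /or3P[]/eqP yE /or3P[]/eqP xE; subst x y; rewrite ?eqxx// in xy *;
  by [apply: Or31|apply: Or32|apply: Or33|rewrite setUC; apply: Or31|
      rewrite setUC; apply: Or32|rewrite setUC; apply: Or33].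
Qed.

(** The two triangles at half of an edge of T are in the two facets at that
    edge.  At the other edges of the refinement they lie in one facet, and
    the two flags differ by an exchange of two nodes. *)
Lemma coherent_refined w : w \in cells T' 1 -> ~~ on_bd (facets T') w ->
  \sum_(z in facets T' | w \subset z) orn z * incid w z = 0.
Proof.
move=> wT nbd; have [a [b [c [ab ac bc fT wE]]]] := refined_edge wT.
have [n1 n2 n3] := flag_neq ab ac bc.
have acb : [set a; c; b] \in facets T by rewrite set3C23.
have bac : [set b; a; c] \in facets T by rewrite set3C12.
have ba : b != a by rewrite eq_sym.
have ca : c != a by rewrite eq_sym.
have cb : c != b by rewrite eq_sym.
have zT := flag_facet ab ac bc fT.
have zT1 := flag_facet ac ab cb acb.
have zT2 := flag_facet ba bc ac bac.
have [m1 m2 m3] := flag_neq ac ab cb.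
have [l1 l2 l3] := flag_neq ba bc ac.
case: wE => wE; rewrite wE (orn_incid_sum oT')//.
- rewrite (_ : \sum_(v | _) _ = 0) ?mulr0//.
  pose D := [set d | [&& a != d, b != d & [set a; b; d] \in facets T]].
  transitivity (\sum_(d in D) orn3 a b d).
    transitivity (\sum_(v in [set ([set a; b; d] : node T') | d in D])
        orn3 ([set a] : node T') [set a; b] v).
      apply: eq_bigl => v; apply/and3P/imsetP => [[v1 v2 vT]|[d]].
        have az : ([set a] : node T') \in [set ([set a] : node T'); [set a; b]; v].
          by rewrite mem3 eqxx.
        have ez : ([set a; b] : node T') \in [set ([set a] : node T'); [set a; b]; v].
          by rewrite mem3 eqxx orbT.
        have [d [ad bd dT zE]] := flag_of_edge vT ab az ez.
        exists d; first by rewrite inE ad bd.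
        exact: (set3_inj v1 v2 zE).
      rewrite inE => /and3P[ad bd dT] ->.
      have [d1 d2 d3] := flag_neq ab ad bd.
      by split=> //; exact: (flag_facet ab ad bd dT).
    rewrite big_imset/=; last first.
      by move=> d d'; rewrite !inE => /and3P[ad bd _] _; exact: set3_inj.
    apply: eq_bigr => d; rewrite inE => /and3P[ad bd dT].
    exact: orn3_flag.
  have abT : [set a; b] \in cells T 1 by exact: (facet_edge ab fT).
  have nb : ~~ on_bd (facets T) [set a; b].
    rewrite (on_bd_edge rT) ?cards2 ?ab//; apply: contra nbd => /(bdP rT)[_ [K [KT abK uK]]].
    rewrite (on_bd_edge oT'); last by rewrite wE cards2 n1.
    apply: (mem_bd oT' (K := flag a b c)) => //; first by rewrite wE cards2 n1.
      by rewrite wE; exact: subsetUl.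
    move=> z' z'T; rewrite wE => /subsetP sub.
    have [d [ad bd dT ->]] : exists d, [/\ a != d, b != d, [set a; b; d] \in facets T & z' = flag a b d].
      by apply: flag_of_edge => //; apply: sub; rewrite !inE eqxx ?orbT.
    have e1 := uK _ dT (subsetUl _ _); have e2 := uK _ fT (subsetUl _ _).
    by rewrite (set3_inj ad bd (etrans e1 (esym e2))).
  have := reg_coherent rT abT nb; rewrite (orn_incid_sum rT ab).
  have s0 : sgn2 a b != 0.
    apply/eqP => h; have := sgn2_sqr rT ab abT.
    by rewrite h mul0r => /eqP; rewrite eq_sym oner_eq0.
  move=> /eqP; rewrite mulf_eq0 (negbTE s0)/= => /eqP h; rewrite -[RHS]h.
  by apply: eq_bigl => d; rewrite inE.
- rewrite (bigD1 ([set a; b] : node T'))/=; last first.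
    by rewrite n1 eq_sym n3/= set3C23.
  rewrite (bigD1 ([set a; c] : node T'))/=; last first.
    rewrite m1 /= -{1}(set3C23 a b c) (eq_sym [set a; c; b]) m3 /=.
    rewrite set3C23 -{1}(set3C23 a b c) [X in X && _]zT1 /=.
    apply/eqP => /setP/(_ c); rewrite !inE (eq_sym c) (negbTE ac) eqxx /= (eq_sym c).
    by rewrite (negbTE bc).
  rewrite big_pred0 ?addr0; last first.
    move=> v; apply/negP => /andP[/andP[/and3P[v1 v2 vT] vb] vc].
    have az : ([set a] : node T') \in [set ([set a] : node T'); [set a; b; c]; v].
      by rewrite mem3 eqxx.
    have fz : ([set a; b; c] : node T') \in [set ([set a] : node T'); [set a; b; c]; v].
      by rewrite mem3 eqxx orbT.
    have vz : v \in [set ([set a] : node T'); [set a; b; c]; v] by rewrite mem3 eqxx !orbT.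
    have [zE|zE] := flag_swap23 ab ac bc fT vT az fz; move: vz; rewrite zE mem3.
      by rewrite (negbTE vb) ![v == _]eq_sym (negbTE v1) (negbTE v2).
    by rewrite (negbTE vc) set3C23 ![v == _]eq_sym (negbTE v1) (negbTE v2).
  rewrite (orn3C23 oT' n1 n2 n3 zT) (orn3_flag rT oR ab ac bc fT).
  have := orn3_flag rT oR ac ab cb acb; have := orn3C23 oT' m1 m2 m3 zT1.
  rewrite (set3C23 a b c) => -> ->.
  by rewrite (orn3C23 rT ab ac bc fT) opprK subrr mulr0 || rewrite (orn3C23 rT ab ac bc fT); ring.
- have zT2' : [set ([set a; b] : node T'); [set a; b; c]; [set b]] \in facets T'.
    move: zT2; rewrite /flag (set3_rot ([set b; a] : node T') [set b; a; c] [set b]).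
    by rewrite (set3C12 a b c) [[set b; a]]setUC.
  rewrite (bigD1 ([set a] : node T'))/=; last first.
    by rewrite (eq_sym [set a; b]) n1 (eq_sym [set a; b; c]) n2 /= -set3_rot.
  rewrite (bigD1 ([set b] : node T'))/=; last first.
    move: l1 l2; rewrite (set3C12 a b c) [[set b; a]]setUC => l1 l2.
    rewrite (eq_sym [set a; b]) l1 (eq_sym [set a; b; c]) l2 /=.
    rewrite zT2' /=.
    by apply/eqP => /set1_inj /eqP; rewrite eq_sym (negbTE ab).
  rewrite big_pred0 ?addr0; last first.
    move=> v; apply/negP => /andP[/andP[/and3P[v1 v2 vT] va] vb].
    have ez : ([set a; b] : node T') \in [set ([set a; b] : node T'); [set a; b; c]; v].
      by rewrite mem3 eqxx.
    have fz : ([set a; b; c] : node T') \in [set ([set a; b] : node T'); [set a; b; c]; v].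
      by rewrite mem3 eqxx orbT.
    have vz : v \in [set ([set a; b] : node T'); [set a; b; c]; v] by rewrite mem3 eqxx !orbT.
    have [d [_ _ dE zE]] := flag_of_link vT ab fT ez fz.
    case: zE => zE; move: vz; rewrite zE mem3.
      by rewrite (negbTE va) -dE ![v == _]eq_sym (negbTE v1) (negbTE v2).
    by rewrite (negbTE vb) (set3C12 a b d) -dE [[set b; a]]setUC ![v == _]eq_sym (negbTE v1) (negbTE v2).
  have zT' : [set ([set a; b] : node T'); [set a; b; c]; [set a]] \in facets T'.
    by move: zT; rewrite /flag (set3_rot ([set a; b] : node T') [set a; b; c] [set a]).
  have n1' : ([set a; b] : node T') != [set a] by rewrite eq_sym.
  have n2' : ([set a; b; c] : node T') != [set a] by rewrite eq_sym.
  move: (l1) (l2); rewrite (set3C12 a b c) [[set b; a]]setUC => k1 k2.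
  have l1' : ([set a; b] : node T') != [set b] by rewrite eq_sym.
  have l2' : ([set a; b; c] : node T') != [set b] by rewrite eq_sym.
  rewrite -(orn3_rot oT' n3 n1' n2' zT') -(orn3_rot oT' n3 l1' l2' zT2').
  rewrite (orn3_flag rT oR ab ac bc fT).
  have := orn3_flag rT oR ba bc ac bac; rewrite (set3C12 a b c) [[set b; a]]setUC.
  move=> ->; rewrite (orn3C12 rT ab ac bc fT) subrr mulr0 //.
Qed.

Lemma facet_top z : z \in facets T' -> exists2 f, f \in facets T & (f : node T') \in z.
Proof.
move=> /(facet_flag rT)[a [b [c [ab ac bc fT ->]]]].
by exists [set a; b; c] => //; rewrite mem3 eqxx !orbT.
Qed.

Lemma flag_sub z f (s : node T') : z \in facets T' -> f \in facets T -> (f : node T') \in z ->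
  s \in z -> (s : {set node T}) != set0 /\ (s : {set node T}) \subset f.
Proof.
move=> zT fT; have [a [b [d [ab ad bd gT ->]]]] := facet_flag rT zT.
move=> /(mem_flag3 fT ab ad bd) ->.
have ne u : a \in u -> u != set0 by move=> au; apply/set0Pn; exists a.
rewrite mem3 => /or3P[]/eqP->; split.
- by apply: ne; rewrite inE.
- by rewrite sub1set mem3 eqxx.
- by apply: ne; rewrite !inE eqxx.
- exact: subsetUl.
- by apply: ne; rewrite mem3 eqxx.
- exact: subxx.
Qed.

Lemma hat_flag z f (c : node T' -> R) k : f \in facets T -> (f : node T') \in z ->
  z \in facets T' ->
  \sum_(s in z) c s = 1 -> hat k f (\sum_(s in z) c s *: pos s) =
  \sum_(s in z) c s * (if k \in (s : {set node T}) then (#|(s : {set node T})|%:R)^-1 else 0).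
Proof.
move=> fT fz zT c1.
rewrite (affine_comb _ (affine_hat _ _) c1); apply: eq_bigr => s sz; congr (_ * _).
have [s0 sf] := flag_sub zT fT fz sz; rewrite posE /hat fT /=; case: ifPn => kf.
  by rewrite (bary_mid rT fT s0 sf kf).
by case: ifPn => // ks; move/negP: kf; case; exact: (subsetP sf).
Qed.

Lemma simplex_top_comb z f (c : node T' -> R) : z \in facets T' -> f \in facets T ->
  (f : node T') \in z -> \sum_(s in z) c s = 1 ->
  in_plane f (\sum_(s in z) c s *: pos s).
Proof.
move=> zT fT fz c1.
pose g k := \sum_(s in z) c s *
   (if k \in (s : {set node T}) then (#|(s : {set node T})|%:R)^-1 else 0).
have ex (W : lmodType R) (F : node T -> W) :
    \sum_(k in f) g k *: F k =
    \sum_(s in z) c s *: \sum_(k in (s : {set node T})) (#|(s : {set node T})|%:R)^-1 *: F k.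
  rewrite (eq_bigr (fun k => \sum_(s in z) (c s *
     (if k \in (s : {set node T}) then (#|(s : {set node T})|%:R)^-1 else 0)) *: F k)); last first.
    by move=> k _; rewrite /g scaler_suml.
  rewrite exchange_big/=; apply: eq_bigr => s sz; rewrite scaler_sumr.
  have [s0 /subsetP sf] := flag_sub zT fT fz sz.
  rewrite [LHS](bigID (fun k => k \in (s : {set node T})))/= [X in _ + X]big1 ?addr0; last first.
    by move=> k /andP[_ /negbTE ->]; rewrite mulr0 scale0r.
  apply: eq_big => [k|k /andP[_ ->]]; last by rewrite scalerA.
  by apply: andb_idl; exact: sf.
rewrite (_ : \sum_(s in z) c s *: pos s = \sum_(k in f) g k *: pos k).
  apply: (in_plane_comb rT fT); transitivity (\sum_(k in f) g k *: (1 : R^o)).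
    by apply: eq_bigr => k _; rewrite [RHS]mulr1.
  rewrite ex -[RHS]c1; apply: eq_bigr => s sz; have [s0 _] := flag_sub zT fT fz sz.
  rewrite [X in _ *: X](_ : _ = 1); first exact: mulr1.
  by rewrite -[RHS](sum_inv (R := R) s0); apply: eq_bigr => k _; exact: mulr1.
rewrite ex; apply: eq_bigr => s _; congr (_ *: _); exact: mid_comb.
Qed.

Lemma hat_flag_ge0 z f (c : node T' -> R) k : (forall s, s \in z -> 0 <= c s) ->
  0 <= \sum_(s in z) c s * (if k \in (s : {set node T}) then (#|(s : {set node T})|%:R)^-1 else 0).
Proof.
move=> c0; apply: sumr_ge0 => s sz; apply: mulr_ge0; first exact: c0.
by case: ifP => // _; rewrite invr_ge0 ler0n.
Qed.

Lemma simplex_top z f x : z \in facets T' -> f \in facets T -> (f : node T') \in z ->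
  simplex z x -> simplex f x.
Proof.
move=> zT fT fz [c [c0 c1 ->]]; apply/(facetP rT _ fT).
split; first exact: simplex_top_comb.
move=> k kf; have := hat_flag k fT fz zT c1; rewrite /hat fT kf /= => ->.
exact: (hat_flag_ge0 f k c0).
Qed.

Lemma open_simplex_top z f x : z \in facets T' -> f \in facets T -> (f : node T') \in z ->
  open_simplex z x -> open_simplex f x.
Proof.
move=> zT fT fz [c [c0 c1 ->]]; apply/(open_simplexP rT _ fT).
split; first exact: simplex_top_comb.
move=> k kf; have := hat_flag k fT fz zT c1; rewrite /hat fT kf /= => ->.
rewrite (bigD1 (f : node T'))//= kf; apply: ltr_pwDl.
  apply: mulr_gt0; first exact: c0.
  by rewrite invr_gt0 ltr0n (reg_card rT fT).
apply: sumr_ge0 => s /andP[sz _]; apply: mulr_ge0; first by rewrite ltW// c0.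
by case: ifP => // _; rewrite invr_ge0 ler0n.
Qed.

Lemma refined_chain z (s u : node T') : z \in facets T' -> s \in z -> u \in z ->
  ((s : {set node T}) \subset u) || ((u : {set node T}) \subset s).
Proof.
rewrite inE => /and3P[_ _ /forallP h] sz uz.
by move/implyP: (h s) => /(_ sz)/forallP/(_ u)/implyP; exact.
Qed.

Lemma flag_rank z (s : node T') : z \in facets T' -> (0 < #|(s : {set node T})| < 4)%N ->
  exists2 u : node T', u \in z & #|(u : {set node T})| = #|(s : {set node T})|.
Proof.
move=> /(facet_flag rT)[a [b [c [ab ac bc fT ->]]]].
case: (#|_|) => [|[|[|[|]]]]//= _.
- by exists [set a]; rewrite ?cards1// mem3 eqxx.
- by exists [set a; b]; rewrite ?cards2 ?ab// mem3 eqxx orbT.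
- by exists [set a; b; c]; rewrite ?cards3// mem3 eqxx !orbT.
Qed.

(** The node s of a flag has positive weight at x only if the barycentric
    coordinates of x are larger on the vertices of s than on all others; this
    determines s from x and its size. *)
Lemma refined_inter z z' : z \in facets T' -> z' \in facets T' ->
  (simplex z `&` simplex z' `<=` simplex (z :&: z')%SET)%classic.
Proof.
move=> zT zT' x [xz xz'].
have [f fT fz] := facet_top zT; have [f' fT' fz'] := facet_top zT'.
have xf := simplex_top zT fT fz xz; have xf' := simplex_top zT' fT' fz' xz'.
have [c [c0 c1 xc]] := xz; have [c' [c0' c1' xc']] := xz'.
(* if the element u of z' of the size of s were different from s, some vertices
   i of s and j of u would have coordinates in the wrong order *)
have hz (s : node T') : s \in z -> 0 < c s -> s \in z'.
  move=> sz cs; have [s0 sf] := flag_sub zT fT fz sz.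
  have s4 : (0 < #|(s : {set node T})| < 4)%N.
    by rewrite card_gt0 s0 ltnS -(reg_card rT fT) subset_leq_card.
  have [u uz us] := flag_rank zT' s4.
  have [<-//|us'] := eqVneq (u : {set node T}) s.
  have /subsetPn[i si iu] : ~~ ((s : {set node T}) \subset u).
    by apply: contra us' => h; rewrite eq_sym eqEcard h us leqnn.
  have /subsetPn[j ju js] : ~~ ((u : {set node T}) \subset s).
    by apply: contra us' => h; rewrite eqEcard h us leqnn.
  have hi : hat i f x = hat i f' x by apply: (hat_agree rT).
  have hj : hat j f x = hat j f' x by apply: (hat_agree rT).
  have : hat j f x < hat i f x.
    rewrite xc !(hat_flag _ fT fz zT c1) -subr_gt0 -sumrB (bigD1 s)//=.
    apply: ltr_pwDl.
      rewrite si (negbTE js) mulr0 subr0 mulr_gt0// invr_gt0 ltr0n card_gt0.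
      by apply/set0Pn; exists i.
    apply: sumr_ge0 => v /andP[vz vs]; rewrite -mulrBr; apply: mulr_ge0; first exact: c0.
    case/orP: (refined_chain zT vz sz) => h.
      have -> : j \in (v : {set node T}) = false.
        by apply/negP => jv; move/negP: js; apply; exact: (subsetP h).
      by case: ifP; rewrite subr0// invr_ge0 ler0n.
    by rewrite (subsetP h i si); case: ifP; rewrite ?subrr ?subr0// invr_ge0 ler0n.
  have : hat i f' x <= hat j f' x.
    rewrite xc' !(hat_flag _ fT' fz' zT' c1') -subr_ge0 -sumrB.
    apply: sumr_ge0 => v vz; rewrite -mulrBr; apply: mulr_ge0; first exact: c0'.
    case/orP: (refined_chain zT' vz uz) => h.
      have -> : i \in (v : {set node T}) = false.
        by apply/negP => jv; move/negP: iu; apply; exact: (subsetP h).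
      by case: ifP; rewrite subr0// invr_ge0 ler0n.
    by rewrite (subsetP h j ju); case: ifP; rewrite ?subrr ?subr0// invr_ge0 ler0n.
  by rewrite -hi -hj leNgt => /negP.
have c00 (s : node T') : s \in z -> s \notin z' -> c s = 0.
  move=> sz sz'; apply/eqP; rewrite eq_le c0// andbT leNgt; apply/negP => cs.
  by move: sz'; rewrite hz.
exists c; split.
- by move=> s; rewrite inE => /andP[sz _]; exact: c0.
- rewrite -c1 [RHS](big_setID z')/= [X in _ + X]big1 ?addr0// => s.
  by rewrite !inE => /andP[sz' sz]; exact: c00.
- rewrite xc [LHS](big_setID z')/= [X in _ + X]big1 ?addr0// => s.
  by rewrite !inE => /andP[sz' sz]; rewrite c00// scale0r.
Qed.

Lemma regular_refined : regular T'.
Proof.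
split; [exact: oT'| |exact: refined_inter|exact: coherent_refined].
move=> z zT; have [a [b [c [ab ac bc fT ->]]]] := facet_flag rT zT.
exact: (orient_flag rT oR ab ac bc fT).2.
Qed.

Lemma surface_refined : surface T' = surface T.
Proof.
apply/seteqP; split=> x [K KT xK].
  by have [f fT fz] := facet_top KT; exists f => //; exact: (simplex_top KT fT fz xK).
have [a [b [c [ab ac bc KE [lab lbc]]]]] : exists a b c, [/\ a != b, a != c, b != c,
    K = [set a; b; c] & bary K b x <= bary K a x /\ bary K c x <= bary K b x].
  have [a [b [c [ab ac bc KE _]]]] := facet_ord rT KT.
  have ba : b != a by rewrite eq_sym.
  have ca : c != a by rewrite eq_sym.
  have cb : c != b by rewrite eq_sym.
  case: (leP (bary K b x) (bary K a x)) => h1; case: (leP (bary K c x) (bary K b x)) => h2;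
    case: (leP (bary K c x) (bary K a x)) => h3.
  - by exists a, b, c.
  - by move: (lt_le_trans h3 (le_trans h2 h1)); rewrite ltxx.
  - by exists a, c, b; split=> //; [rewrite set3C23|split=> //; exact: ltW].
  - by exists c, a, b; split=> //; [rewrite set3_rot|split=> //; exact: ltW].
  - by exists b, a, c; split=> //; [rewrite set3C12|split=> //; exact: ltW].
  - by exists b, c, a; split=> //; [rewrite -set3_rot|split=> //; exact: ltW].
  - by move: (lt_trans h1 (lt_le_trans h2 h3)); rewrite ltxx.
  - by exists c, b, a; split=> //; [rewrite set3C13|split; exact: ltW].
have fT : [set a; b; c] \in facets T by rewrite -KE.
have [n1 n2 n3] := flag_neq ab ac bc.
exists (flag a b c); first exact: flag_facet.
have [xp x0] := (facetP rT x KT).1 xK.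
have aK : a \in K by rewrite KE mem3 eqxx.
have bK : b \in K by rewrite KE mem3 eqxx orbT.
have cK : c \in K by rewrite KE mem3 eqxx !orbT.
have s1 := sum_bary rT x KT; rewrite {1}KE big_set3// in s1.
have xE := in_plane_decomp rT KT xp; rewrite {1}KE big_set3// in xE.
pose g (s : node T') : R := if s == [set a] then bary K a x - bary K b x
  else if s == [set a; b] then 2%:R * (bary K b x - bary K c x) else 3%:R * bary K c x.
exists g; rewrite /flag !big_set3// /g !eqxx (eq_sym [set a; b]) (negbTE n1).
rewrite (eq_sym [set a; b; c] [set a]) (negbTE n2) (eq_sym [set a; b; c] [set a; b]) (negbTE n3).
split.
- move=> s _; case: ifP => _; first by rewrite subr_ge0.
  case: ifP => _; first by rewrite mulr_ge0 ?ler0n// subr_ge0.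
  by rewrite mulr_ge0 ?ler0n// x0.
- by rewrite -[RHS]s1; ring.
- rewrite !posE /mid cards1 cards2 ab cards3// big_set1 big_setU1 ?inE ?ab//= big_set1 big_set3//.
  have h2 : 2%:R != 0 :> R by rewrite pnatr_eq0.
  have h3 : 3%:R != 0 :> R by rewrite pnatr_eq0.
  have -> : true.+1%:R = 2%:R :> R by [].
  rewrite [LHS]xE; apply/rowP => j; rewrite !mxE; field.
  by [].
Qed.

(** A common interior point of L and z is interior to the facet of T that
    contains z, and z has the orientation of that facet. *)
Lemma orient_compat (M : mesh R N) (oM : ordered M) (L : {set node M}) z :
  same_oriented_surface M T -> L \in facets M -> z \in facets T' ->
  (open_simplex L `&` open_simplex z !=set0)%classic ->
  orient L (edgemx 2 (vert z)) = orn z.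
Proof.
move=> [_ comp] LM zT [x [xL xz]]; have [f fT fz] := facet_top zT.
have xf := open_simplex_top zT fT fz xz.
have h : orient L (edgemx 2 (vert f)) = orn f by apply: comp => //; exists x.
rewrite (orn_refined rT zT fT fz).
have [D ->] : exists D : 'M[R]_2, edgemx 2 (vert z) = D *m edgemx 2 (vert f).
  apply/submxP/row_subP => i; rewrite edgemxE.
  have pz (s : node T') : s \in z -> in_plane f (pos s).
    move=> sz; have -> : pos s = \sum_(u in z) (u == s)%:R *: pos u.
      rewrite (bigD1 s sz) eqxx scale1r big1; first exact: esym (addr0 _).
      by move=> u /andP[_ /negbTE ->]; rewrite scale0r.
    apply: simplex_top_comb => //; rewrite (bigD1 s sz) eqxx big1; first exact: addr0.
    by move=> u /andP[_ /negbTE ->].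
  have [s0 [s1 [s2 [_ _ _ zE oz]]]] := facet_ord oT' zT.
  have -> : (vert z)`_i.+1 - (vert z)`_0 =
     ((vert z)`_i.+1 - (vert f)`_0) - ((vert z)`_0 - (vert f)`_0).
    by rewrite opprB addrA subrK.
  rewrite (vertE oz); apply: addmx_sub; last first.
    by rewrite eqmx_opp; apply: pz; rewrite zE mem3 eqxx.
  by case: i => -[|[|]]//= _; apply: pz; rewrite zE mem3 eqxx ?orbT.
by rewrite (orient_mulmx oM)// h (orient_edgemx rT)// mulrC.
Qed.

End RefinedRegular.

(** * Whitney forms *)

Section Whitney.
Variables (R : realType) (N : nat) (M : mesh R N).
Hypothesis rM : regular M.
Local Notation V := 'rV[R]_N.
Implicit Types (a b c v : node M) (K L e t : {set node M}).

Lemma lambda0E a : [set a] \in cells M 0 -> lambda 0 [set a] = fun K x _ => hat a K x.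
Proof.
move=> aM; apply/funext => K; apply/funext => x; apply/funext => E.
rewrite /lambda /hat sub1set (ord_node rM aM); case: ifP => // _.
by rewrite big_ord_recl big_ord0 det_mx00 /= fact0 expr0 !mul1r mulr1 addr0.
Qed.

(** Other than [lambda], this depends on the order of the nodes and not on the
    orientation of the cell. *)
Definition whitney1 a b : pform M 1 := fun K x E =>
  hat a K x * dlin (hat b K) (row 0 E) - hat b K x * dlin (hat a K) (row 0 E).

Lemma hat_out a K : a \notin K -> hat a K = fun=> 0.
Proof. by move=> aK; apply/funext => x; rewrite /hat (negbTE aK) andbF. Qed.

Lemma hat_in a K : K \in facets M -> a \in K -> hat a K = bary K a.
Proof. by move=> KM aK; apply/funext => x; rewrite /hat KM aK. Qed.

Lemma hat_nonfacet a K : K \notin facets M -> hat a K = fun=> 0.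
Proof. by move=> KM; apply/funext => x; rewrite /hat (negbTE KM). Qed.

Lemma dlin0 (x : V) : dlin (fun=> 0 : R) x = 0.
Proof. by rewrite /dlin subrr. Qed.

Lemma lambda1E a b : a != b -> [set a; b] \in cells M 1 ->
  lambda 1 [set a; b] = fun K x E => sgn2 a b * whitney1 a b K x E.
Proof.
move=> ab eM; apply/funext => K; apply/funext => x; apply/funext => E.
rewrite /lambda /whitney1; have [KM|KM] := boolP (K \in facets M); last first.
  by rewrite !hat_nonfacet// !dlin0 !mul0r subrr mulr0.
have [sub|sub] := boolP ([set a; b] \subset K); last first.
  rewrite /=; have : (a \notin K) || (b \notin K).
    rewrite -negb_and; apply: contra sub => /andP[aK bK].
    by apply/subsetP => u; rewrite !inE => /orP[]/eqP->.
  by case/orP => h; rewrite (hat_out h) !dlin0 ?mul0r ?mulr0 ?mul0r subrr mulr0.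
have aK : a \in K by apply: (subsetP sub); rewrite !inE eqxx.
have bK : b \in K by apply: (subsetP sub); rewrite !inE eqxx orbT.
rewrite andbT !hat_in// !big_ord_recl big_ord0 addr0 !det_mx11 !mxE.
have [oE|oE] := perm2P ab (ord_edge rM ab eM); rewrite /sgn2 oE perm_sign2.
  rewrite !eqxx (eq_sym b a) (negbTE ab) /= /bump /= expr0 expr1 /dlin /dbary.
  have -> : (1`!)%:R = 1 :> R by [].
  ring.
rewrite !eqxx (eq_sym b a) (negbTE ab) /= /bump /= expr0 expr1 /dlin /dbary.
have -> : (1`!)%:R = 1 :> R by [].
ring.
Qed.

Definition whitney2 a b c : pform M 2 := fun K x E =>
  2%:R * (hat a K x * wedge2 (hat b K) (hat c K) E - hat b K x * wedge2 (hat a K) (hat c K) E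
          + hat c K x * wedge2 (hat a K) (hat b K) E).

Lemma lambda2E a b c : a != b -> a != c -> b != c -> [set a; b; c] \in facets M ->
  lambda 2 [set a; b; c] = fun K x E => sgn3 a b c * whitney2 a b c K x E.
Proof.
move=> ab ac bc KM; apply/funext => K; apply/funext => x; apply/funext => E.
rewrite /lambda; have [K'M|K'M] := boolP (K \in facets M); last first.
  by rewrite /whitney2 !hat_nonfacet// !mul0r subrr addr0 !mulr0.
have [sub|sub] := boolP ([set a; b; c] \subset K); last first.
  have : [|| a \notin K, b \notin K | c \notin K].
    rewrite -!negb_and; apply: contra sub => /and3P[aK bK cK].
    by apply/subsetP => u; rewrite mem3 => /or3P[]/eqP->.
  by rewrite /= /whitney2 /wedge2; case/or3P => h; rewrite (hat_out h) !dlin0; ring.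
pose F x0 x1 x2 := whitney2 x0 x1 x2 K x E.
have F1 u v w : F v u w = - F u v w by rewrite /F /whitney2 /wedge2; ring.
have F2 u v w : F u w v = - F u v w by rewrite /F /whitney2 /wedge2; ring.
have [s0 [s1 [s2 [oE FE _]]]] := alternating3 a F1 F2 ab ac bc (ord_facet rM ab ac bc KM).
rewrite -[RHS]FE oE /F /whitney2 /=.
have inK u : u \in [:: s0; s1; s2] -> u \in K.
  rewrite -oE (perm_mem (ord_facet rM ab ac bc KM)) !inE => h.
  by apply: (subsetP sub); rewrite mem3.
rewrite !hat_in ?inK ?inE ?eqxx ?orbT//.
rewrite !big_ord_recl big_ord0 addr0 !det2 !mxE /= /bump /= /wedge2 /dlin /dbary.
have -> : (2`!)%:R = 2%:R :> R by [].
rewrite expr0 expr1 expr2; ring.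
Qed.

Lemma sum_hat a b c K x : K = [set a; b; c] -> a != b -> a != c -> b != c -> K \in facets M ->
  hat a K x + hat b K x + hat c K x = 1.
Proof.
move=> KE ab ac bc KM; rewrite !hat_in ?KE ?mem3 ?eqxx ?orbT -?KE//.
by rewrite -[RHS](sum_bary rM x KM) [in RHS]KE big_set3// -KE.
Qed.

Lemma sum_dhat a b c K x : K = [set a; b; c] -> a != b -> a != c -> b != c -> K \in facets M ->
  dlin (hat c K) x = - dlin (hat a K) x - dlin (hat b K) x.
Proof.
move=> KE ab ac bc KM.
have h1 := sum_hat x KE ab ac bc KM; have h2 := sum_hat 0 KE ab ac bc KM.
rewrite /dlin; move: h1 h2.
move: (hat a K x) (hat b K x) (hat c K x) (hat a K 0) (hat b K 0) (hat c K 0) => *; lra.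
Qed.

(** The difference quotients are constant. *)
Lemma derive_affine (f : V -> R) (v x : V) : affine_fun f ->
  'D_v (f : V -> R^o) x = dlin f v.
Proof.
move=> af; rewrite /derive; apply: cvg_lim => //.
apply: (@cvg_trans _ (cst (dlin f v : R^o) @ (0 : R)^')%classic).
  apply: near_eq_cvg; near=> h.
  have h0 : h != 0 by near: h; exact: nbhs_dnbhs_neq.
  rewrite /= (affineE af) addrK /GRing.scale /= mulrA mulVf// mul1r //.
exact: cvg_cst.
Unshelve. all: by end_near. Qed.

(** Whitney forms have this property, which makes their derivatives finite
    differences and their products tame. *)
Definition affine_form r (w : pform M r) : Prop := forall K E, affine_fun (fun x => w K x E).

Lemma extdE r (w : pform M r) K x E : affine_form w ->
  extd w K x E = \sum_(k < r.+1) (-1) ^+ k * dlin (fun y => w K y (row' k E)) (row k E).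
Proof. by move=> aw; rewrite /extd; apply: eq_bigr => k _; rewrite derive_affine. Qed.

Lemma affine_whitney1 a b : affine_form (whitney1 a b).
Proof.
move=> K E; rewrite /whitney1 (_ : (fun x => _) =
  fun x => dlin (hat b K) (row 0 E) * hat a K x + - (dlin (hat a K) (row 0 E) * hat b K x)).
  apply: affine_add; last apply: affine_opp; apply: affine_scale; exact: affine_hat.
by apply/funext => x; ring.
Qed.

Lemma extd_hat a : extd ((fun K x _ => hat a K x) : pform M 0) =
  fun K x (E : 'M[R]_(1, N)) => dlin (hat a K) (row 0 E).
Proof.
apply/funext => K; apply/funext => x; apply/funext => E.
rewrite extdE; last by move=> K' E'; exact: affine_hat.
by rewrite big_ord_recl big_ord0 addr0 expr0 mul1r.
Qed.

Lemma extd_whitney1 a b : extd (whitney1 a b) =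
  fun K x (E : 'M[R]_(2, N)) => 2%:R * wedge2 (hat a K) (hat b K) E.
Proof.
apply/funext => K; apply/funext => x; apply/funext => E.
rewrite extdE; last exact: affine_whitney1.
rewrite !big_ord_recl big_ord0 addr0 expr0 expr1 /whitney1 /wedge2.
have -> : row 0 (row' ord0 E) = row 1 E.
  by apply/rowP => j; rewrite !mxE; congr (E _ _); exact: val_inj.
have -> : row 0 (row' (lift ord0 ord0) E) = row 0 E.
  by apply/rowP => j; rewrite !mxE; congr (E _ _); exact: val_inj.
have -> : row (lift ord0 ord0) E = row 1 E.
  by congr row; exact: val_inj.
have -> : row ord0 E = row 0 E by [].
rewrite /dlin; ring.
Qed.

End Whitney.

(** * The exterior derivative of Whitney forms *)

Section EdgesAtNode.
Variables (R : realType) (N : nat) (M : mesh R N).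

Lemma sum_edges_at (v b c : node M) (F : {set node M} -> R) :
  v != b -> v != c -> b != c -> [set v; b; c] \in facets M ->
  (forall e, F e != 0 -> v \in e /\ e \subset [set v; b; c]) ->
  \sum_(e in cells M 1) F e = F [set v; b] + F [set v; c].
Proof.
move=> vb vc bc KM hF.
have vbM : [set v; b] \in cells M 1 := facet_edge vb KM.
have vcM : [set v; c] \in cells M 1.
  by apply: (facet_edge (c := b) vc); rewrite set3C23.
have nbc : [set v; c] != [set v; b].
  apply/eqP => h; have : c \in [set v; b] by rewrite -h !inE eqxx orbT.
  by rewrite !inE eq_sym (negbTE vc) eq_sym (negbTE bc).
rewrite (bigD1 [set v; b])//= (bigD1 [set v; c]) ?vcM//= big1 ?addr0//.
move=> e /andP[/andP[eM eb] ec]; apply/eqP; apply: contraTT isT => /hF[ve /subsetP eK].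
have /cellP[e2 _] := eM; have [x0 [y0 [xy eE]]] := subset_card2 e2.
have bad y : e = [set v; y] -> v != y -> False.
  move=> eE' vy; have : y \in [set v; b; c] by apply: eK; rewrite eE' !inE eqxx orbT.
  rewrite mem3 eq_sym (negbTE vy) /= => /orP[]/eqP yE.
    by rewrite eE' yE eqxx in eb.
  by rewrite eE' yE eqxx in ec.
move: ve; rewrite eE !inE => /orP[]/eqP vE; exfalso.
  by apply: (bad y0); rewrite vE.
by apply: (bad x0); rewrite vE; [rewrite eE setUC|rewrite eq_sym].
Qed.

End EdgesAtNode.

Section Differential.
Variables (R : realType) (N : nat) (M : mesh R N).
Hypothesis rM : regular M.
Local Notation V := 'rV[R]_N.
Implicit Types (a b c v : node M) (K L e s t : {set node M}).

Lemma lambda_out r t K x E : ~~ (t \subset K) -> lambda (R := R) (N := N) r t K x E = 0.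
Proof. by move=> tK; rewrite /lambda (negbTE tK) andbF. Qed.

Lemma lambda_nonfacet r t K x E : K \notin facets M -> lambda (R := R) (N := N) r t K x E = 0.
Proof. by move=> KM; rewrite /lambda (negbTE KM). Qed.

Lemma lambda1_at a b K x E : a != b -> [set a; b] \in cells M 1 ->
  lambda 1 [set a; b] K x E = sgn2 a b * whitney1 a b K x E.
Proof. by move=> ab eM; rewrite (lambda1E rM ab eM). Qed.

Lemma lambda2_at a b c K x E : a != b -> a != c -> b != c -> [set a; b; c] \in facets M ->
  lambda 2 [set a; b; c] K x E = sgn3 a b c * whitney2 a b c K x E.
Proof. by move=> ab ac bc KM; rewrite (lambda2E rM ab ac bc KM). Qed.

Lemma incid_sub s t : incid s t != 0 -> s \subset t /\ #|t| = #|s|.+1.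
Proof. by rewrite /incid; case: ifP => [/andP[? /eqP ?]|]; rewrite ?eqxx. Qed.

Lemma incid0 s t : ~~ (s \subset t) -> incid (R := R) (N := N) s t = 0.
Proof. by move=> st; rewrite /incid (negbTE st). Qed.

Lemma extd_lambda0 v : [set v] \in cells M 0 ->
  extd (lambda 0 [set v]) = fun K x E => \sum_(e in cells M 1) incid [set v] e * lambda 1 e K x E.
Proof.
move=> vM; rewrite (lambda0E rM vM) (extd_hat v).
apply/funext => K; apply/funext => x; apply/funext => E.
have [KM|KM] := boolP (K \in facets M); last first.
  by rewrite hat_nonfacet// dlin0 big1// => e _; rewrite lambda_nonfacet// mulr0.
have [vK|vK] := boolP (v \in K); last first.
  rewrite hat_out// dlin0 big1// => e _; have [ve|ve] := boolP ([set v] \subset e); last first.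
    by rewrite incid0// mul0r.
  rewrite lambda_out ?mulr0//; apply: contra vK => /subsetP; apply.
  by rewrite -sub1set.
have [b [c [vb vc bc KE]]] := card3_from (reg_card rM KM) vK.
have KM' : [set v; b; c] \in facets M by rewrite -KE.
have vbM : [set v; b] \in cells M 1 := facet_edge vb KM'.
have vcM : [set v; c] \in cells M 1.
  by apply: (facet_edge (c := b) vc); rewrite set3C23.
rewrite (sum_edges_at (F := fun e => incid [set v] e * lambda 1 e K x E) vb vc bc KM'); last first.
  move=> e h; split.
    by apply: contraNT h; rewrite -sub1set => ve; rewrite incid0// mul0r.
  by apply: contraNT h => eK; rewrite lambda_out ?mulr0// KE.
rewrite !(incid_edge rM)// !lambda1_at// (sgn2C rM vb vbM) (sgn2C rM vc vcM).
rewrite !mulNr !mulrA !(sgn2_sqr rM)// !mul1r.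
have h1 := sum_hat rM x KE vb vc bc KM.
have h2 := sum_dhat rM (row 0 E) KE vb vc bc KM.
rewrite /whitney1 h2; move: h1 {h2}.
move: (hat v K x) (hat b K x) (hat c K x) (dlin _ _) (dlin _ _) => p q s y z h1.
have -> : s = 1 - p - q by lra.
ring.
Qed.

Lemma extdZ r (w : pform M r) k : affine_form w ->
  extd (fun K x E => k * w K x E) = fun K x E => k * extd w K x E.
Proof.
move=> aw; apply/funext => K; apply/funext => x; apply/funext => E.
rewrite !extdE//; last by move=> K' E'; apply: affine_scale; exact: aw.
rewrite mulr_sumr; apply: eq_bigr => i _; rewrite /dlin; ring.
Qed.

Lemma affine_form_sum r (I : finType) (P : pred I) (F : I -> pform M r) :
  (forall i, P i -> affine_form (F i)) ->
  affine_form (fun K x E => \sum_(i | P i) F i K x E).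
Proof.
move=> aF K E k x y; rewrite -!sumrB mulr_sumr -big_split; apply: eq_bigr => i Pi; exact: aF.
Qed.

Lemma extd_sum r (I : finType) (P : pred I) (F : I -> pform M r) :
  (forall i, P i -> affine_form (F i)) ->
  extd (fun K x E => \sum_(i | P i) F i K x E) =
  fun K x E => \sum_(i | P i) extd (F i) K x E.
Proof.
move=> aF; apply/funext => K; apply/funext => x; apply/funext => E.
rewrite extdE; last exact: affine_form_sum.
under [RHS]eq_bigr => i Pi do rewrite (extdE _ _ _ (aF i Pi)).
rewrite exchange_big; apply: eq_bigr => k _; rewrite -mulr_sumr /dlin; congr (_ * _).
by rewrite sumrB.
Qed.

Lemma extd_lambda1 e : e \in cells M 1 ->
  extd (lambda 1 e) = fun K x E => \sum_(t in cells M 2) incid e t * lambda 2 t K x E.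
Proof.
move=> eM; have /cellP[e2 _] := eM; have [a [b [ab eE]]] := subset_card2 e2; subst e.
rewrite (lambda1E rM ab eM) extdZ; last exact: affine_whitney1.
rewrite extd_whitney1.
apply/funext => K; apply/funext => x; apply/funext => E.
have [KM|KM] := boolP (K \in facets M); last first.
  rewrite /wedge2 !hat_nonfacet// !dlin0 !mul0r subrr !mulr0 big1// => t _.
  by rewrite lambda_nonfacet// mulr0.
rewrite (bigD1 K) ?(facet_cell rM)//= big1 ?addr0; last first.
  move=> t /andP[/(cell_facet rM) tM tK]; rewrite lambda_out ?mulr0//.
  by apply: contra tK => tK; rewrite eqEcard tK (reg_card rM KM) (reg_card rM tM).
have [sub|sub] := boolP ([set a; b] \subset K); last first.
  rewrite incid0// mul0r.
  have : (a \notin K) || (b \notin K).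
    rewrite -negb_and; apply: contra sub => /andP[aK bK].
    by apply/subsetP => u; rewrite !inE => /orP[]/eqP->.
  by rewrite /wedge2; case/orP => h; rewrite (hat_out h) !dlin0 ?mul0r ?mulr0 ?subrr ?mulr0 ?subrr ?mulr0.
have aK : a \in K by apply: (subsetP sub); rewrite !inE eqxx.
have bK : b \in K by apply: (subsetP sub); rewrite !inE eqxx orbT.
have [c [ac bc KE]] := card3_from2 (reg_card rM KM) aK bK ab.
have KM' : [set a; b; c] \in facets M by rewrite -KE.
have -> : incid [set a; b] K = sgn2 a b * sgn3 a b c by rewrite KE (incid_facet rM).
have -> : lambda 2 K K x E = sgn3 a b c * whitney2 a b c K x E.
  by rewrite -lambda2_at// -KE.
rewrite -!mulrA [sgn3 a b c * (_ * _)]mulrA (sgn3_sqr rM)// mul1r.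
have h1 := sum_hat rM x KE ab ac bc KM.
have h2 := sum_dhat rM (row 0 E) KE ab ac bc KM.
have h3 := sum_dhat rM (row 1 E) KE ab ac bc KM.
rewrite /whitney2 /wedge2 h2 h3; congr (_ * _); move: h1 {h2 h3}.
move: (hat a K x) (hat b K x) (hat c K x) (dlin _ _) (dlin _ _) (dlin _ _) (dlin _ _) => p q s y z u w h1.
have -> : s = 1 - p - q by lra.
ring.
Qed.
End Differential.

(** * The pairing is bilinear *)

Section Pairing.
Variables (R : realType) (N : nat) (A B : mesh R N).
Hypotheses (rA : regular A) (rB : regular B).
Local Notation V := 'rV[R]_N.

Lemma affine_lambda (M : mesh R N) r t : affine_form (lambda (T := M) r t).
Proof.
move=> K E; rewrite /lambda; case: ((K \in facets M) && (t \subset K)); last exact: affine_cst.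
apply: affine_scale; move=> k x y; rewrite -!sumrB mulr_sumr -big_split /=.
apply: eq_bigr => i _ /=; move: (\det _) => d.
suff af : affine_fun (fun x => [seq bary K a x | a <- ord t]`_i) by rewrite (affineE af); ring.
case: (ord t) => [|a0 s]; first by rewrite (_ : (fun x => _) = fun=> 0); [exact: affine_cst|apply/funext => u; rewrite nth_nil].
have [h|h] := ltnP i (size (a0 :: s)); last first.
  rewrite (_ : (fun x => _) = fun=> 0); first exact: affine_cst.
  by apply/funext => u; rewrite nth_default// size_map.
rewrite (_ : (fun x => _) = bary K (nth a0 (a0 :: s) i)); first exact: affine_bary.
by apply/funext => u; rewrite (nth_map a0).
Qed.

Lemma tame_wedge q r (b : pform A q) (w : pform B r) K L E : affine_form b -> affine_form w ->
  tame (fun x => wedge (b K) (w L) x E).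
Proof.
move=> ab aw; apply: tame_mul; first exact: tame_cst.
apply: tame_sum => s _; apply: tame_mul; last exact: (tame_affine (aw _ _)).
apply: tame_mul; first exact: tame_cst; exact: (tame_affine (ab _ _)).
Qed.

(** The degree is a variable here because the degree of a wedge product is a
    sum, which is 2 only by an equation. *)
Lemma simplex_integral2 m (p : seq V) (w : form R N m) : m = 2%N ->
  tame (fun x => w x (edgemx m p)) -> simplex_integral p w = tint p (fun x => w x (edgemx m p)).
Proof. by move=> m2; subst m; exact: simplex_integralE. Qed.

Lemma pairingE q r (b : pform A q) (w : pform B r) : (q + r = 2)%N -> affine_form b -> affine_form w ->
  pairing b w = \sum_(K in facets A) \sum_(L in facets B)
    orn K * tint (vert K) (fun x => chi L x * wedge (b K) (w L) x (edgemx (q + r)%N (vert K))).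
Proof.
move=> qr ab aw; apply: eq_bigr => K _; apply: eq_bigr => L LB; congr (_ * _).
have tw := tame_wedge K L (edgemx (q + r)%N (vert K)) ab aw.
have e : (fun x => \1_(simplex L) x * wedge (b K) (w L) x (edgemx (q + r)%N (vert K))) =
  (fun x => chi L x * wedge (b K) (w L) x (edgemx (q + r)%N (vert K))).
  by apply/funext => x; rewrite (chiE rB LB).
rewrite simplex_integral2// ?e//.
by apply: tame_mul; [exact: tame_chi|].
Qed.

Lemma wedge_suml q r (I : finType) (P : pred I) (k : I -> R) (F : I -> form R N q) (w : form R N r) x E :
  wedge (fun x E => \sum_(i | P i) k i * F i x E) w x E = \sum_(i | P i) k i * wedge (F i) w x E.
Proof.
rewrite /wedge; under [RHS]eq_bigr do rewrite mulrCA mulr_sumr.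
rewrite -mulr_sumr exchange_big; congr (_ * _); apply: eq_bigr => s _ /=.
rewrite mulr_sumr mulr_suml; apply: eq_bigr => i _.
by rewrite !mulrA [k i * _]mulrC.
Qed.

Lemma wedge_sumr q r (I : finType) (P : pred I) (k : I -> R) (b : form R N q) (F : I -> form R N r) x E :
  wedge b (fun x E => \sum_(i | P i) k i * F i x E) x E = \sum_(i | P i) k i * wedge b (F i) x E.
Proof.
rewrite /wedge; under [RHS]eq_bigr do rewrite mulrCA mulr_sumr.
rewrite -mulr_sumr exchange_big; congr (_ * _); apply: eq_bigr => s _ /=.
by rewrite mulr_sumr; apply: eq_bigr => i _; rewrite mulrCA.
Qed.

Lemma affine_form_comb (M : mesh R N) r (I : finType) (P : pred I) (k : I -> R) (F : I -> pform M r) :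
  (forall i, affine_form (F i)) -> affine_form (fun K x E => \sum_(i | P i) k i * F i K x E).
Proof.
by move=> aF; apply: (affine_form_sum (F := fun i K x E => k i * F i K x E)) => i _ K E;
  apply: affine_scale; exact: aF.
Qed.

Lemma pairing_suml q r (I : finType) (P : pred I) (k : I -> R) (F : I -> pform A q) (w : pform B r) :
  (q + r = 2)%N -> (forall i, affine_form (F i)) -> affine_form w ->
  pairing (fun K x E => \sum_(i | P i) k i * F i K x E) w = \sum_(i | P i) k i * pairing (F i) w.
Proof.
move=> qr aF aw; rewrite pairingE//; last exact: affine_form_comb.
under [RHS]eq_bigr => i _ do rewrite (pairingE qr (aF i) aw) mulr_sumr.
rewrite [RHS]exchange_big; apply: eq_bigr => K _ /=.
under [RHS]eq_bigr => i _ do rewrite mulr_sumr.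
rewrite [RHS]exchange_big; apply: eq_bigr => L _ /=.
have tw i : tame (fun x => chi L x * wedge (F i K) (w L) x (edgemx (q + r)%N (vert K))).
  by apply: tame_mul; [exact: tame_chi|exact: tame_wedge].
rewrite (eq_tint (vert K) (psi := fun x => \sum_(i | P i)
    k i * (chi L x * wedge (F i K) (w L) x (edgemx (q + r)%N (vert K))))); last first.
  by move=> x; rewrite wedge_suml mulr_sumr; apply: eq_bigr => i _; rewrite mulrCA.
rewrite tint_sum; last by move=> i _; apply: tame_mul; [exact: tame_cst|exact: tw].
rewrite mulr_sumr; apply: eq_bigr => i _; by rewrite tintZ// mulrCA.
Qed.

Lemma pairing_sumr q r (I : finType) (P : pred I) (k : I -> R) (b : pform A q) (F : I -> pform B r) :
  (q + r = 2)%N -> affine_form b -> (forall i, affine_form (F i)) ->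
  pairing b (fun K x E => \sum_(i | P i) k i * F i K x E) = \sum_(i | P i) k i * pairing b (F i).
Proof.
move=> qr ab aF; rewrite pairingE//; last exact: affine_form_comb.
under [RHS]eq_bigr => i _ do rewrite (pairingE qr ab (aF i)) mulr_sumr.
rewrite [RHS]exchange_big; apply: eq_bigr => K _ /=.
under [RHS]eq_bigr => i _ do rewrite mulr_sumr.
rewrite [RHS]exchange_big; apply: eq_bigr => L _ /=.
have tw i : tame (fun x => chi L x * wedge (b K) (F i L) x (edgemx (q + r)%N (vert K))).
  by apply: tame_mul; [exact: tame_chi|exact: tame_wedge].
rewrite (eq_tint (vert K) (psi := fun x => \sum_(i | P i)
    k i * (chi L x * wedge (b K) (F i L) x (edgemx (q + r)%N (vert K))))); last first.
  by move=> x; rewrite wedge_sumr mulr_sumr; apply: eq_bigr => i _; rewrite mulrCA.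
rewrite tint_sum; last by move=> i _; apply: tame_mul; [exact: tame_cst|exact: tw].
rewrite mulr_sumr; apply: eq_bigr => i _; by rewrite tintZ// mulrCA.
Qed.

End Pairing.

Section WedgeLow.
Variables (R : realType) (N : nat).
Local Notation V := 'rV[R]_N.

Lemma sum_S2 (F : 'S_2 -> R) : \sum_s F s = F 1%g + F (tperm ord0 ord_max).
Proof.
have n1 : 1%g != tperm ord0 ord_max :> 'S_2.
  by apply/eqP => /permP/(_ ord0); rewrite perm1 tpermL.
rewrite (bigD1 1%g)//= (bigD1 (tperm ord0 ord_max))/= ?[_ == 1%g]eq_sym// big_pred0 ?addr0// => s.
apply/negP => /andP[s1 st].
have : (#|[set 1%g; tperm ord0 ord_max; s]| <= #|{: 'S_2}|)%N by exact: max_card.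
by rewrite card_Sn cards3// eq_sym.
Qed.

Lemma row_usub (p q : nat) (s : 'S_(p + q)) (E : 'M[R]_(p + q, N)) i :
  row i (usubmx (row_perm s E)) = row (s (lshift q i)) E.
Proof. by apply/rowP => j; rewrite !mxE. Qed.

Lemma row_dsub (p q : nat) (s : 'S_(p + q)) (E : 'M[R]_(p + q, N)) i :
  row i (dsubmx (row_perm s E)) = row (s (rshift p i)) E.
Proof. by apply/rowP => j; rewrite !mxE. Qed.

Lemma wedge11 (b w : form R N 1) (f g : V -> V -> R) x (E : 'M[R]_(2, N)) :
  (forall E, b x E = f x (row 0 E)) -> (forall E, w x E = g x (row 0 E)) ->
  wedge b w x E = f x (row 0 E) * g x (row 1 E) - f x (row 1 E) * g x (row 0 E).
Proof.
move=> hb hw; rewrite /wedge sum_S2 !hb !hw !row_usub !row_dsub odd_perm1 odd_tperm.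
have -> : @lshift 1 1 0 = ord0 :> 'I_2 by exact: val_inj.
have -> : @rshift 1 1 0 = ord_max :> 'I_2 by exact: val_inj.
rewrite !perm1 tpermL tpermR /= expr0 expr1.
have -> : ord_max = 1 :> 'I_2 by exact: val_inj.
rewrite (_ : ord0 = 0 :> 'I_2)//.
have -> : (1`! * 1`!)%:R = 1 :> R by [].
rewrite invr1; move: (f _ _) (f _ _) (g _ _) (g _ _) => p q s t; ring.
Qed.

Definition swap_rows (E : 'M[R]_(2, N)) : 'M[R]_(2, N) := row_perm (tperm ord0 ord_max) E.

Lemma wedge20 (b : form R N 2) (w : form R N 0) (f : V -> 'M[R]_(2, N) -> R) (u : V -> R) x
    (E : 'M[R]_(2, N)) :
  (forall E, b x E = f x E) -> f x (swap_rows E) = - f x E -> (forall E, w x E = u x) ->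
  wedge b w x E = f x E * u x.
Proof.
move=> hb fs hw; rewrite /wedge (sum_S2 (fun s => _)) !hb !hw odd_perm1 odd_tperm.
have -> : usubmx (row_perm (1%g : 'S_(2 + 0)) E) = E :> 'M[R]_(2, N).
  by apply/matrixP => i j; rewrite !mxE perm1; congr (E _ _); exact: val_inj.
have -> : usubmx (row_perm (tperm ord0 ord_max : 'S_(2 + 0)) E) = swap_rows E :> 'M[R]_(2, N).
  apply/matrixP => i j; rewrite !mxE; congr (E _ _); congr (tperm _ _ _).
  exact: val_inj.
rewrite fs /= expr0 expr1.
have -> : (2`! * 0`!)%:R = 2%:R :> R by [].
have n2 : (2%:R : R) != 0 by rewrite pnatr_eq0.
by move: (f _ _) (u _) => p q; field.
Qed.

Lemma wedge02 (b : form R N 0) (w : form R N 2) (f : V -> 'M[R]_(2, N) -> R) (u : V -> R) x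
    (E : 'M[R]_(2, N)) :
  (forall E, b x E = u x) -> (forall E, w x E = f x E) -> f x (swap_rows E) = - f x E ->
  wedge b w x E = u x * f x E.
Proof.
move=> hb hw fs; rewrite /wedge (sum_S2 (fun s => _)) !hb !hw odd_perm1 odd_tperm.
have -> : dsubmx (row_perm (1%g : 'S_(0 + 2)) E) = E :> 'M[R]_(2, N).
  by apply/matrixP => i j; rewrite !mxE perm1; congr (E _ _); exact: val_inj.
have -> : dsubmx (row_perm (tperm ord0 ord_max : 'S_(0 + 2)) E) = swap_rows E :> 'M[R]_(2, N).
  apply/matrixP => i j; rewrite !mxE; congr (E _ _); congr (tperm _ _ _).
  exact: val_inj.
rewrite fs /= expr0 expr1.
have -> : (0`! * 2`!)%:R = 2%:R :> R by [].
have n2 : (2%:R : R) != 0 by rewrite pnatr_eq0.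
by move: (f _ _) (u _) => p q; field.
Qed.

Lemma wedge2_swap (f g : V -> R) E : wedge2 f g (swap_rows E) = - wedge2 f g E.
Proof.
rewrite /wedge2 /swap_rows.
have -> : row 0 (row_perm (tperm ord0 ord_max) E) = row 1 E.
  by apply/rowP => j; rewrite !mxE (_ : 0 = ord0)// tpermL; congr (E _ _); exact: val_inj.
have -> : row 1 (row_perm (tperm ord0 ord_max) E) = row 0 E.
  by apply/rowP => j; rewrite !mxE (_ : 1 = ord_max) ?tpermR//; exact: val_inj.
by rewrite opprB [X in X - _]mulrC [X in _ - X]mulrC; ring.
Qed.
End WedgeLow.

(** * Stokes' theorem for the pairing of basis forms *)

Section Stokes.
Variables (R : realType) (N : nat) (A B : mesh R N).
Hypotheses (rA : regular A) (rB : regular B).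
Hypotheses (sAB : (surface A `<=` surface B)%classic) (sBA : (surface B `<=` surface A)%classic).
Local Notation V := 'rV[R]_N.

Lemma tint_combine (p : seq V) (k s : R) (phi psi c1 c2 : V -> R) :
  tame phi -> tame psi -> tame c1 -> tame c2 ->
  (forall x, phi x + k * psi x = s * (c1 x - c2 x)) ->
  tint p phi + k * tint p psi = s * (tint p c1 - tint p c2).
Proof.
move=> t1 t2 t3 t4 h; rewrite -tintZ// -tintD//; last by apply: tame_mul => //; exact: tame_cst.
rewrite (eq_tint p h) tintZ; last exact: tame_sub.
by rewrite tintD ?tintN//; exact: tame_opp.
Qed.

Lemma core_sum_pairs (p a : node A) (v : node B) : p != a ->
  ([set p; a] \notin bd (facets A)) || ~~ on_bd (facets B) [set v] ->
  \sum_(K in facets A) \sum_(L in facets B) orn K * tint (vert K) (fun x =>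
     chi L x * core_form p a v K L x (edgemx 2 (vert K))) = 0.
Proof.
move=> pa bc; rewrite -[RHS](core_sum rA rB sAB sBA pa bc); apply: eq_bigr => K _.
rewrite tint_sum ?mulr_sumr// => L _.
by apply: tame_mul; [exact: tame_chi|exact: tame_core].
Qed.

Lemma affine_form_cst (M : mesh R N) r (w : {set node M} -> 'M[R]_(r, N) -> R) :
  affine_form (fun K x E => w K E).
Proof. by move=> K E; exact: affine_cst. Qed.

(** With this, an identity of pairings follows from a pointwise identity that
    expresses the integrands by two core forms. *)
Lemma pairing_stokes q r q' r' (b : pform A q) (w : pform B r) (b' : pform A q') (w' : pform B r')
    (k s : R) (c1 c2 : {set node A} -> {set node B} -> V -> R) :
  (q + r = 2)%N -> (q' + r' = 2)%N ->
  affine_form b -> affine_form w -> affine_form b' -> affine_form w' ->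
  (forall K L, tame (c1 K L)) -> (forall K L, tame (c2 K L)) ->
  (forall K L x, K \in facets A -> L \in facets B ->
     wedge (b K) (w L) x (edgemx (q + r)%N (vert K)) +
     k * wedge (b' K) (w' L) x (edgemx (q' + r')%N (vert K)) = s * (c1 K L x - c2 K L x)) ->
  \sum_(K in facets A) \sum_(L in facets B) orn K * tint (vert K) (fun x => chi L x * c1 K L x) = 0 ->
  \sum_(K in facets A) \sum_(L in facets B) orn K * tint (vert K) (fun x => chi L x * c2 K L x) = 0 ->
  pairing b w + k * pairing b' w' = 0.
Proof.
move=> qr qr' ab aw ab' aw' t1 t2 h z1 z2.
rewrite !pairingE// mulr_sumr -big_split.
transitivity (s * ((\sum_(K in facets A) \sum_(L in facets B) orn K *
    tint (vert K) (fun x => chi L x * c1 K L x)) -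
  (\sum_(K in facets A) \sum_(L in facets B) orn K *
    tint (vert K) (fun x => chi L x * c2 K L x)))); last by rewrite z1 z2 subrr mulr0.
rewrite -sumrB mulr_sumr; apply: eq_bigr => K KA /=.
rewrite mulr_sumr -big_split -sumrB mulr_sumr; apply: eq_bigr => L LB /=.
have tc (f : V -> R) : tame f -> tame (fun x => chi L x * f x).
  by move=> tf; apply: tame_mul; [exact: tame_chi|].
have gen (o p1 p2 p3 p4 : R) : p1 + k * p2 = s * (p3 - p4) ->
    o * p1 + k * (o * p2) = s * (o * p3 - o * p4).
  by move=> H; rewrite mulrCA -mulrDr H; ring.
apply: gen; apply: tint_combine; [apply: tc; exact: tame_wedge|apply: tc; exact: tame_wedge|exact: tc|exact: tc|].
by move=> x; rewrite [k * _]mulrCA -mulrDr h// mulrCA; congr (_ * _); rewrite mulrBr.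
Qed.

(** The form 2 l_v d l_p /\ d l_a - (l_p d l_a - l_a d l_p) /\ d l_v is the
    difference of the core forms for (p, a) and (a, p). *)
Lemma stokes_edge_node (e : {set node A}) (t : {set node B}) : e \in cells A 1 -> t \in cells B 0 ->
  (e \notin bd (facets A)) || ~~ on_bd (facets B) t ->
  pairing (extd (lambda 1 e : pform A 1)) (lambda 0 t : pform B 0) =
  pairing (lambda 1 e : pform A 1) (extd (lambda 0 t : pform B 0)).
Proof.
move=> eA tB; have /cellP[e2 _] := eA; have [p [a [pa eE]]] := subset_card2 e2.
have /cellP[/eqP/cards1P[v tE] _] := tB; subst e t => bc.
rewrite (lambda1E rA pa eA) (lambda0E rB tB) extdZ; last exact: affine_whitney1.
rewrite extd_whitney1 extd_hat; apply/eqP; rewrite -subr_eq0 -[X in _ - X]mul1r -mulNr; apply/eqP.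
apply: (@pairing_stokes 2 0 1 1 _ _ _ _ _ (sgn2 p a)
  (fun K L x => core_form p a v K L x (edgemx 2 (vert K)))
  (fun K L x => core_form a p v K L x (edgemx 2 (vert K)))) => //.
- exact: (affine_form_cst (fun K E => sgn2 p a * (2%:R * wedge2 (hat p K) (hat a K) E))).
- by move=> K E; exact: affine_hat.
- by move=> K E; apply: affine_scale; exact: affine_whitney1.
- exact: (affine_form_cst (fun K E => dlin (hat v K) (row 0 E))).
- by move=> K L; exact: tame_core.
- by move=> K L; exact: tame_core.
- move=> K L x _ _.
  rewrite (wedge20 (f := fun x E => sgn2 p a * (2%:R * wedge2 (hat p K) (hat a K) E)) (u := hat v L))//;
    last by rewrite wedge2_swap !mulrN.
  rewrite (wedge11 (f := fun x E => sgn2 p a * (hat p K x * dlin (hat a K) E - hat a K x * dlin (hat p K) E))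
     (g := fun x E => dlin (hat v L) E))//.
  rewrite /core_form /wedge2.
  move: (hat _ _ _) (hat _ _ _) (hat _ _ _) (sgn2 _ _) => h1 h2 h3 s.
  move: (dlin _ _) (dlin _ _) (dlin _ _) (dlin _ _) (dlin _ _) (dlin _ _) => d1 d2 d3 d4 d5 d6; ring.
- exact: core_sum_pairs.
- by apply: core_sum_pairs; [rewrite eq_sym|rewrite setUC].
Qed.

End Stokes.

Section StokesSwap.
Variables (R : realType) (N : nat) (A B : mesh R N).
Hypotheses (rA : regular A) (rB : regular B).
Hypotheses (sAB : (surface A `<=` surface B)%classic) (sBA : (surface B `<=` surface A)%classic).
Hypothesis comp : forall L K, L \in facets B -> K \in facets A ->
  (open_simplex L `&` open_simplex K !=set0)%classic -> orient L (edgemx 2 (vert K)) = orn K.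

(** The two functions with differentials in [core_sum] must come from the mesh
    over whose facets one integrates. *)
Lemma core_sum_swap (p a : node B) (v : node A) : p != a ->
  ([set p; a] \notin bd (facets B)) || ~~ on_bd (facets A) [set v] ->
  \sum_(K in facets A) \sum_(L in facets B) orn K * tint (vert K) (fun x =>
     chi L x * core_form p a v L K x (edgemx 2 (vert K))) = 0.
Proof.
move=> pa bc; rewrite -[RHS](core_sum_pairs rB rA sBA sAB pa bc) [RHS]exchange_big.
apply: eq_bigr => K KA; apply: eq_bigr => L LB; apply/esym.
apply: swap_term => //.
- exact: comp.
- by move=> x; exact: two_form_core.
- by move=> E; exact: tame_core.
Qed.

(** The form d l_v /\ (l_p d l_a - l_a d l_p) + 2 l_v d l_p /\ d l_a is the
    difference of the core forms for (p, a) and (a, p). *)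
Lemma stokes_node_edge (t : {set node A}) (e : {set node B}) : t \in cells A 0 -> e \in cells B 1 ->
  (e \notin bd (facets B)) || ~~ on_bd (facets A) t ->
  pairing (extd (lambda 0 t : pform A 0)) (lambda 1 e : pform B 1) =
  - pairing (lambda 0 t : pform A 0) (extd (lambda 1 e : pform B 1)).
Proof.
move=> tA eB; have /cellP[e2 _] := eB; have [p [a [pa eE]]] := subset_card2 e2.
have /cellP[/eqP/cards1P[v tE] _] := tA; subst e t => bc.
rewrite (lambda1E rB pa eB) (lambda0E rA tA) extdZ; last exact: affine_whitney1.
rewrite extd_whitney1 extd_hat; apply/eqP; rewrite -addr_eq0 -[X in _ + X]mul1r; apply/eqP.
apply: (@pairing_stokes _ _ _ _ rB 1 1 0 2 _ _ _ _ _ (sgn2 p a)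
  (fun K L x => core_form p a v L K x (edgemx 2 (vert K)))
  (fun K L x => core_form a p v L K x (edgemx 2 (vert K)))) => //.
- exact: (affine_form_cst (fun K E => dlin (hat v K) (row 0 E))).
- by move=> K E; apply: affine_scale; exact: affine_whitney1.
- by move=> K E; exact: affine_hat.
- exact: (affine_form_cst (fun K E => sgn2 p a * (2%:R * wedge2 (hat p K) (hat a K) E))).
- by move=> K L; exact: tame_core.
- by move=> K L; exact: tame_core.
- move=> K L x _ _.
  rewrite (wedge11 (f := fun x E => dlin (hat v K) E)
     (g := fun x E => sgn2 p a * (hat p L x * dlin (hat a L) E - hat a L x * dlin (hat p L) E)))//.
  rewrite (wedge02 (f := fun x E => sgn2 p a * (2%:R * wedge2 (hat p L) (hat a L) E)) (u := hat v K))//;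
    last by rewrite wedge2_swap !mulrN.
  rewrite /core_form /wedge2.
  move: (hat _ _ _) (hat _ _ _) (hat _ _ _) (sgn2 _ _) => h1 h2 h3 s.
  move: (dlin _ _) (dlin _ _) (dlin _ _) (dlin _ _) (dlin _ _) (dlin _ _) => d1 d2 d3 d4 d5 d6; ring.
- exact: core_sum_swap.
- by apply: core_sum_swap; [rewrite eq_sym|rewrite setUC].
Qed.
End StokesSwap.

(** * Spaces of forms *)

Section Combinations.
Variables (R : realType) (N : nat).
Local Notation V := 'rV[R]_N.

(** Whitney spaces and dual spaces are both described by conditions on the
    coefficients with respect to all cells. *)
Definition wform (M : mesh R N) r (g : {set node M} -> R) : pform M r :=
  fun K x E => \sum_(t in cells M r) g t * lambda r t K x E.

Arguments wform {M} r g.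

Lemma affine_wform (M : mesh R N) r g : affine_form (wform (M := M) r g).
Proof. by apply: affine_form_comb => t; exact: affine_lambda. Qed.

Lemma affine_extd (M : mesh R N) r (w : pform M r) : affine_form w -> affine_form (extd w).
Proof.
move=> aw K E; rewrite (_ : (fun x => _) = fun=>
  \sum_(k < r.+1) (-1) ^+ k * dlin (fun y => w K y (row' k E)) (row k E)); first exact: affine_cst.
by apply/funext => x; exact: extdE.
Qed.

Lemma extd_comb (M : mesh R N) r (I : finType) (P : pred I) (k : I -> R) (F : I -> pform M r) :
  (forall i, affine_form (F i)) ->
  extd (fun K x E => \sum_(i | P i) k i * F i K x E) =
  fun K x E => \sum_(i | P i) k i * extd (F i) K x E.
Proof.
move=> aF; rewrite (extd_sum (F := fun i K x E => k i * F i K x E)).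
  apply/funext => K; apply/funext => x; apply/funext => E; apply: eq_bigr => i _.
  by rewrite extdZ.
by move=> i _ K E; apply: affine_scale; exact: aF.
Qed.

Lemma extd_wform (M : mesh R N) r g : regular M -> (r <= 1)%N ->
  extd (wform (M := M) r g) =
  wform r.+1 (fun t => \sum_(s in cells M r) g s * incid s t).
Proof.
move=> rM r1; rewrite /wform extd_comb; last by move=> t; exact: affine_lambda.
apply/funext => K; apply/funext => x; apply/funext => E.
under [RHS]eq_bigr do rewrite mulr_suml.
rewrite [RHS]exchange_big; apply: eq_bigr => s sM /=.
under [RHS]eq_bigr do rewrite -mulrA.
rewrite -mulr_sumr; congr (_ * _).
case: r r1 g s E sM => [|[|//]] _ g s E sM; last by rewrite extd_lambda1.
have /cellP[/eqP/cards1P[v sE] _] := sM; subst s.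
by rewrite extd_lambda0.
Qed.

Lemma whitneyP c (M : mesh R N) r (w : pform M r) : whitney_space c w <->
  exists g : {set node M} -> R, (forall t, g t != 0 -> t \in dofs c M r) /\ w = wform r g.
Proof.
have sub t : t \in dofs c M r -> t \in cells M r by case: c => //=; rewrite inE => /andP[].
split=> -[b].
  move=> ->; exists (fun t => if t \in dofs c M r then b t else 0); split.
    by move=> t; case: ifP => //; rewrite eqxx.
  apply/funext => K; apply/funext => x; apply/funext => E; rewrite /wform.
  rewrite [RHS](big_setID (dofs c M r)) /= [X in _ + X]big1 ?addr0; last first.
    by move=> t; rewrite inE => /andP[/negbTE-> _]; rewrite mul0r.
  rewrite (setIidPr _); last by apply/subsetP => t /sub.
  by apply: eq_bigr => t ->.
move=> [bd ->]; exists b; apply/funext => K; apply/funext => x; apply/funext => E; rewrite /wform.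
rewrite [LHS](big_setID (dofs c M r)) /= [X in _ + X]big1 ?addr0; last first.
  move=> t; rewrite inE => /andP[tn _].
  by have [->|/bd] := eqVneq (b t) 0; rewrite ?mul0r// (negbTE tn).
by rewrite (setIidPr _)//; apply/subsetP => t /sub.
Qed.

Lemma whitney_extd c (M : mesh R N) r (w : pform M r) : regular M -> (r <= 1)%N ->
  whitney_space c w -> whitney_space c (extd w).
Proof.
move=> rM r1 /whitneyP[g [gd ->]]; rewrite extd_wform//; apply/whitneyP.
pose h t := if t \in cells M r.+1 then \sum_(s in cells M r) g s * incid s t else 0.
exists h; split; last first.
  apply/funext => K; apply/funext => x; apply/funext => E.
  by apply: eq_bigr => t tM; rewrite /h tM.
move=> t; rewrite /h; case: ifP => [tM|]; last by rewrite eqxx.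
case: c gd => //= gd; rewrite inE tM /=; apply: contra => tb; apply/eqP; apply: big1 => s sM.
have [->|/gd] := eqVneq (g s) 0; first by rewrite mul0r.
rewrite inE => /andP[_ sb]; have [->|/incid_sub[st _]] := eqVneq (incid s t) 0; first by rewrite mulr0.
case/negP: sb; have /existsP[u /andP[ub tu]] := tb; apply/existsP; exists u.
by rewrite ub (subset_trans st tu).
Qed.

(** For Whitney forms of vanishing trace this is a defining property of the
    dual basis; otherwise it is a consequence of the rules. *)
Definition dual_derivative c (T : bc_mesh R N) : Prop := forall q t, (q <= 1)%N ->
  t \in dofs c T (2 - q) -> extd (mu q t) = fun K x V =>
    (-1) ^+ (1 - q) * \sum_(s in dofs c T (1 - q)) incid s t * mu q.+1 s K x V.

Definition no_trace (T : bc_mesh R N) : Prop := forall q t w, (q <= 1)%N ->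
  t \in cells T (2 - q) -> w \in cells (refined T) q -> coef q t w != 0 ->
  ~~ on_bd (facets (refined T)) w.

Lemma affine_mu (T : bc_mesh R N) q t : affine_form (mu (T := T) q t).
Proof. by apply: affine_form_comb => w; exact: affine_lambda. Qed.

Lemma bc_extd c (T : bc_mesh R N) q (b : pform (refined T) q) : (q <= 1)%N ->
  dual_derivative c T -> bc_space c b -> bc_space c (extd b).
Proof.
move=> q1 dm [k ->]; rewrite extd_comb; last by move=> t; exact: affine_mu.
exists (fun s => \sum_(t in dofs c T (2 - q)) k t * ((-1) ^+ (1 - q) * incid s t)).
apply/funext => K; apply/funext => x; apply/funext => E.
rewrite (_ : (2 - q.+1)%N = (1 - q)%N)//.
under [RHS]eq_bigr do rewrite mulr_suml.
rewrite [RHS]exchange_big; apply: eq_bigr => t td /=.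
rewrite dm// mulrA mulr_sumr; apply: eq_bigr => s _.
by rewrite !mulrA.
Qed.

Lemma bc_wform c (T : bc_mesh R N) q (b : pform (refined T) q) : (q <= 1)%N ->
  no_trace T \/ c = WhitneyTraceZero -> bc_space c b ->
  exists g, b = wform q g /\ (c = WhitneyTraceZero \/
    forall w, w \in cells (refined T) q -> g w != 0 -> ~~ on_bd (facets (refined T)) w).
Proof.
move=> q1 nt [k ->]; exists (fun w => \sum_(t in dofs c T (2 - q)) k t * coef q t w); split.
  apply/funext => K; apply/funext => x; apply/funext => E; rewrite /wform.
  under [RHS]eq_bigr do rewrite mulr_suml.
  rewrite [RHS]exchange_big; apply: eq_bigr => t td /=.
  by rewrite mulr_sumr; apply: eq_bigr => w _; rewrite mulrA.
case: nt => [nt|]; last by left.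
right=> w wT; apply: contra => wb; apply/eqP; apply: big1 => t td.
have tT : t \in cells T (2 - q) by move: td; case: (c) => //=; rewrite inE => /andP[].
have [->|h] := eqVneq (coef q t w) 0; first by rewrite mulr0.
by have := nt q t w q1 tT wT h; rewrite wb.
Qed.

Lemma pairing_subr (A B : mesh R N) q r (b : pform A q) (w w' : pform B r) : regular A -> regular B ->
  (q + r = 2)%N -> affine_form b -> affine_form w -> affine_form w' ->
  pairing b (fun K x E => w K x E - w' K x E) = pairing b w - pairing b w'.
Proof.
move=> rA rB qr ab aw aw'.
have := @pairing_sumr _ _ _ _ rB q r bool predT (fun i => if i then 1 else -1) b
  (fun i => if i then w else w') qr ab.
rewrite big_bool/= mul1r mulN1r => <-; last by case.
congr (pairing b _); apply/funext => K; apply/funext => x; apply/funext => E.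
by rewrite big_bool /= mul1r mulN1r.
Qed.
End Combinations.
Arguments wform {R N M} r g.

(** * Commutation from duality *)

Section Commutation.
Variables (R : realType) (N : nat) (c : bc_case).
Local Notation V := 'rV[R]_N.

Lemma pairing_wform (A B : mesh R N) (rB : regular B) q r q' r' (g : {set node A} -> R)
    (h : {set node B} -> R) (F : {set node A} -> pform A q') (G : {set node B} -> pform B r') :
  (q' + r' = 2)%N -> (forall t, affine_form (F t)) -> (forall t, affine_form (G t)) ->
  pairing (fun K x E => \sum_(t in cells A q) g t * F t K x E)
    (fun K x E => \sum_(t in cells B r) h t * G t K x E) =
  \sum_(s in cells A q) \sum_(t in cells B r) g s * (h t * pairing (F s) (G t)).
Proof.
move=> qr aF aG; rewrite (pairing_suml rB)//; last exact: affine_form_comb.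
by apply: eq_bigr => s _; rewrite (pairing_sumr rB)// mulr_sumr.
Qed.

Lemma extd_comb_wform (M : mesh R N) r (g : {set node M} -> R) :
  extd (wform r g) = fun K x E => \sum_(t in cells M r) g t * extd (lambda r t) K x E.
Proof. by apply: extd_comb => t; exact: affine_lambda. Qed.

Lemma affine_dlambda (M : mesh R N) r (t : {set node M}) : affine_form (extd (lambda r t)).
Proof. by apply: affine_extd; exact: affine_lambda. Qed.

Lemma eq_if_neq0 (x y a b : R) : (x != 0 -> y != 0 -> a = b) -> x * (y * a) = x * (y * b).
Proof.
have [->|x0] := eqVneq x 0; first by rewrite !mul0r.
by have [->|y0 ->//] := eqVneq y 0; rewrite !mul0r.
Qed.

(** Stokes' theorem for the pairing: the boundary term vanishes because the
    trace of one of the two forms does. *)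
Lemma stokes0 (A B : mesh R N) (g : {set node A} -> R) (h : {set node B} -> R) :
  regular A -> regular B -> surface A = surface B ->
  (forall s t, s \in cells A 1 -> t \in cells B 0 -> g s != 0 -> h t != 0 ->
     ~~ on_bd (facets A) s || ~~ on_bd (facets B) t) ->
  pairing (extd (wform 1 g)) (wform 0 h) = pairing (wform 1 g) (extd (wform 0 h)).
Proof.
move=> rA rB sAB bc; rewrite !extd_comb_wform.
rewrite (pairing_wform rB 1 0 g h (F := fun s => extd (lambda 1 s)) (G := fun t => lambda 0 t)
  erefl (@affine_dlambda A 1) (@affine_lambda R N B 0)).
rewrite (pairing_wform rB 1 0 g h (F := fun s => lambda 1 s) (G := fun t => extd (lambda 0 t))
  erefl (@affine_lambda R N A 1) (@affine_dlambda B 0)).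
apply: eq_bigr => s sA; apply: eq_bigr => t tB.
apply: eq_if_neq0 => gs ht; have := bc s t sA tB gs ht.
have /cellP[s2 _] := sA; rewrite (on_bd_edge rA s2) => bc'.
by apply: (stokes_edge_node rA rB _ _ sA tB bc'); rewrite sAB.
Qed.

Lemma stokes1 (A B : mesh R N) (g : {set node A} -> R) (h : {set node B} -> R) :
  regular A -> regular B -> surface A = surface B ->
  (forall L K, L \in facets B -> K \in facets A ->
    (open_simplex L `&` open_simplex K !=set0)%classic -> orient L (edgemx 2 (vert K)) = orn K) ->
  (forall s t, s \in cells A 0 -> t \in cells B 1 -> g s != 0 -> h t != 0 ->
     ~~ on_bd (facets A) s || ~~ on_bd (facets B) t) ->
  pairing (extd (wform 0 g)) (wform 1 h) = - pairing (wform 0 g) (extd (wform 1 h)).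
Proof.
move=> rA rB sAB comp bc; rewrite !extd_comb_wform.
rewrite (pairing_wform rB 0 1 g h (F := fun s => extd (lambda 0 s)) (G := fun t => lambda 1 t)
  erefl (@affine_dlambda A 0) (@affine_lambda R N B 1)).
rewrite (pairing_wform rB 0 1 g h (F := fun s => lambda 0 s) (G := fun t => extd (lambda 1 t))
  erefl (@affine_lambda R N A 0) (@affine_dlambda B 1)).
rewrite -sumrN; apply: eq_bigr => s sA; rewrite -sumrN; apply: eq_bigr => t tB.
rewrite -2!mulrN; apply: eq_if_neq0 => gs ht; have := bc s t sA tB gs ht.
have /cellP[t2 _] := tB; rewrite orbC (on_bd_edge rB t2) => bc'.
by apply: (stokes_node_edge rA rB _ _ comp sA tB bc'); rewrite sAB.
Qed.

Variables (T : bc_mesh R N).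
Hypotheses (rT : regular T) (oR : cell_orders (refined T)).
Hypotheses (dm : dual_derivative c T) (nt : no_trace T \/ c = WhitneyTraceZero).

(** There is no boundary term: either b or w has vanishing trace. *)
Lemma adjoint (M : mesh R N) q r (b : pform (refined T) q) (w : pform M r) : (q + r = 1)%N ->
  regular M -> same_oriented_surface M T -> bc_space c b -> whitney_space c w ->
  pairing (extd b) w = (-1) ^+ r * pairing b (extd w).
Proof.
move=> qr rM sM bB wW.
have q1 : (q <= 1)%N by rewrite -qr leq_addr.
have [g [bE hg]] := bc_wform q1 nt bB; have /whitneyP[h [hd wE]] := wW; subst b w.
have rA := regular_refined rT oR.
have sA : surface (refined T) = surface M by rewrite surface_refined//; case: sM => ->.
have bc s t : s \in cells (refined T) q -> t \in cells M r -> g s != 0 -> h t != 0 ->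
     ~~ on_bd (facets (refined T)) s || ~~ on_bd (facets M) t.
  move=> sT tM gs ht; case: hg => [hc|/(_ s sT gs)->//].
  by have := hd t ht; rewrite hc /= inE => /andP[_ ->]; rewrite orbT.
move: bB wW; case: q r qr {q1} g h hd hg bc => [|[|//]] [|[|//]]// _ g h _ _ bc _ _.
  by rewrite expr1 mulN1r; apply: stokes1 => // L K LM KT; exact: (orient_compat rT oR rM sM LM KT).
by rewrite expr0 mul1r; exact: stokes0.
Qed.

(** Both sides have the same pairing with all b, since the derivative can be
    moved to b, where the characterization of v applies, and back. *)
Lemma commute (M : mesh R N) q r (w : pform M r) (v : pform T r) (u : pform T r.+1) : (q + r = 1)%N ->
  regular M -> same_oriented_surface M T -> same_oriented_surface T T ->
  whitney_space c w -> whitney_space c v -> whitney_space c u ->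
  (forall b, bc_space (T := T) (q := q.+1) c b -> pairing b v = pairing b w) ->
  (forall b, bc_space (T := T) (q := q) c b -> pairing b u = pairing b (extd w)) ->
  (forall d : pform T r.+1, whitney_space c d -> 
     (forall b, bc_space (T := T) (q := q) c b -> pairing b d = 0) -> d = fun _ _ _ => 0) ->
  extd v = u.
Proof.
move=> qr rM sM sT wW vW uW hv hu nd.
have q1 : (q <= 1)%N by rewrite -qr leq_addr.
have r1 : (r <= 1)%N by rewrite -qr leq_addl.
have dvW := whitney_extd rT r1 vW.
have aff (M' : mesh R N) r' (f : pform M' r') : whitney_space c f -> affine_form f.
  by move=> /whitneyP[g [_ ->]]; exact: affine_wform.
suff : (fun K x E => extd v K x E - u K x E) = (fun _ _ _ => 0).
  move=> h; apply/funext => K; apply/funext => x; apply/funext => E.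
  by apply/eqP; rewrite -subr_eq0; apply/eqP; exact: (congr1 (fun f => f K x E) h).
apply: nd.
  have /whitneyP[g [hg ->]] := dvW; have /whitneyP[h [hh ->]] := uW.
  apply/whitneyP; exists (fun t => g t - h t); split.
    move=> t; have [g0|/hg//] := eqVneq (g t) 0; have [h0|/hh//] := eqVneq (h t) 0.
    by rewrite g0 h0 subrr eqxx.
  apply/funext => K; apply/funext => x; apply/funext => E; rewrite /wform -sumrB.
  by apply: eq_bigr => t _; rewrite mulrBl.
move=> b bB; have [g [bE _]] := bc_wform q1 nt bB.
have ab : affine_form b by rewrite bE; exact: affine_wform.
have qr2 : (q + r.+1 = 2)%N by rewrite addnS qr.
rewrite (pairing_subr (regular_refined rT oR) rT qr2 ab (aff _ _ _ dvW) (aff _ _ _ uW)).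
rewrite hu//.
have dB := bc_extd q1 dm bB.
have e1 := adjoint qr rT sT bB vW; have e2 := adjoint qr rM sM bB wW.
move: e1; rewrite hv// e2 => /(congr1 (fun z => (-1) ^+ r * z)).
by rewrite !mulrA -expr2 sqrr_sign !mul1r => ->; rewrite subrr.
Qed.
End Commutation.

(** * Dual cells *)

Section DualCells.
Variables (R : realType) (N : nat) (T : bc_mesh R N).
Hypothesis rT : regular T.
Hypothesis orn_sqr : forall K, K \in facets T -> orn K * orn K = 1.
Hypothesis oR : cell_orders (refined T).
Local Notation V := 'rV[R]_N.
Local Notation T' := (refined T).
Implicit Types (a b c k : node T) (s t u e f : {set node T}) (z w : {set node T'}).
Let oT' : ordered T' := ordered_refined oR.

Lemma sgn3_eq x y : x * x = 1 -> y * y = 1 -> (x * y) * (x * y) = 1 :> R.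
Proof. by move=> hx hy; rewrite mulrACA hx hy mul1r. Qed.

Lemma orn3_sqr a b c : a != b -> a != c -> b != c -> [set a; b; c] \in facets T ->
  orn3 a b c * orn3 a b c = 1.
Proof. by move=> ab ac bc fT; apply: sgn3_eq; [exact: orn_sqr|exact: (sgn3_sqr rT)]. Qed.

Lemma ornz_sqr z : z \in facets T' -> orn z * orn z = 1.
Proof.
move=> zT; have [a [b [c [ab ac bc fT zE]]]] := facet_flag rT zT; subst z.
have [-> _] := orient_flag rT oR ab ac bc fT; have [n1 n2 n3] := flag_neq ab ac bc.
by apply: sgn3_eq; [exact: orn3_sqr|exact: (sgn3_sqr oT')].
Qed.

(** A chain of cells that contains a node starts there. *)
Lemma dual_node a z : z \in dual [set a] = (z \in facets T') && ([set a] \in z).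
Proof.
rewrite inE cards1; apply/andP/andP => [[zT /andP[az _]]|[zT az]].
  by rewrite (cell_facet oT' zT).
rewrite (facet_cell oT' zT) az; split=> //; apply/forall_inP => s sz.
have /orP[//|] := refined_chain zT az sz.
have [f fT fz] := facet_top rT zT; have [s0 _] := flag_sub rT zT fT fz sz.
by rewrite subset1 (negbTE s0) orbF => /eqP->.
Qed.

Lemma spoke_cell t f : t \in cells T 1 -> f \in facets T -> t \subset f ->
  [set (t : node T'); f] \in cells T' 1.
Proof.
move=> /cellP[t2 _] fT tf; have [a [b [ab tE]]] := subset_card2 t2; subst t.
have af : a \in f by apply: (subsetP tf); rewrite !inE eqxx.
have bf : b \in f by apply: (subsetP tf); rewrite !inE eqxx orbT.
have [c [ac bc fE]] := card3_from2 (reg_card rT fT) af bf ab; subst f.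
have [n1 n2 n3] := flag_neq ab ac bc.
apply/cellP; rewrite cards2 n3; split=> //; exists (flag a b c); first exact: flag_facet.
by apply/subsetP => u; rewrite !inE => /orP[]/eqP->; rewrite eqxx ?orbT.
Qed.

Lemma dual_edge t w : t \in cells T 1 ->
  reflect (exists2 f, f \in facets T /\ t \subset f & w = [set (t : node T'); f]) (w \in dual t).
Proof.
move=> tT; have /cellP[t2 _] := tT; rewrite inE t2; apply: (iffP andP).
  move=> [wT /andP[tw /forall_inP sub]].
  have [a [b [c [ab ac bc fT wE]]]] := refined_edge rT wT.
  case: wE => wE; subst w.
  - have := sub [set a]; rewrite !inE eqxx => /(_ isT)/subset_leq_card.
    by rewrite t2 cards1.
  - have := sub [set a]; rewrite !inE eqxx => /(_ isT)/subset_leq_card.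
    by rewrite t2 cards1.
  - have /orP[/eqP tE|/eqP tE] : (t == [set a; b]) || (t == [set a; b; c]) by move: tw; rewrite !inE.
      by exists [set a; b; c]; rewrite ?tE//; split=> //; exact: subsetUl.
    by move: t2; rewrite tE cards3.
move=> [f [fT tf] ->]; rewrite spoke_cell//; split=> //.
rewrite !inE eqxx; apply/forall_inP => s; rewrite !inE => /orP[]/eqP->//.
Qed.

Lemma facet_node_cell f : f \in facets T -> [set (f : node T')] \in cells T' 0.
Proof.
move=> fT; have /card_gt0P[a af] : (0 < #|f|)%N by rewrite (reg_card rT fT).
have [b [c [ab ac bc fE]]] := card3_from (reg_card rT fT) af; subst f.
apply: (facet_node (flag_facet ab ac bc fT)).
by rewrite !inE eqxx !orbT.
Qed.

Lemma dual_facet t w : t \in facets T -> (w \in dual t) = (w == [set (t : node T')]).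
Proof.
move=> tT; rewrite inE (reg_card rT tT); apply/andP/eqP => [[wT /andP[tw _]]|->].
  have /cellP[/eqP/cards1P[s wE] _] := wT; move: tw; rewrite wE inE => /eqP<- //.
rewrite facet_node_cell//; split=> //; rewrite inE eqxx; apply/forall_inP => s.
by rewrite inE => /eqP->.
Qed.

Lemma chain_coef2 a z : z \in facets T' -> ([set a] : node T') \in z -> chain_coef 2 [set a] z = orn z.
Proof.
move=> zT az; rewrite /chain_coef dual_node zT az /=.
apply: eq_bigr => f _; congr (orn f * Num.sg (\det _)).
apply/matrixP => i j; rewrite !mxE; congr (nth _ _ _); apply: eq_map => k; congr (dbary _ _ _).
apply/rowP => l; rewrite !mxE; case: splitP => [i' ->|[]//].
by rewrite !mxE.
Qed.

Lemma chain_size2 a : chain_size 2 [set a] =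
  (#|[set z in facets T' | ([set a] : node T') \in z]|)%:R :> R.
Proof.
rewrite /chain_size -sum1_card natr_sum.
rewrite [LHS](big_setID [set z in facets T' | ([set a] : node T') \in z]) /= [X in _ + X]big1 ?addr0.
  rewrite (setIidPr _); last by apply/subsetP => z; rewrite inE => /andP[/(facet_cell oT')].
  apply: eq_bigr => z; rewrite inE => /andP[zT az]; rewrite chain_coef2//.
  have /eqP := ornz_sqr zT; rewrite -expr2 sqrf_eq1 => /orP[]/eqP->; rewrite ?normrN normr1//.
move=> z; rewrite inE => /andP[zn zT]; rewrite /chain_coef dual_node ifF ?normr0//.
by apply/negP; move: zn; rewrite inE => /negP.
Qed.

End DualCells.

(** * Orientation signs of dual cells *)

Section DualSigns.
Variables (R : realType) (N : nat) (T : bc_mesh R N).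
Hypothesis rT : regular T.
Hypothesis orn_sqr : forall K, K \in facets T -> orn K * orn K = 1.
Hypothesis oR : cell_orders (refined T).
Local Notation V := 'rV[R]_N.
Local Notation T' := (refined T).
Implicit Types (a b c k : node T) (s t u e f : {set node T}) (z w : {set node T'}).
Let oT' : ordered T' := ordered_refined oR.

Lemma edge_row (M : mesh R N) (oM : ordered M) (x y : node M) : x != y -> [set x; y] \in cells M 1 ->
  row 0 (edgemx 1 (vert [set x; y])) = sgn2 x y *: (pos y - pos x).
Proof.
move=> xy eM; rewrite /sgn2 /vert.
have -> : row 0 (edgemx 1 (map (@pos R N M) (ord [set x; y]))) =
  (map (@pos R N M) (ord [set x; y]))`_1 - (map (@pos R N M) (ord [set x; y]))`_0.
  by apply/rowP => j; rewrite !mxE.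
have [oE|oE] := perm2P xy (ord_edge oM xy eM); rewrite oE perm_sign2 /= !eqxx.
  by rewrite (eq_sym y x) (negbTE xy) /= mulr0 mulr1 subr0 scale1r.
by rewrite (eq_sym y x) (negbTE xy) /= mulr0 mulr1 sub0r scaleN1r opprB.
Qed.

Lemma sgn2_pm (M : mesh R N) (oM : ordered M) (x y : node M) : x != y -> [set x; y] \in cells M 1 ->
  sgn2 x y = 1 \/ sgn2 x y = -1.
Proof.
move=> xy eM; have /eqP := sgn2_sqr oM xy eM; rewrite -expr2 sqrf_eq1.
by case/orP => /eqP; [left|right].
Qed.

Lemma dlinZ (g : V -> R) (k : R) (v : V) : affine_fun g -> dlin g (k *: v) = k * dlin g v.
Proof.
by move=> ag; rewrite -[k *: v]addr0 -(scale0r v) dlin_comb// mul0r addr0.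
Qed.

(** In the coordinates (l_b, l_c) of the facet, the vector from the midpoint of
    ab to the barycenter of abc is (-1/6, 1/3) and that of the edge ab is
    (1, 0); their determinant is -1/3. *)
Lemma chain_coef1 a b c (t := [set a; b]) (f := [set a; b; c]) : a != b -> a != c -> b != c ->
  f \in facets T ->
  sgn2 (t : node T') f * chain_coef 1 t [set (t : node T'); f] = - (sgn2 a b * orn3 a b c).
Proof.
move=> ab ac bc fT; have [n1 n2 n3] := flag_neq ab ac bc.
have tT : t \in cells T 1 := facet_edge ab fT.
have tf : t \subset f by exact: subsetUl.
have wT := spoke_cell rT tT fT tf.
have wd : [set (t : node T'); f] \in dual t by apply/(dual_edge rT _ tT); exists f.
rewrite /chain_coef wd.
rewrite (big_pred1 f); last first.
  move=> u /=; rewrite !inE; apply/andP/eqP => [[uT /orP[/eqP uE|/eqP//]]|->].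
    by have := reg_card rT uT; rewrite uE cards2 ab.
  by rewrite fT eqxx orbT.
set E := col_mx _ _.
have E0 : row 0 E = sgn2 (t : node T') f *: (mid f - mid t).
  rewrite -[RHS](edge_row oT' n3 wT); apply/rowP => j; rewrite !mxE.
  by case: splitP => [[[]]// ? _|[[]]//]; rewrite !mxE.
have E1 : row 1 E = sgn2 a b *: (pos b - pos a).
  rewrite -(edge_row rT ab tT); apply/rowP => j; rewrite !mxE.
  by case: splitP => [[[]]//|[[]]// ? _]; rewrite !mxE.
have [-> _] := orient_nodes rT E ab ac bc fT.
rewrite /wedge2 E0 E1 !dlinZ ?dlin_sub; try exact: affine_bary.
have af : a \in f by rewrite mem3 eqxx.
have bf : b \in f by rewrite mem3 eqxx orbT.
have cf : c \in f by rewrite mem3 eqxx !orbT.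
have f0 : f != set0 by apply/set0Pn; exists a.
have t0 : t != set0 by apply/set0Pn; exists a; rewrite !inE eqxx.
rewrite !(bary_mid rT)// !(bary_pos rT)// bf cf !inE eqxx (eq_sym b a) (eq_sym c a) (eq_sym c b).
rewrite (negbTE ab) (negbTE ac) (negbTE bc) /= cards2 ab cards3//.
have sg3 : Num.sg (3%:R^-1 : R) = 1 by apply: gtr0_sg; rewrite invr_gt0 ltr0n.
set s1 := sgn2 _ _; set s2 := sgn2 _ _; set o := orn3 _ _ _.
have -> : s1 * (3%:R^-1 - (2%:R)^-1) * (s2 * (0%:R - 0%:R)) -
    s2 * (1%:R - 0%:R) * (s1 * (3%:R^-1 - 0)) = - (s1 * s2) * 3%:R^-1 by field.
rewrite sgrM sg3 mulr1.
have h1 : s1 = 1 \/ s1 = -1 := sgn2_pm oT' n3 wT.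
have h2 : s2 = 1 \/ s2 = -1 := sgn2_pm rT ab tT.
by case: h1 => ->; case: h2 => ->;
  rewrite ?mulr1 ?mul1r ?mulrN1 ?opprK ?mulN1r ?opprK ?sgrN ?sgr1; ring.
Qed.

Lemma chain_coef1_sqr a b c (t := [set a; b]) (f := [set a; b; c]) : a != b -> a != c -> b != c ->
  f \in facets T -> chain_coef 1 t [set (t : node T'); f] * chain_coef 1 t [set (t : node T'); f] = 1.
Proof.
move=> ab ac bc fT; have [n1 n2 n3] := flag_neq ab ac bc.
have tT : t \in cells T 1 := facet_edge ab fT.
have wT := spoke_cell rT tT fT (subsetUl _ _).
have h1 := chain_coef1 ab ac bc fT; have h2 := sgn2_sqr oT' n3 wT.
have h3 := orn3_sqr rT orn_sqr ab ac bc fT; have h4 := sgn2_sqr rT ab tT.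
rewrite -/t -/f in h1.
have : (sgn2 (t : node T') f * chain_coef 1 t [set (t : node T'); f]) *
  (sgn2 (t : node T') f * chain_coef 1 t [set (t : node T'); f]) = 1.
  by rewrite h1 mulrNN mulrACA h3 h4 mulr1.
by rewrite mulrACA h2 mul1r.
Qed.

Lemma edge_in_facet t f : t \in cells T 1 -> f \in facets T -> t \subset f ->
  exists a b c, [/\ a != b, a != c, b != c, t = [set a; b] & f = [set a; b; c]].
Proof.
move=> /cellP[t2 _] fT tf; have [a [b [ab tE]]] := subset_card2 t2; subst t.
have af : a \in f by apply: (subsetP tf); rewrite !inE eqxx.
have bf : b \in f by apply: (subsetP tf); rewrite !inE eqxx orbT.
by have [c [ac bc fE]] := card3_from2 (reg_card rT fT) af bf ab; exists a, b, c.
Qed.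

Lemma spoke_inj t f f' : #|t| = 2%N -> f \in facets T ->
  [set (t : node T'); f] = [set (t : node T'); f'] -> f = f'.
Proof.
move=> t2 fT h; have : (f : node T') \in [set (t : node T'); f'] by rewrite -h !inE eqxx orbT.
rewrite !inE => /orP[]/eqP // fE.
by have := reg_card rT fT; rewrite fE t2.
Qed.

Lemma chain_size1 t : t \in cells T 1 ->
  chain_size 1 t = (#|[set f in facets T | t \subset f]|)%:R :> R.
Proof.
move=> tT; have /cellP[t2 _] := tT; pose D := [set f in facets T | t \subset f].
rewrite /chain_size -sum1_card natr_sum.
transitivity (\sum_(w in [set [set (t : node T'); (f : node T')] | f in D]) `|chain_coef 1 t w|).
  rewrite [LHS](big_setID [set [set (t : node T'); (f : node T')] | f in D]) /= [X in _ + X]big1 ?addr0.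
    apply: eq_bigl => w; rewrite inE; apply/andP/idP => [[]//|wD]; split=> //.
    by move: wD => /imsetP[f]; rewrite inE => /andP[fT tf] ->; exact: spoke_cell.
  move=> w; rewrite inE => /andP[wn _]; rewrite /chain_coef.
  have [/(dual_edge rT _ tT)[f [fT tf] wE]|_] := boolP (w \in dual t); last by rewrite normr0.
  by case/negP: wn; rewrite wE; apply: imset_f; rewrite inE fT.
rewrite big_imset/=; last by move=> f f'; rewrite !inE => /andP[fT _] _; exact: spoke_inj.
apply: eq_bigr => f; rewrite inE => /andP[fT tf].
have [a [b [c [ab ac bc tE fE]]]] := edge_in_facet tT fT tf; subst t f.
have /eqP := chain_coef1_sqr ab ac bc fT.
by rewrite -expr2 sqrf_eq1 => /orP[]/eqP->; rewrite ?normrN normr1.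
Qed.

Lemma chain_coef0 t : t \in facets T -> chain_coef 0 t [set (t : node T')] = orn t.
Proof.
move=> tT; rewrite /chain_coef (dual_facet rT)// eqxx (big_pred1 t); last first.
  by move=> u /=; rewrite inE; apply/andP/eqP => [[_ /eqP]|->]; rewrite ?tT ?eqxx.
transitivity (orient t (1%:M *m edgemx 2 (vert t))); last by rewrite (orient_edgemx rT)// det1 sgr1 mulr1.
rewrite mul1mx; congr (orn t * Num.sg (\det _)).
apply/matrixP => i j; rewrite !mxE; congr (nth _ _ _); apply: eq_map => k; congr (dbary _ _ _).
apply/rowP => l; rewrite !mxE; case: splitP => [[]//|i' ->].
by rewrite !mxE.
Qed.

Lemma chain_size0 t : t \in facets T -> chain_size 0 t = 1 :> R.
Proof.
move=> tT; rewrite /chain_size (bigD1 [set (t : node T')]) ?facet_node_cell//= big1 ?addr0.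
  rewrite chain_coef0//; have /eqP := orn_sqr tT.
  by rewrite -expr2 sqrf_eq1 => /orP[]/eqP->; rewrite ?normrN normr1.
by move=> w /andP[_ wt]; rewrite /chain_coef (dual_facet rT)// (negbTE wt) normr0.
Qed.

(** The dual edge and the triangle z are both oriented by the surface, so that
    their relative sign does not depend on the facet f. *)
Lemma corner_sign a b c (t := [set a; b]) (f := [set a; b; c]) (z := flag a b c) :
  a != b -> a != c -> b != c -> f \in facets T ->
  orn z * incid [set (t : node T'); f] z * chain_coef 1 t [set (t : node T'); f] = incid [set a] t.
Proof.
move=> ab ac bc fT; have [n1 n2 n3] := flag_neq ab ac bc.
have tT : t \in cells T 1 := facet_edge ab fT.
have zT : z \in facets T' := flag_facet ab ac bc fT.
have zE : z = [set (t : node T'); (f : node T'); ([set a] : node T')] by exact: set3_rot.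
have m1 : (t : node T') != [set a] by rewrite eq_sym.
have m2 : (f : node T') != [set a] by rewrite eq_sym.
have zT2 : [set (t : node T'); (f : node T'); ([set a] : node T')] \in facets T' by rewrite -zE.
rewrite zE (orn_incid oT' n3 m1 m2 zT2) mulrAC (chain_coef1 ab ac bc fT).
have -> : orn3 (t : node T') f [set a] = orn3 ([set a] : node T') t f.
  exact: esym (orn3_rot oT' n3 m1 m2 zT2).
rewrite (orn3_flag rT oR ab ac bc fT) mulNr -mulrA (orn3_sqr rT orn_sqr ab ac bc fT) mulr1.
by rewrite (incid_edge rT ab tT) (sgn2C rT ab tT).
Qed.

End DualSigns.

Section DoubleIncidence.
Variables (R : realType) (N : nat) (M : mesh R N).
Hypothesis oM : ordered M.

(** This is dd = 0 for the cochains of the mesh. *)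
Lemma incid_incid (u : node M) (K : {set node M}) : K \in facets M ->
  \sum_(s in cells M 1) incid [set u] s * incid s K = 0.
Proof.
move=> KM; have [uK|uK] := boolP (u \in K); last first.
  apply: big1 => s _; have [us|us] := boolP ([set u] \subset s); last by rewrite incid0// mul0r.
  rewrite [incid s K]incid0 ?mulr0//; apply: contra uK => /subsetP; apply.
  by rewrite -sub1set.
have [b [c [ub uc bc KE]]] := card3_from (reg_card oM KM) uK; subst K.
have KM' : [set u; c; b] \in facets M by rewrite set3C23.
have cb : c != b by rewrite eq_sym.
have ubM := facet_edge ub KM; have ucM := facet_edge uc KM'.
rewrite (sum_edges_at (F := fun s => incid [set u] s * incid s [set u; b; c]) ub uc bc KM).
  rewrite !(incid_edge oM)// (incid_facet oM)// -[in incid [set u; c] _]set3C23 (incid_facet oM)//.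
  rewrite (sgn3C23 oM ub uc bc KM) (sgn2C oM ub ubM) (sgn2C oM uc ucM).
  have h1 := sgn2_sqr oM ub ubM; have h2 := sgn2_sqr oM uc ucM; move: h1 h2.
  move: (sgn2 u b) (sgn2 u c) (sgn3 u b c) => p q r hp hq.
  have -> : - p * (p * r) + - q * (q * - r) = (q * q - p * p) * r by ring.
  by rewrite hp hq subrr mul0r.
move=> s h; split.
  by apply: contraNT h; rewrite -sub1set => us; rewrite incid0// mul0r.
by apply: contraNT h => sK; rewrite [incid s _]incid0 ?mulr0.
Qed.
End DoubleIncidence.

(** * Supports of the coefficients *)

Section Supports.
Variables (R : realType) (N : nat) (T : bc_mesh R N).
Hypothesis rT : regular T.
Hypothesis oR : cell_orders (refined T).
Local Notation V := 'rV[R]_N.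
Local Notation T' := (refined T).
Implicit Types (a b c k x y : node T) (s t u e f : {set node T}) (z w : {set node T'}).
Let oT' : ordered T' := ordered_refined oR.

(** The regions U of an edge and of a facet are of this form, with S the set of
    its nodes. *)
Definition corners_in (U : {set {set node T'}}) (S : {set node T}) : Prop :=
  forall z, z \in U = (z \in facets T') && [exists x in S, ([set x] : node T') \in z].

Lemma mem_bd_sub (U : {set {set node T'}}) w z : z \in U -> w \subset z -> #|z| = #|w|.+1 ->
  (forall z', z' \in U -> w \subset z' -> z' = z) -> w \in bd U.
Proof.
move=> zU wz cz uz; rewrite inE; apply/cards1P; exists z; apply/setP => z'; rewrite !inE.
apply/andP/eqP => [[z'U /andP[wz' _]]|->]; first exact: uz.
by rewrite zU wz cz eqxx.
Qed.

Lemma bd_member (U : {set {set node T'}}) w : w \in bd U -> exists2 z, z \in U & w \subset z.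
Proof.
rewrite inE => /cards1P[z zE]; have : z \in [set z] by rewrite inE.
by rewrite -zE inE => /andP[zU /andP[wz _]]; exists z.
Qed.

Lemma flag_corner a z : z \in facets T' -> ([set a] : node T') \in z -> exists b c,
  [/\ a != b, a != c, b != c, [set a; b; c] \in facets T & z = flag a b c].
Proof.
move=> zT; have [a' [b [c [ab ac bc fT zE]]]] := facet_flag rT zT; subst z.
by move=> az; exists b, c; rewrite (mem_flag1 ab ac bc az).
Qed.

Lemma link_facets a y c z : a != y -> a != c -> y != c -> [set a; y; c] \in facets T ->
  z \in facets T' -> [set ([set a; y] : node T'); [set a; y; c]] \subset z ->
  z = flag a y c \/ z = flag y a c.
Proof.
move=> ay ac yc fT zT /subsetP sub.
have m1 : ([set a; y] : node T') \in z by apply: sub; rewrite !inE eqxx.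
have m2 : ([set a; y; c] : node T') \in z by apply: sub; rewrite !inE eqxx orbT.
have [c' [ac' yc' fE zE]] := flag_of_link rT zT ay fT m1 m2.
have cc : c = c' by exact: (set3_inj ac yc).
by subst c'.
Qed.

Lemma link_sub a y c : [set ([set a; y] : node T'); [set a; y; c]] \subset flag a y c.
Proof. by apply/subsetP => u; rewrite !inE => /orP[]/eqP->; rewrite eqxx ?orbT. Qed.

(** The two triangles at the edge from the midpoint of ay to the barycenter of
    ayc have their corners at a and y. *)
Lemma link_bd (U : {set {set node T'}}) S a y c : corners_in U S ->
  a != y -> a != c -> y != c -> [set a; y; c] \in facets T -> a \in S -> y \notin S ->
  [set ([set a; y] : node T'); [set a; y; c]] \in bd U.
Proof.
move=> hU ay ac yc fT aS yS; have [n1 n2 n3] := flag_neq ay ac yc.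
have zT := flag_facet ay ac yc fT.
apply: (mem_bd_sub (z := flag a y c)).
- rewrite hU zT; apply/exists_inP; exists a => //; by rewrite mem3 eqxx.
- exact: link_sub.
- by rewrite (reg_card oT' zT) cards2 n3.
move=> z'; rewrite hU => /andP[z'T /exists_inP[x xS xz]] sub.
have [//|zE] := link_facets ay ac yc fT z'T sub.
have ya : y != a by rewrite eq_sym.
move: xz; rewrite zE => /(mem_flag1 ya yc ac) xy.
by move: yS; rewrite -xy xS.
Qed.

Lemma corners_dual a : corners_in (dual [set a]) [set a].
Proof.
move=> z; rewrite (dual_node rT oR); congr (_ && _); apply/idP/exists_inP => [az|[x]].
  by exists a => //; rewrite inE.
by rewrite inE => /eqP->.
Qed.

Lemma dual_edge_bd a b : a != b -> [set a; b] \in cells T 1 -> dual [set a; b] \subset bd (dual [set a]).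
Proof.
move=> ab tT; apply/subsetP => w /(dual_edge rT _ tT)[f [fT tf] wE].
have af : a \in f by apply: (subsetP tf); rewrite !inE eqxx.
have bf : b \in f by apply: (subsetP tf); rewrite !inE eqxx orbT.
have [c [ac bc fE]] := card3_from2 (reg_card rT fT) af bf ab; subst f w.
by apply: (link_bd (@corners_dual a)) => //; rewrite !inE// eq_sym.
Qed.

Lemma corners_Udom1 t : t \in cells T 1 -> corners_in (Udom 1 t) t.
Proof.
move=> tT z; have /cellP[t2 [f fT tf]] := tT; apply/bigcupP/andP.
  move=> [s /andP[sT /subsetP sub]]; have /cellP[/eqP/cards1P[a sE] _] := sT; subst s.
  rewrite /= (dual_node rT oR) => /andP[zT az]; split=> //; apply/exists_inP; exists a => //.
  have /sub/bd_member[z'] : [set (t : node T'); f] \in dual t by apply/(dual_edge rT _ tT); exists f.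
  rewrite (dual_node rT oR) => /andP[z'T az'] /subsetP tz'.
  have tz : (t : node T') \in z' by apply: tz'; rewrite !inE eqxx.
  have /orP[] := refined_chain z'T az' tz; first by rewrite sub1set.
  by move=> /subset_leq_card; rewrite t2 cards1.
move=> [zT /exists_inP[a at_ az]].
exists [set a]; last by rewrite /= (dual_node rT oR) zT.
have [x [y [xy tE]]] := subset_card2 t2.
have [b [ab tab]] : exists b, a != b /\ t = [set a; b].
  move: at_; rewrite tE !inE => /orP[]/eqP->; first by exists y.
  by exists x; rewrite eq_sym xy setUC.
rewrite (facet_node fT (subsetP tf _ at_)) tab dual_edge_bd// -?tab//.
Qed.

Lemma corners_Udom2 t : t \in facets T -> corners_in (Udom 2 t) t.
Proof.
move=> tT z; apply/bigcupP/andP.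
  move=> [e /andP[eT /subsetP sub]]; rewrite corners_Udom1// => /andP[zT /exists_inP[a ae az]].
  split=> //; apply/exists_inP; exists a => //.
  have /sub/bd_member[w /(dual_edge rT _ eT)[f [fT ef] ->]] : [set (t : node T')] \in dual t.
    by rewrite (dual_facet rT)// eqxx.
  rewrite sub1set !inE => /orP[]/eqP tE.
    by have := reg_card rT tT; rewrite tE; have /cellP[->] := eT.
  by rewrite tE; exact: (subsetP ef).
move=> [zT /exists_inP[a at_ az]].
have [b [c [ab ac bc tE]]] := card3_from (reg_card rT tT) at_; subst t.
have eT := facet_edge ab tT; have [n1 n2 n3] := flag_neq ab ac bc.
exists [set a; b]; last first.
  by rewrite corners_Udom1// zT; apply/exists_inP; exists a => //; rewrite !inE eqxx.
rewrite eT; apply/subsetP => w; rewrite (dual_facet rT)// => /eqP->.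
have sub : [set a; b] \subset [set a; b; c] by exact: subsetUl.
apply: (mem_bd_sub (z := [set ([set a; b] : node T'); [set a; b; c]])).
- by apply/(dual_edge rT _ eT); exists [set a; b; c].
- by rewrite sub1set !inE eqxx orbT.
- by rewrite cards2 cards1 n3.
move=> w' /(dual_edge rT _ eT)[f [fT ef] ->]; rewrite sub1set !inE => /orP[/eqP h|/eqP ->//].
by rewrite h eqxx in n3.
Qed.

Lemma on_bd_sub (U : {set {set node T'}}) w w' : w' \in bd U -> w \subset w' -> on_bd U w.
Proof. by move=> wU ww; apply/existsP; exists w'; rewrite wU. Qed.

(** The only facet at a boundary edge of the surface is also the only one
    within a region that contains it. *)
Lemma bd_inherit (U : {set {set node T'}}) w z : U \subset facets T' -> w \in bd (facets T') ->
  z \in U -> w \subset z -> w \in bd U.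
Proof.
move=> /subsetP UT /(bdP oT')[w2 [K [KT wK uK]]] zU wz.
have zE := uK z (UT z zU) wz; subst z.
apply: (mem_bd_sub zU wz); first by rewrite (reg_card oT' KT) w2.
by move=> z' /UT z'T wz'; exact: uK.
Qed.

Lemma corners_sub (U : {set {set node T'}}) S : corners_in U S -> U \subset facets T'.
Proof. by move=> hU; apply/subsetP => z; rewrite hU => /andP[]. Qed.

Hypothesis rule1 : bc_rule1 T.

Lemma support2 a z : [set a] \in cells T 0 -> z \in facets T' -> ([set a] : node T') \notin z ->
  coef 2 [set a] z = 0.
Proof.
move=> aT zT az; apply: (rule1 (r := 0)) => //; first exact: facet_cell.
apply/orP; left; apply/existsP => -[z' /= /andP[]]; rewrite (dual_node rT oR) => /andP[z'T az'] zz'.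
move: az; suff -> : z = z' by rewrite az'.
by apply/eqP; rewrite eqEcard zz' (reg_card oT' zT) (reg_card oT' z'T).
Qed.

Lemma coef_covered r t w : (r <= 2)%N -> t \in cells T r -> w \in cells T' (2 - r) ->
  coef (2 - r) t w != 0 -> (exists2 z, z \in Udom r t & w \subset z) /\ ~~ on_bd (Udom r t) w.
Proof.
move=> r2 tT wT h; have := rule1 r2 tT wT.
case: (boolP (covered _ _)) => [/existsP[z /andP[zU wz]]|_] /=; last first.
  by move=> /(_ isT) h0; move: h; rewrite h0 eqxx.
case: (boolP (on_bd _ _)) => [_|nb]; first by move=> /(_ isT) h0; move: h; rewrite h0 eqxx.
by move=> _; split=> //; exists z.
Qed.

Lemma no_trace1 t w : t \in cells T 1 -> w \in cells T' 1 -> coef 1 t w != 0 ->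
  ~~ on_bd (facets T') w.
Proof.
move=> tT wT h; have [[z zU wz] nb] := coef_covered (r := 1) isT tT wT h.
apply: contra nb; rewrite (on_bd_edge oT'); last by have /cellP[] := wT.
move=> wb; apply: (on_bd_sub (w' := w)) => //.
exact: bd_inherit (corners_sub (corners_Udom1 tT)) wb zU wz.
Qed.

(** All other edges of the region of t join the midpoint of an edge at one
    endpoint of t to the barycenter of a facet, hence are on the boundary of
    the region. *)
Lemma support1 t w : t \in cells T 1 -> w \in cells T' 1 -> coef 1 t w != 0 ->
  (exists2 a, a \in t & ([set a] : node T') \in w) \/ w \in dual t.
Proof.
move=> tT wT h; have [[z zU wz] nb] := coef_covered (r := 1) isT tT wT h.
have hU := corners_Udom1 tT; move: zU; rewrite hU => /andP[zT /exists_inP[a at_ az]].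
have [aw|aw] := boolP (([set a] : node T') \in w); first by left; exists a.
have [a1 [b1 [c1 [ab ac bc fT wE]]]] := refined_edge rT wT.
have corner x : ([set x] : node T') \in z -> x = a.
  by have [b [c [n1 n2 n3 _ zE]]] := flag_corner zT az; rewrite zE; exact: mem_flag1.
case: wE => wE.
- have : ([set a1] : node T') \in w by rewrite wE !inE eqxx.
  by move=> h1; move: (h1) aw => /(subsetP wz)/corner <-; rewrite h1.
- have : ([set a1] : node T') \in w by rewrite wE !inE eqxx.
  by move=> h1; move: (h1) aw => /(subsetP wz)/corner <-; rewrite h1.
right; have {}wz := wz; rewrite wE in wz.
have key x y : x != y -> x != c1 -> y != c1 -> [set x; y; c1] \in facets T ->
    w = [set ([set x; y] : node T'); [set x; y; c1]] -> z = flag x y c1 -> w \in dual t.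
  move=> xy xc yc fT' wE' zE'.
  have xa : x = a by apply: corner; rewrite zE' !inE eqxx.
  subst x.
  have [yt|yt] := boolP (y \in t); last first.
    by case/negP: nb; apply: (on_bd_sub (w' := w)) => //; rewrite wE'; exact: (link_bd hU).
  have tE : t = [set a; y].
    apply/esym/eqP; rewrite eqEcard; have /cellP[-> _] := tT; rewrite cards2 xy andbT.
    by apply/subsetP => u; rewrite !inE => /orP[]/eqP->.
  by apply/(dual_edge rT _ tT); exists [set a; y; c1]; rewrite ?wE' ?tE//; split=> //; exact: subsetUl.
have [zE|zE] := link_facets ab ac bc fT zT wz; first exact: (key a1 b1).
apply: (key b1 a1) => //; first by rewrite eq_sym.
  by rewrite set3C12.
by rewrite wE set3C12 [[set b1; a1]]setUC.
Qed.

(** The other nodes of the region of t are on such edges with only one end of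
    the primal edge in t, hence on the boundary of the region. *)
Lemma support0 t (p : node T') : t \in facets T -> [set p] \in cells T' 0 -> coef 0 t [set p] != 0 ->
  (p : {set node T}) \subset t.
Proof.
move=> tT pT h; have [[z zU wz] nb] := coef_covered (r := 2) isT (facet_cell rT tT) pT h.
have hU := corners_Udom2 tT; move: zU; rewrite hU => /andP[zT /exists_inP[a at_ az]].
have [y [c [ay ac yc fT zE]]] := flag_corner zT az.
have pz : p \in z by rewrite -sub1set.
have stop w : w \in bd (Udom 2 t) -> p \in w -> False.
  by move=> wb pw; case/negP: nb; apply: (on_bd_sub wb); rewrite sub1set.
have [yt|yt] := boolP (y \in t); last first.
  have wb := link_bd hU ay ac yc fT at_ yt.
  move: pz; rewrite zE mem3 => /or3P[]/eqP pE; first by rewrite pE sub1set.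
    by case: (stop _ wb); rewrite pE !inE eqxx.
  by case: (stop _ wb); rewrite pE !inE eqxx orbT.
have sub2 : [set a; y] \subset t by apply/subsetP => u; rewrite !inE => /orP[]/eqP->.
have [ct|ct] := boolP (c \in t).
  have sub3 : [set a; y; c] \subset t by apply/subsetP => u; rewrite mem3 => /or3P[]/eqP->.
  by move: pz; rewrite zE mem3 => /or3P[]/eqP->//; rewrite sub1set.
have cy : c != y by rewrite eq_sym.
have fT' : [set a; c; y] \in facets T by rewrite set3C23.
have wb := link_bd hU ac ay cy fT' at_ ct.
move: pz; rewrite zE mem3 => /or3P[]/eqP pE; rewrite pE ?sub1set//.
by case: (stop _ wb); rewrite pE !inE set3C23 eqxx orbT.
Qed.

Lemma no_trace0 t w : t \in facets T -> w \in cells T' 0 -> coef 0 t w != 0 ->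
  ~~ on_bd (facets T') w.
Proof.
move=> tT wT h; have /cellP[/eqP/cards1P[p wE] _] := wT; subst w.
have pt := support0 tT wT h.
have [_ nb] := coef_covered (r := 2) isT (facet_cell rT tT) wT h.
apply: contra nb => /existsP[u /andP[ub pu]].
have hU := corners_Udom2 tT.
have [u2 [K [KT uK uniq]]] := bdP oT' ub.
have [x [y [c [xy xc yc fT KE]]]] := facet_flag rT KT.
have pK : p \in K by apply: (subsetP uK); rewrite -sub1set.
have xt : x \in t.
  apply: (subsetP pt); move: pK; rewrite KE mem3 => /or3P[]/eqP->; rewrite !inE eqxx//.
apply: (on_bd_sub _ pu); apply: (bd_inherit (corners_sub hU) ub (z := K)) => //.
by rewrite hU KT; apply/exists_inP; exists x => //; rewrite KE mem3 eqxx.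
Qed.

Lemma no_trace_rules : no_trace T.
Proof.
move=> [|[|//]] t w _ tT wT h; first by apply: (no_trace0 _ wT h); exact: (cell_facet rT).
exact: (no_trace1 tT wT h).
Qed.
End Supports.

(** * The equations of the edges *)

Section EdgeEquations.
Variables (R : realType) (N : nat) (T : bc_mesh R N).
Hypothesis rT : regular T.
Hypothesis orn_sqr : forall K, K \in facets T -> orn K * orn K = 1.
Hypothesis oR : cell_orders (refined T).
Hypotheses (rule1 : bc_rule1 T) (rule2 : bc_rule2 T).
Local Notation V := 'rV[R]_N.
Local Notation T' := (refined T).
Implicit Types (a b c k x y : node T) (s t u e f : {set node T}) (z w : {set node T'}).
Let oT' : ordered T' := ordered_refined oR.

Lemma corner_unique x a z : z \in facets T' -> ([set a] : node T') \in z ->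
  ([set x] : node T') \in z -> x = a.
Proof.
move=> zT az; have [b [c [n1 n2 n3 _ ->]]] := flag_corner rT zT az; exact: mem_flag1.
Qed.

Lemma dual_edgeE t : t \in cells T 1 ->
  dual t = [set [set (t : node T'); (f : node T')] | f in [set f in facets T | t \subset f]].
Proof.
move=> tT; apply/setP => w; apply/(dual_edge rT _ tT)/imsetP => -[f].
  by move=> [fT tf] ->; exists f => //; rewrite inE fT.
by rewrite inE => /andP[fT tf] ->; exists f.
Qed.

Lemma sum_dual_edge t (g : {set node T'} -> R) : t \in cells T 1 ->
  \sum_(w in dual t) g w = \sum_(f in facets T | t \subset f) g [set (t : node T'); f].
Proof.
move=> tT; rewrite dual_edgeE// big_imset/=; last first.
  move=> f f'; rewrite !inE => /andP[fT _] _; apply: (spoke_inj rT) => //.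
  by have /cellP[] := tT.
by apply: eq_bigl => f; rewrite inE.
Qed.

Lemma coef2 a z : z \in facets T' -> ([set a] : node T') \in z -> [set a] \in cells T 0 ->
  coef 2 [set a] z = orn z / chain_size 2 [set a].
Proof.
move=> zT az aT; have cc := chain_coef2 rT oR zT az.
have := rule2 (r := 0) isT aT (facet_cell oT' zT); rewrite subn0 cc; apply.
by apply/eqP => o0; have /eqP := ornz_sqr rT orn_sqr oR zT; rewrite o0 mul0r eq_sym oner_eq0.
Qed.

Lemma coef1 t f : t \in cells T 1 -> f \in facets T -> t \subset f ->
  coef 1 t [set (t : node T'); f] =
  chain_coef 1 t [set (t : node T'); f] / (#|[set f in facets T | t \subset f]|)%:R.
Proof.
move=> tT fT tf; rewrite -(chain_size1 rT orn_sqr oR tT).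
apply: (rule2 (r := 1)) => //; first exact: spoke_cell.
have [a [b [c [ab ac bc tE fE]]]] := edge_in_facet rT tT fT tf; subst t f.
apply/eqP => c0; have /eqP := chain_coef1_sqr rT orn_sqr oR ab ac bc fT.
by rewrite c0 mul0r eq_sym oner_eq0.
Qed.

Definition lhs0 t z : R := \sum_(w in cells T' 1 | w \subset z) coef 1 t w * incid w z.
Definition rhs0 t z : R := \sum_(s in cells T 0 | s \subset t) incid s t * coef 2 s z.

Lemma rhs0_corner t a z : t \in cells T 1 -> a \in t -> z \in facets T' ->
  ([set a] : node T') \in z -> rhs0 t z = incid [set a] t * (orn z / chain_size 2 [set a]).
Proof.
move=> tT at_ zT az; have /cellP[_ [f fT tf]] := tT.
have aT : [set a] \in cells T 0 := facet_node fT (subsetP tf _ at_).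
rewrite /rhs0 (bigD1 [set a]) /=; last by rewrite aT sub1set.
rewrite coef2// big1 ?addr0// => s /andP[/andP[sT st] sa].
have /cellP[/eqP/cards1P[x sE] _] := sT; subst s.
rewrite (support2 rT oR rule1)// ?mulr0//; apply: contra sa => xz.
by rewrite (corner_unique zT az xz).
Qed.

(** An edge of the refinement that ends at a lies in two triangles around a,
    which cancel, or on the boundary, where the coefficient vanishes.  The
    halves of the dual edge of t remain; each lies in one of the triangles. *)
Lemma sum_lhs0 t a : t \in cells T 1 -> a \in t ->
  \sum_(z in facets T' | ([set a] : node T') \in z) orn z * lhs0 t z = incid [set a] t.
Proof.
move=> tT at_; have /cellP[t2 [f0 f0T tf0]] := tT.
pose S w : R := \sum_(z in facets T' | (([set a] : node T') \in z) && (w \subset z)) orn z * incid w z.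
transitivity (\sum_(w in cells T' 1) coef 1 t w * S w).
  rewrite /lhs0; under eq_bigr do rewrite mulr_sumr.
  rewrite (exchange_big_dep (fun w => w \in cells T' 1)) /=; last by move=> z w _ /andP[].
  apply: eq_bigr => w wT; rewrite /S mulr_sumr.
  apply: eq_big => [z|z _]; last by rewrite mulrCA.
  by rewrite wT -andbA.
have key w : w \in cells T' 1 -> w \notin dual t -> coef 1 t w * S w = 0.
  move=> wT wd; have [->|h] := eqVneq (coef 1 t w) 0; first by rewrite mul0r.
  have [[x xt xw]|wd'] := support1 rT oR rule1 tT wT h; last by rewrite wd' in wd.
  have nb := no_trace1 rT oR rule1 tT wT h.
  have [xa|xa] := eqVneq x a.
    rewrite -[X in _ * X](_ : 0 = _) ?mulr0// -(coherent_refined rT oR wT nb).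
    apply: eq_bigl => z; rewrite andbCA; case: (boolP (w \subset z)) => [/subsetP wz|_]; last by rewrite !andbF.
    by rewrite -xa wz//.
  rewrite /S big_pred0 ?mulr0// => z; apply/negP => /andP[zT /andP[az /subsetP wz]].
  by case/eqP: xa; apply: (corner_unique zT az); exact: wz.
rewrite (big_setID (dual t)) /= [X in _ + X]big1 ?addr0; last first.
  by move=> w; rewrite inE => /andP[wd wT]; exact: key.
rewrite (setIidPr _); last first.
  by apply/subsetP => w /(dual_edge rT _ tT)[f [fT tf] ->]; exact: spoke_cell.
rewrite (sum_dual_edge _ tT); set n := #|[set f in facets T | t \subset f]|.
have n0 : n%:R != 0 :> R.
  by rewrite pnatr_eq0 -lt0n; apply/card_gt0P; exists f0; rewrite inE f0T.
transitivity (\sum_(f in facets T | t \subset f) incid [set a] t / n%:R).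
  apply: eq_bigr => f /andP[fT tf]; rewrite coef1// -/n.
  have [b [ab tE]] : exists b, a != b /\ t = [set a; b].
    have [x [y [xy tE]]] := subset_card2 t2.
    move: at_; rewrite tE !inE => /orP[]/eqP->; first by exists y.
    by exists x; rewrite eq_sym xy setUC.
  have bf : b \in f by apply: (subsetP tf); rewrite tE !inE eqxx orbT.
  have [c [ac bc fE]] := card3_from2 (reg_card rT fT) (subsetP tf _ at_) bf ab.
  rewrite /S (big_pred1 (flag a b c)); last first.
    move=> z; apply/and3P/eqP => [[zT az wz]|->].
      rewrite tE fE in wz; rewrite fE in fT.
      have [//|zE] := link_facets rT ab ac bc fT zT wz.
      have ba : b != a by rewrite eq_sym.
      by move: az ab; rewrite zE => /(mem_flag1 ba bc ac)->; rewrite eqxx.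
    split; [by apply: (flag_facet ab ac bc); rewrite -fE|by rewrite mem3 eqxx|].
    by rewrite tE fE; exact: link_sub.
  rewrite fE in fT; have := corner_sign rT orn_sqr oR ab ac bc fT.
  rewrite tE fE => <-; move: (orn _) (incid _ _) (chain_coef _ _ _) => p q r.
  by rewrite mulrAC [r * _]mulrC.
rewrite (eq_bigl (fun f => f \in [set f in facets T | t \subset f])); last by move=> f; rewrite inE.
by rewrite sumr_const -[_ *+ _]mulr_natr divfK.
Qed.

Lemma sum_rhs0 t a z : t \in cells T 1 -> a \in t -> z \in facets T' -> ([set a] : node T') \in z ->
  \sum_(z in facets T' | ([set a] : node T') \in z) orn z * rhs0 t z = incid [set a] t.
Proof.
move=> tT at_ zT az; set D := [set z in facets T' | ([set a] : node T') \in z].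
rewrite (eq_bigl (fun z => z \in D)); last by move=> z'; rewrite [z' \in D]in_set.
have n0 : #|D|%:R != 0 :> R.
  by rewrite pnatr_eq0 -lt0n; apply/card_gt0P; exists z; rewrite [z \in D]in_set zT.
transitivity (\sum_(z in D) incid [set a] t / #|D|%:R).
  apply: eq_bigr => z'; rewrite in_set => /andP[z'T az'].
  rewrite (rhs0_corner tT at_ z'T az') (chain_size2 rT orn_sqr oR) -/D.
  by rewrite mulrCA [orn z' * (_ / _)]mulrA (ornz_sqr rT orn_sqr oR z'T) mul1r.
by rewrite sumr_const -[_ *+ _]mulr_natr divfK.
Qed.

Lemma no_corner_equation t z : t \in cells T 1 -> z \in facets T' ->
  (forall a, a \in t -> ([set a] : node T') \notin z) -> lhs0 t z = 0 /\ rhs0 t z = 0.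
Proof.
move=> tT zT nc; split.
  apply: big1 => w /andP[wT /subsetP wz].
  have [->|h] := eqVneq (coef 1 t w) 0; first by rewrite mul0r.
  have [[x xt xw]|/(dual_edge rT _ tT)[f [fT tf] wE]] := support1 rT oR rule1 tT wT h.
    by have := nc x xt; rewrite wz.
  have tz : (t : node T') \in z by apply: wz; rewrite wE !inE eqxx.
  have [x [y [c [xy xc yc gT zE]]]] := facet_flag rT zT.
  have xz : ([set x] : node T') \in z by rewrite zE mem3 eqxx.
  have /orP[|/subset_leq_card] := refined_chain zT xz tz.
    by rewrite sub1set => /nc; rewrite xz.
  by rewrite cards1; have /cellP[-> _] := tT.
apply: big1 => s /andP[sT st]; have /cellP[/eqP/cards1P[x sE] _] := sT; subst s.
rewrite (support2 rT oR rule1)// ?mulr0//; apply: nc.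
by rewrite -sub1set.
Qed.

Hypothesis rule4 : bc_rule4_edges T.

(** Both sides have the same sum over the triangles around an endpoint of t, so
    that the last equation follows from the others. *)
Lemma equation0 t z : t \in cells T 1 -> z \in facets T' -> bc_equation 0 t z.
Proof.
move=> tT zT; suff : lhs0 t z = rhs0 t z by rewrite /bc_equation expr0 mul1r.
have [/exists_inP[a at_ az]|nc] := boolP [exists x in t, ([set x] : node T') \in z]; last first.
  have [|-> ->//] := no_corner_equation tT zT.
  by move=> a at_; apply: contra nc => az; apply/exists_inP; exists a.
have [z0 hz0] := rule4 tT at_.
have other z' : z' \in facets T' -> ([set a] : node T') \in z' -> z' != z0 -> lhs0 t z' = rhs0 t z'.
  by move=> z'T az' zz; have := hz0 z' z'T az' zz; rewrite /bc_equation expr0 mul1r.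
have [zz|zz] := eqVneq z z0; last exact: other.
have := sum_lhs0 tT at_; rewrite -(sum_rhs0 tT at_ zT az) => /eqP.
rewrite (bigD1 z) ?zT//= [X in _ == X](bigD1 z) ?zT//=.
rewrite (eq_bigr (fun z' => orn z' * rhs0 t z')); last first.
  by move=> z' /andP[/andP[z'T az'] nz]; rewrite other// -zz.
move=> /eqP/addIr /(congr1 (fun r => orn z * r)).
by rewrite !mulrA (ornz_sqr rT orn_sqr oR zT) !mul1r.
Qed.

End EdgeEquations.

(** * The defect of the equations of the facets *)

Section Ends.
Variables (R : realType) (N : nat) (M : mesh R N).
Hypothesis oM : ordered M.

Lemma incid_dropr r (c : {set node M} -> R) (z : {set node M}) :
  \sum_(w in cells M r | w \subset z) c w * incid w z = \sum_(w in cells M r) c w * incid w z.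
Proof.
rewrite big_mkcondr; apply: eq_bigr => w _; case: ifPn => // wz.
by rewrite incid0// mulr0.
Qed.

Lemma incid_dropl r (c : {set node M} -> R) (z : {set node M}) :
  \sum_(w in cells M r | w \subset z) incid w z * c w = \sum_(w in cells M r) incid w z * c w.
Proof.
rewrite big_mkcondr; apply: eq_bigr => w _; case: ifPn => // wz.
by rewrite incid0// mul0r.
Qed.

Lemma sgn_unit (x y v : node M) : x != y -> x != v -> y != v ->
  [set x; y; v] \in facets M -> incid [set x; y] [set x; y; v] != 0 :> R.
Proof.
move=> xy xv yv KM; rewrite (incid_facet oM)//; apply/eqP => h.
have := sgn2_sqr oM xy (facet_edge xy KM); have := sgn3_sqr oM xy xv yv KM.
move=> h3 h2; have : (sgn2 x y * sgn3 x y v) * (sgn2 x y * sgn3 x y v) = 1.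
  by rewrite mulrACA h2 h3 mulr1.
by rewrite h mul0r => /eqP; rewrite eq_sym oner_eq0.
Qed.

Lemma sum_ends (g : {set node M} -> R) (p q : node M) : p != q -> [set p; q] \in cells M 1 ->
  \sum_(w in cells M 0 | w \subset [set p; q]) g w * incid w [set p; q] =
  sgn2 p q * (g [set q] - g [set p]).
Proof.
move=> pq zT; have qp : q != p by rewrite eq_sym.
have zT' : [set q; p] \in cells M 1 by rewrite setUC.
have pT := edge_node zT; have qT := edge_node zT'.
have npq : [set q] != [set p] :> {set node M}.
  apply/eqP => h; have : q \in [set p] by rewrite -h inE.
  by rewrite inE (negbTE qp).
rewrite (bigD1 [set p]) /=; last by rewrite pT subsetUl.
rewrite (bigD1 [set q]) /=; last by rewrite qT subsetUr npq.
rewrite big1 ?addr0; last first.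
  move=> w /andP[/andP[/andP[wT wz] wp] wq].
  have /cellP[/eqP/cards1P[r wE] _] := wT; subst w.
  move: wz; rewrite sub1set !inE => /orP[]/eqP rE.
    by rewrite rE eqxx in wp.
  by rewrite rE eqxx in wq.
rewrite (incid_edge oM pq zT) [in X in _ + X]setUC (incid_edge oM qp zT').
by rewrite (sgn2C oM pq zT); ring.
Qed.

End Ends.

Section NodeEquations.
Variables (R : realType) (N : nat) (T : bc_mesh R N).
Hypothesis tT : triangulation T.
Hypothesis rT : regular T.
Hypothesis orn_sqr : forall K, K \in facets T -> orn K * orn K = 1.
Hypothesis oR : cell_orders (refined T).
Hypothesis rules : bc_rules T.
Local Notation V := 'rV[R]_N.
Local Notation T' := (refined T).
Implicit Types (a b c k x y : node T) (s u e f : {set node T}) (z w : {set node T'}).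
Let oT' : ordered T' := ordered_refined oR.
Let rule1 : bc_rule1 T. Proof. by case: rules. Qed.
Let rule2 : bc_rule2 T. Proof. by case: rules. Qed.
Let rule4 : bc_rule4_edges T. Proof. by case: rules. Qed.

Variable t : {set node T}.
Hypothesis tF : t \in facets T.

Definition nodal (p : node T') : R := coef 0 t [set p].
Definition lhs1 z : R := \sum_(w in cells T' 0 | w \subset z) coef 0 t w * incid w z.
Definition rhs1 z : R := - \sum_(s in cells T 1 | s \subset t) incid s t * coef 1 s z.
Definition defect z : R := lhs1 z - rhs1 z.

(** By dd = 0 on the refinement, the equations of the edges turn the boundary
    of the right hand side into a double boundary on T. *)
Lemma defect_closed Z : Z \in facets T' -> \sum_(z in cells T' 1) defect z * incid z Z = 0.
Proof.
move=> ZT; rewrite /defect; under eq_bigr do rewrite mulrBl.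
rewrite sumrB; apply/eqP; rewrite subr_eq0; apply/eqP.
transitivity (0 : R).
  rewrite /lhs1; under eq_bigr do rewrite incid_dropr mulr_suml.
  rewrite exchange_big; apply: big1 => w wT /=.
  have /cellP[/eqP/cards1P[p wE] _] := wT; subst w.
  under eq_bigr do rewrite -mulrA.
  by rewrite -mulr_sumr (incid_incid oT')// mulr0.
apply/esym; rewrite /rhs1; under eq_bigr do rewrite incid_dropl mulNr mulr_suml.
rewrite sumrN exchange_big /=.
transitivity (- \sum_(s in cells T 1) incid s t * rhs0 s Z).
  congr (- _); apply: eq_bigr => s sT; under eq_bigr do rewrite -mulrA.
  rewrite -mulr_sumr; congr (_ * _).
  have := equation0 rT orn_sqr oR rule1 rule2 rule4 sT ZT.
  by rewrite /bc_equation expr0 mul1r incid_dropr.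
rewrite /rhs0; under eq_bigr do rewrite incid_dropl mulr_sumr.
rewrite exchange_big big1 ?oppr0// => u uT /=.
have /cellP[/eqP/cards1P[p uE] _] := uT; subst u.
under eq_bigr do rewrite mulrA [incid _ t * _]mulrC.
by rewrite -mulr_suml (incid_incid rT)// mul0r.
Qed.

Lemma lhs1E (p q : node T') : p != q -> [set p; q] \in cells T' 1 ->
  lhs1 [set p; q] = sgn2 p q * (nodal q - nodal p).
Proof.
by move=> pq zT; exact: (sum_ends oT').
Qed.

Lemma no_node_edge s x : #|s| = 2%N -> (s : node T') != [set x].
Proof. by move=> s2; apply/eqP => h; move: s2; rewrite h cards1. Qed.

Lemma nodal_out (p : node T') : [set p] \in cells T' 0 -> ~~ ((p : {set node T}) \subset t) ->
  nodal p = 0.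
Proof. by move=> pT; apply: contraNeq => h; exact: (support0 rT oR rule1 tF pT h). Qed.

Lemma nodal_bd (p : node T') : [set p] \in cells T' 0 -> on_bd (facets T') [set p] -> nodal p = 0.
Proof. by move=> pT; apply: contraTeq => h; exact: (no_trace0 rT oR rule1 tF pT h). Qed.

Lemma nodal_top : nodal t = orn t.
Proof.
rewrite /nodal (rule2 (r := 2) isT (facet_cell rT tF) (facet_node_cell rT tF)).
  by rewrite (chain_coef0 rT)// (chain_size0 rT orn_sqr)// divr1.
rewrite (chain_coef0 rT)//; apply/eqP => h; have /eqP := orn_sqr tF.
by rewrite h mul0r eq_sym oner_eq0.
Qed.

Section Link.
Variables (a b c : node T).
Let e := [set a; b]. Let f := [set a; b; c].
Hypotheses (ab : a != b) (ac : a != c) (bc : b != c) (fT : f \in facets T).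
Let n3 : (e : node T') != f. Proof. by have [] := flag_neq ab ac bc. Qed.
Let eT : e \in cells T 1. Proof. exact: facet_edge ab fT. Qed.
Let wT : [set (e : node T'); f] \in cells T' 1.
Proof. by apply: spoke_cell => //; exact: subsetUl. Qed.

Lemma rhs1_link s : s \in cells T 1 -> coef 1 s [set (e : node T'); f] != 0 -> s = e.
Proof.
move=> sT h; have /cellP[s2 _] := sT; have /cellP[e2 _] := eT.
have [[x xs]|/(dual_edge rT _ sT)[f' [f'T sf'] wE]] := support1 rT oR rule1 sT wT h.
  rewrite !inE => /orP[]/eqP h1; first by move: (no_node_edge x e2); rewrite h1 eqxx.
  by have := reg_card rT fT; rewrite -h1 cards1.
have : (s : node T') \in [set (e : node T'); f] by rewrite wE !inE eqxx.
rewrite !inE => /orP[]/eqP // h1.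
by have := reg_card rT fT; rewrite -h1 s2.
Qed.

Lemma link_out : ~~ (e \subset t) -> defect [set (e : node T'); f] = 0.
Proof.
move=> et; rewrite /defect lhs1E// /rhs1 big1.
  rewrite (nodal_out (facet_node_cell rT fT)); last first.
    by apply: contra et => ft; apply: (subset_trans _ ft); exact: subsetUl.
  by rewrite (nodal_out (edge_node wT) et) subrr mulr0 oppr0 subrr.
move=> s /andP[sT st]; have [->|/(rhs1_link sT) sE] := eqVneq (coef 1 s [set (e : node T'); f]) 0.
  by rewrite mulr0.
by rewrite -sE st in et.
Qed.

Lemma link_in : e \subset t -> sgn2 (e : node T') f * defect [set (e : node T'); f] =
  nodal f - nodal e - incid e t * (orn f * incid e f) / (#|[set g in facets T | e \subset g]|)%:R.
Proof.
move=> et; rewrite /defect lhs1E// /rhs1 (bigD1 e) /=; last by rewrite eT.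
rewrite big1 ?addr0; last first.
  move=> s /andP[/andP[sT st] se]; have [->|/(rhs1_link sT) sE] := eqVneq (coef 1 s [set (e : node T'); f]) 0.
    by rewrite mulr0.
  by rewrite sE eqxx in se.
rewrite (coef1 rT orn_sqr oR rule2)//; last exact: subsetUl.
have h1 := chain_coef1 rT oR ab ac bc fT; have h2 := sgn2_sqr oT' n3 wT.
have h3 := orn_incid rT ab ac bc fT; rewrite -/e -/f in h1 h3.
rewrite -h3 in h1; rewrite -[orn f * _]opprK -h1.
move: h2; move: (sgn2 _ _) (nodal _) (nodal _) (incid _ _) (chain_coef _ _ _) (_%:R) => p q r i k n h2.
have -> : p * (p * (r - q) - - (i * (k / n))) = (p * p) * (r - q) - i * (- (p * k)) / n by ring.
by rewrite h2 mul1r.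
Qed.
End Link.

Lemma incid_unit a b c : a != b -> a != c -> b != c -> [set a; b; c] \in facets T ->
  incid [set a; b] [set a; b; c] * incid [set a; b] [set a; b; c] = 1 :> R.
Proof.
move=> ab ac bc fT; rewrite (incid_facet rT)// mulrACA (sgn2_sqr rT ab (facet_edge ab fT)).
by rewrite (sgn3_sqr rT)// mul1r.
Qed.

(** A boundary edge of the refinement at the midpoint of e must be a half of e,
    because those inside a facet have triangles on both sides. *)
Lemma edge_on_bd e f g : e \in cells T 1 -> on_bd (facets T') [set (e : node T')] ->
  f \in facets T -> e \subset f -> g \in facets T -> e \subset g -> f = g.
Proof.
move=> eT /existsP[u /andP[ub]]; rewrite sub1set => eu fT ef gT eg.
have /cellP[e2 _] := eT; have [u2 [K [KT uK uniq]]] := bdP oT' ub.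
have uT : u \in cells T' 1 by apply/cellP; split=> //; exists K.
have [a [b [c [ab ac bc hT uE]]]] := refined_edge rT uT.
have h3 := cards3 ab ac bc.
case: uE => uE; move: eu; rewrite uE !inE => /orP[]/eqP eE; try (by move: e2; rewrite eE ?cards1 ?h3);
  subst e.
- have [c1 [ac1 bc1 fE]] := card3_from2 (reg_card rT fT) (subsetP ef _ (set21 a b)) (subsetP ef _ (set22 a b)) ab.
  have [c2 [ac2 bc2 gE]] := card3_from2 (reg_card rT gT) (subsetP eg _ (set21 a b)) (subsetP eg _ (set22 a b)) ab.
  subst f g; have z1 := flag_facet ab ac1 bc1 fT; have z2 := flag_facet ab ac2 bc2 gT.
  have sub d : u \subset flag a b d.
    by rewrite uE; apply/subsetP => v; rewrite !inE => /orP[]/eqP->; rewrite eqxx ?orbT.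
  have e1 := uniq _ z1 (sub c1); have e2' := uniq _ z2 (sub c2).
  have : ([set a; b; c1] : node T') \in flag a b c2 by rewrite e2' -e1 mem3 eqxx !orbT.
  by move=> /(mem_flag3 rT fT ab ac2 bc2).
- have ba : b != a by rewrite eq_sym.
  have bacT : [set b; a; c] \in facets T by rewrite set3C12.
  have z1 := flag_facet ab ac bc hT; have z2 := flag_facet ba bc ac bacT.
  have s1 : u \subset flag a b c by rewrite uE; exact: link_sub.
  have s2 : u \subset flag b a c by rewrite uE -set3C12 [[set a; b]]setUC; exact: link_sub.
  have e1 := uniq _ z1 s1; have e2' := uniq _ z2 s2.
  have : ([set a] : node T') \in flag b a c by rewrite e2' -e1 mem3 eqxx.
  by move=> /(mem_flag1 ba bc ac) h; rewrite h eqxx in ab.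
Qed.

Hypothesis rule5 : bc_rule4_nodes T.

Lemma equation_defect z : bc_equation 1 t z <-> defect z = 0.
Proof.
rewrite /bc_equation /defect /lhs1 /rhs1 expr1 mulN1r; split=> [->|/eqP]; first by rewrite subrr.
by rewrite subr_eq0 => /eqP.
Qed.

(** The coefficient at the barycenter of t is orn t.  At the midpoint of an edge
    of t it is half of this, or 0 if the edge is on the boundary; these are
    the jumps which the halves of the dual edge prescribe. *)
Lemma link_zero a b c : a != b -> a != c -> b != c -> [set a; b; c] \in facets T ->
  defect [set ([set a; b] : node T'); [set a; b; c]] = 0.
Proof.
move=> ab ac bc fT; have [n1 n2 n3] := flag_neq ab ac bc.
set e := [set a; b]; set f := [set a; b; c].
have eT : e \in cells T 1 := facet_edge ab fT.
have ef : e \subset f := subsetUl _ _.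
have [et|] := boolP (e \subset t); last exact: link_out.
have wT := spoke_cell rT eT fT ef.
suff h : sgn2 (e : node T') f * defect [set (e : node T'); f] = 0.
  have /(congr1 (fun r => sgn2 (e : node T') f * r)) := h.
  by rewrite mulrA (sgn2_sqr oT' n3 wT) mul1r mulr0.
rewrite link_in// -/e -/f.
have [k [ak bk tE]] : exists k, [/\ a != k, b != k & t = [set a; b; k]].
  exact: (card3_from2 (reg_card rT tF) (subsetP et _ (set21 a b)) (subsetP et _ (set22 a b)) ab).
have tF' : [set a; b; k] \in facets T by rewrite -tE.
have ii : incid e t * incid e t = 1 :> R by rewrite tE; exact: incid_unit.
have eN : [set (e : node T')] \in cells T' 0 := edge_node wT.
pose D := [set g in facets T | e \subset g].
have tD : t \in D by rewrite inE tF.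
have fD : f \in D by rewrite inE fT.
have [ebd|eint] := boolP (on_bd (facets T') [set (e : node T')]).
  have ft : f = t := edge_on_bd eT ebd fT ef tF et.
  have -> : #|[set g in facets T | e \subset g]| = 1%N.
    rewrite (_ : [set g in facets T | e \subset g] = [set t]) ?cards1//.
    apply/setP => g; rewrite !inE; apply/andP/eqP => [[gT eg]|->//].
    exact: (edge_on_bd eT ebd gT eg tF et).
  rewrite (nodal_bd eN ebd) ft nodal_top subr0 divr1 mulrCA ii mulr1 subrr//.
have [n3' w'T] : (e : node T') != t /\ [set (e : node T'); t] \in cells T' 1.
  by rewrite tE; have [_ _ ?] := flag_neq ab ak bk; split=> //; apply: spoke_cell => //; exact: subsetUl.
have := rule5 (facet_cell rT tF) et; rewrite setUC => /(_ w'T eint)/equation_defect d0.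
have := link_in ab ak bk tF'; rewrite -tE -/e => /(_ et); rewrite d0 mulr0 nodal_top mulrCA ii mulr1.
have [ft|ft] := eqVneq f t.
  by rewrite ft => h; rewrite nodal_top mulrCA ii mulr1 -h.
have -> : #|[set g in facets T | e \subset g]| = 2%N.
  apply/eqP; rewrite eqn_leq (tri_edge tT eT) /=.
  have <- : #|[set f; t]| = 2%N by rewrite cards2 ft.
  by apply: subset_leq_card; apply/subsetP => g; rewrite in_set2 => /orP[]/eqP->.
have fn : ~~ (f \subset t).
  apply: contra ft => ft; rewrite eqEcard ft (reg_card rT fT) (reg_card rT tF) //.
rewrite (nodal_out (facet_node_cell rT fT) fn).
have nbe : ~~ on_bd (facets T) e.
  have /cellP[e2 _] := eT; rewrite (on_bd_edge rT e2); apply/negP => /(bdP rT)[_ [K [_ _ uK]]].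
  by move: ft; rewrite (uK f fT ef) (uK t tF et) eqxx.
have := reg_coherent rT eT nbe.
rewrite (bigD1 f) ?fT//= (bigD1 t) /= ?tF ?et ?[t == f]eq_sym ?ft// big1 ?addr0; last first.
  move=> g /andP[/andP[/andP[gT eg] gf] gt].
  have : (#|[set f; t; g]| <= 2)%N.
    apply: leq_trans (tri_edge tT eT); apply: subset_leq_card; apply/subsetP => x.
    by rewrite mem3 => /or3P[]/eqP->; rewrite inE ?fT ?tF ?gT ?ef ?et ?eg.
  by rewrite cards3// eq_sym.
move=> /eqP; rewrite addr_eq0 => /eqP -> h.
move: h; move: (nodal _) (orn t) (incid e t) ii => r o i ii h.
have -> : i * - (o * i) / 2%:R = - ((i * i) * o / 2%:R) by ring.
rewrite ii mul1r; have o2 : o = o / 2%:R + o / 2%:R by field.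
by move: h o2; move: (o / 2%:R) => o' h o2; rewrite sub0r opprK; lra.
Qed.

End NodeEquations.

(** * The equations of the facets *)

Section Spokes.
Variables (R : realType) (N : nat) (T : bc_mesh R N).
Hypothesis tT : triangulation T.
Hypothesis rT : regular T.
Hypothesis orn_sqr : forall K, K \in facets T -> orn K * orn K = 1.
Hypothesis oR : cell_orders (refined T).
Hypothesis rules : bc_rules T.
Local Notation T' := (refined T).
Implicit Types (a b c k x y : node T) (s e f : {set node T}) (u z w : {set node T'}).
Let oT' : ordered T' := ordered_refined oR.
Let rule1 : bc_rule1 T. Proof. by case: rules. Qed.
Let rule5 : bc_rule4_nodes T. Proof. by case: rules. Qed.

Variable t : {set node T}.
Hypothesis tF : t \in facets T.

Lemma defect_bd u : u \in bd (facets T') -> defect t u = 0.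
Proof.
move=> ub; have [u2 [K [KT uK _]]] := bdP oT' ub.
have uT : u \in cells T' 1 by apply/cellP; split=> //; exists K.
have nb w : w \subset u -> on_bd (facets T') w by move=> wu; apply/existsP; exists u; rewrite ub.
rewrite /defect /lhs1 /rhs1 big1; last first.
  move=> w /andP[wT wu]; have [->|h] := eqVneq (coef 0 t w) 0; first by rewrite mul0r.
  by have := no_trace0 rT oR rule1 tF wT h; rewrite nb.
rewrite big1 ?oppr0 ?addr0// => s /andP[sT st].
have [->|h] := eqVneq (coef 1 s u) 0; first by rewrite mulr0.
by have := no_trace1 rT oR rule1 sT uT h; rewrite nb.
Qed.

(** The defect is closed on the triangle and vanishes on the edge opposite to
    the node. *)
Lemma spoke_iff a b c : a != b -> a != c -> b != c -> [set a; b; c] \in facets T ->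
  defect t [set ([set a] : node T'); [set a; b]] = 0 <->
  defect t [set ([set a] : node T'); [set a; b; c]] = 0.
Proof.
move=> ab ac bc fT; have [n1 n2 n3] := flag_neq ab ac bc.
have ZT : flag a b c \in facets T' := flag_facet ab ac bc fT.
have ZT' : [set ([set a] : node T'); [set a; b; c]; [set a; b]] \in facets T'.
  by rewrite (@set3C23 (node T') [set a] [set a; b] [set a; b; c]).
have n3' : ([set a; b; c] : node T') != [set a; b] by rewrite eq_sym.
have h0 := link_zero tT rT orn_sqr oR rules tF rule5 ab ac bc fT.
have := defect_closed rT orn_sqr oR rules tF ZT.
rewrite (sum_edges_at (F := fun z => defect t z * incid z (flag a b c)) n1 n2 n3 ZT); last first.
  move=> z h; have [zZ cz] : z \subset flag a b c /\ #|flag a b c| = #|z|.+1.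
    by apply: (@incid_sub _ _ T'); apply: contraNneq h => ->; rewrite mulr0.
  split=> //; apply: contraNT h => az.
  have -> : z = [set ([set a; b] : node T'); [set a; b; c]].
    apply/eqP; rewrite eqEcard cards2 n3.
    have -> : (2 <= #|z|)%N by rewrite -ltnS -cz (reg_card oT' ZT).
    rewrite andbT; apply/subsetP => x xz; have := subsetP zZ x xz; rewrite mem3 !inE.
    by case/orP => // /eqP xa; rewrite -xa xz in az.
  by rewrite h0 mul0r.
have i1 := sgn_unit oT' n1 n2 n3 ZT; have i2 := sgn_unit oT' n2 n1 n3' ZT'.
rewrite (@set3C23 (node T') [set a] [set a; b] [set a; b; c]) in i2; rewrite -/(flag a b c) in i1 i2.
move: i1 i2; move: (incid _ _) (incid _ _) (defect t _) (defect t _) => i j p q hi hj h.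
split=> h1; move: h; rewrite h1 mul0r ?add0r ?addr0 => /eqP; rewrite mulf_eq0 ?(negbTE hi) ?(negbTE hj) orbF;
  by move/eqP.
Qed.

Lemma spoke_step a f g : f \in facets T -> g \in facets T -> a \in f :&: g -> #|f :&: g| = 2%N ->
  defect t [set ([set a] : node T'); f] = 0 -> defect t [set ([set a] : node T'); g] = 0.
Proof.
move=> fT gT afg c2; have [x [y [xy fgE]]] := subset_card2 c2.
have [b [ab fgE']] : exists b, a != b /\ f :&: g = [set a; b].
  move: afg; rewrite fgE !inE => /orP[]/eqP->; first by exists y.
  by exists x; rewrite eq_sym xy setUC.
have [bf bg] : b \in f /\ b \in g by apply/setIP; rewrite fgE' !inE eqxx orbT.
have /setIP[af ag] := afg.
have [c [ac bc fE]] := card3_from2 (reg_card rT fT) af bf ab.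
have [d [ad bd' gE]] := card3_from2 (reg_card rT gT) ag bg ab.
subst f g; move=> /(spoke_iff ab ac bc fT) h; exact/(spoke_iff ab ad bd' gT).
Qed.

(** The equation is trivial if a is not in t, prescribed if a is an interior
    node of t, and trivial on a boundary edge at a, where all coefficients
    vanish. *)
Lemma spoke_start a f : f \in facets T -> a \in f ->
  exists2 g, g \in facets T /\ a \in g & defect t [set ([set a] : node T'); g] = 0.
Proof.
move=> fT af; have [b [c [ab ac bc fE]]] := card3_from (reg_card rT fT) af.
have [n1 n2 n3] := flag_neq ab ac bc.
have aT : [set ([set a] : node T')] \in cells T' 0.
  have fT' : [set a; b; c] \in facets T by rewrite -fE.
  by apply: (facet_node (flag_facet ab ac bc fT')); rewrite mem3 eqxx.
have cell g : g \in facets T -> a \in g -> [set ([set a] : node T'); g] \in cells T' 1.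
  move=> gT ag; have [b' [c' [ab' ac' bc' gE]]] := card3_from (reg_card rT gT) ag; subst g.
  have [m1 m2 m3] := flag_neq ab' ac' bc'.
  apply: (facet_edge (c := [set a; b'] : node T') m2).
  by rewrite (@set3C23 (node T') [set a] [set a; b'] [set a; b'; c']); exact: flag_facet.
have [at_|at_] := boolP (a \in t); last first.
  exists f => //; have n : ([set a] : node T') != f by rewrite fE.
  rewrite /defect (lhs1E oR t n (cell f fT af)) /rhs1.
  rewrite (nodal_out rT oR rules tF aT) ?sub1set//.
  rewrite (nodal_out rT oR rules tF (facet_node_cell rT fT)); last first.
    by apply: contra at_ => /subsetP; apply.
  rewrite big1 ?oppr0 ?subrr ?mulr0 ?addr0 ?mulr0// => s /andP[sT st].
  have [->|h] := eqVneq (coef 1 s [set ([set a] : node T'); f]) 0; first by rewrite mulr0.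
  have /cellP[s2 _] := sT.
  have [[x xs]|/(dual_edge rT _ sT)[g [gT sg] wE]] := support1 rT oR rule1 sT (cell f fT af) h.
    rewrite !inE => /orP[]/eqP xE.
      have : x \in [set a] by rewrite -xE inE.
      by rewrite inE => /eqP xa; rewrite -xa (subsetP st) in at_.
    by have := reg_card rT fT; rewrite -xE cards1.
  have : (s : node T') \in [set ([set a] : node T'); f] by rewrite wE !inE eqxx.
  rewrite !inE => /orP[]/eqP sE; first by move: s2; rewrite sE cards1.
  by have := reg_card rT fT; rewrite -sE s2.
have [abd|aint] := boolP (on_bd (facets T') [set ([set a] : node T')]); last first.
  exists t => //; have := rule5 (p := [set a]) (facet_cell rT tF).
  rewrite sub1set setUC => /(_ at_ (cell t tF at_) aint) /equation_defect //.
have /existsP[u /andP[ub]] := abd; rewrite sub1set => au.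
have d0 := defect_bd ub; have [u2 [K [KT uK _]]] := bdP oT' ub.
have uT : u \in cells T' 1 by apply/cellP; split=> //; exists K.
have [a1 [b1 [c1 [ab1 ac1 bc1 hT uE]]]] := refined_edge rT uT.
have h3 := cards3 ab1 ac1 bc1.
have eq1 : ([set a] : node T') = [set a1] -> a = a1.
  by move=> h; have : a \in [set a1]; [rewrite -h inE|rewrite inE => /eqP].
have no2 x y : x != y -> ([set a] : node T') = [set x; y] -> False.
  by move=> xy h; have := cards1 a; rewrite h cards2 xy.
have no3 : ([set a] : node T') = [set a1; b1; c1] -> False.
  by move=> h; have := cards1 a; rewrite h h3.
case: uE => uE; move: au d0; rewrite uE !inE => /orP[]/eqP; try (by move=> /no3);
    try (by move=> /(no2 _ _ ab1)); move=> /eq1 aE d0; subst a1;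
    exists [set a; b1; c1]; rewrite ?mem3 ?eqxx//.
exact/(spoke_iff ab1 ac1 bc1 hT).
Qed.

(** The facets around a are connected through edges at a. *)
Lemma spoke_zero a f : f \in facets T -> a \in f -> defect t [set ([set a] : node T'); f] = 0.
Proof.
move=> fT af; have [g [gT ag] dg] := spoke_start fT af.
have /connectP[p pth ->] := tri_node tT gT fT ag af.
elim: p g {gT ag} dg pth => [|h p IH] g dg //= /andP[/and4P[gT hT agh /eqP c2] pth].
by apply: IH pth; exact: (spoke_step gT hT agh c2 dg).
Qed.

Lemma equation1 z : z \in cells T' 1 -> bc_equation 1 t z.
Proof.
move=> zT; apply/equation_defect.
have [a [b [c [ab ac bc fT [] ->]]]] := refined_edge rT zT.
- apply/(spoke_iff ab ac bc fT); apply: spoke_zero => //; by rewrite mem3 eqxx.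
- by apply: spoke_zero => //; rewrite mem3 eqxx.
- exact: (link_zero tT rT orn_sqr oR rules tF rule5 ab ac bc fT).
Qed.

End Spokes.

(** * The derivative of the dual basis *)

Section DualDerivative.
Variables (R : realType) (N : nat) (T : bc_mesh R N).
Hypothesis rT : regular T.
Hypothesis oR : cell_orders (refined T).
Local Notation T' := (refined T).

Lemma extd_mu q r t : (q + r = 1)%N -> 
  (forall z, z \in cells T' q.+1 -> bc_equation r t z) ->
  extd (mu q t) = fun K x V =>
    (-1) ^+ r * \sum_(s in cells T r) incid s t * mu (T := T) q.+1 s K x V.
Proof.
move=> qr E; have q1 : (q <= 1)%N by rewrite -qr leq_addr.
rewrite (_ : mu q t = wform (M := T') q (coef q t))// (extd_wform _ (regular_refined rT oR) q1).
apply/funext => K; apply/funext => x; apply/funext => V; rewrite /wform /mu.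
under [in RHS]eq_bigr do rewrite mulr_sumr.
rewrite exchange_big mulr_sumr; apply: eq_bigr => z zT /=.
have := E z zT; rewrite /bc_equation.
have -> : (1 - r = q)%N by rewrite -qr addnK.
have -> : (2 - r = q.+1)%N by rewrite -[2%N]/(1.+1) -qr -addSn addnK.
rewrite incid_dropr incid_dropl => ->; rewrite -mulrA; congr (_ * _).
by rewrite mulr_suml; apply: eq_bigr => s _; rewrite mulrA.
Qed.
End DualDerivative.

Lemma discretization_rules (R : realType) (N : nat) (c : bc_case) (T : bc_mesh R N) :
  bc_discretization c T -> dual_derivative c T /\ (no_trace T \/ c = WhitneyTraceZero).
Proof.
move=> [tT oR _ hc _]; have rT := triangulation_regular tT.
have orn_sqr K : K \in facets T -> orn K * orn K = 1.
  by move=> /(tri_orn tT)[]->; rewrite ?mulrNN mulr1.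
have main : c <> WhitneyTraceZero -> bc_rules T -> dual_derivative c T /\ no_trace T.
  move=> cW rules; have [r1 r2 _ r4 _] := rules; split; last exact: no_trace_rules.
  have dE r : dofs c T r = cells T r by case: (c) cW.
  move=> [|[|//]] t _; rewrite !dE => tc.
    by apply: (extd_mu rT oR) => // z; exact: (equation1 tT rT orn_sqr oR rules (cell_facet rT tc)).
  apply: (extd_mu rT oR) => // z /(cell_facet (ordered_refined oR)) zT.
  exact: equation0.
case: c hc main => hc main.
- by have [//|//|? ?] := main; split=> //; left.
- by have [//|//|? ?] := main; split=> //; left.
by split; [exact: hc.2|right].
Qed.

(** * The coupling operators commute with the exterior derivative *)

Theorem theorem4p2 (R : realType) (N : nat) (c : bc_case)
    (T : 'I_2 -> bc_mesh R N)
    (hT : forall i, bc_discretization c (T i))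
    (hsurf : forall i j, same_oriented_surface (T i) (T j))
    (Q : forall (j i : 'I_2) (r : nat), pform (T i) r -> pform (T j) r)
    (hQ : forall (j i : 'I_2) (r : nat), j != i -> (r <= 2)%N ->
       coupling_operator c (Q j i r)) :
  forall (j i : 'I_2) (r : nat), j != i -> (r <= 1)%N ->
  forall w : pform (T i) r, whitney_space c w ->
    extd (Q j i r w) = Q j i r.+1 (extd w).
Proof.
move=> j i r ji r1 w wW.
have [dm nt] := discretization_rules (hT j).
have [tT oR _ _ nd] := hT j; have [tM _ _ _ _] := hT i.
have rT := triangulation_regular tT; have rM := triangulation_regular tM.
have [vW hv] := hQ j i r ji (leqW r1) w wW.
have [uW hu] := hQ j i r.+1 ji r1 (extd w) (whitney_extd rM r1 wW).
have [nd1 _] := nd r.+1 r1.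
apply: (@commute R N c (T j) rT oR dm nt (T i) (1 - r)%N r w) => //.
- by rewrite subnK.
- by case: r r1 w wW vW hv uW hu nd1 => [|[|//]].
Qed.
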